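(* Let $r=pq-p-q$ and let $G\subseteq\widetilde\Gamma$ be the subgroup generated by $\alpha^{r}$ and $\beta^{r}$. Define $$\Psi\colon \mathbb H^2\times\widetilde{\mathbb C^\times}\to\mathbb C^2,\qquad \Psi(z,w)=(\omega_b(z,w),\,\omega_a(z,w)).$$ Then $\Psi$ is constant on the orbits of $G$ (acting by $\gamma(z,w)=(\gamma(z),\gamma'(z)w)$), so it induces a map $\overline\Psi\colon M:=(\mathbb H^2\times\widetilde{\mathbb C^\times})/G\to\mathbb C^2$; the image of $\overline\Psi$ is contained in $\mathbb C^2\setminus V$, where $V=\{(z_1,z_2)\in\mathbb C^2: c_b z_1^q+c_a z_2^p=0\}$ and $c_a,c_b$ are the nonzero constants with $\omega_\infty=c_a\omega_a^p+c_b\omega_b^q$; and $\overline\Psi\colon M\to\mathbb C^2\setminus V$ is biholomorphic.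
   Context: Fix coprime integers $2\le p<q$. Let $\mathbb H^2=\{z\in\mathbb C:\operatorname{Im}z>0\}$, with $PSL_2(\mathbb R)$ acting by Möbius transformations. $\widetilde{SL_2}(\mathbb R)$ is the universal covering group of $PSL_2(\mathbb R)$ with covering homomorphism $\tilde P$; it acts on $\mathbb H^2$ through $\tilde P$. Let $\widetilde{\mathbb C^\times}$ be the universal cover of $\mathbb C^\times$, identified with $\mathbb C$ via $u\mapsto e^u$ (elements written $e^u$, $u\in\mathbb C$); for $k\in\mathbb Q$ put $(e^u)^k=e^{ku}$, and write $\bar w\in\mathbb C^\times$ for the image of $w$. Each $\gamma\in\widetilde{SL_2}(\mathbb R)$ has a derivative $\gamma'\colon\mathbb H^2\to\widetilde{\mathbb C^\times}$, the lift of $\frac{d}{dz}\tilde P(\gamma)(z)$ determined by continuity in $\gamma$ with $\mathrm{id}'=1$ (so the chain rule $(\gamma_2\gamma_1)'(z)=\gamma_2'(\gamma_1 z)\gamma_1'(z)$ holds); $\widetilde{SL_2}(\mathbb R)$ acts freely on $\mathbb H^2\times\widetilde{\mathbb C^\times}$ by $\gamma(z,w)=(\gamma(z),\gamma'(z)w)$. The center $C=\ker\tilde P\cong\mathbb Z$ is generated by $c$, which acts trivially on $\mathbb H^2$ with $c'(z)=e^{2\pi i}$. A form of degree $k\in\mathbb Q$ is a function $\omega(z,w)=f(z)\,\overline{w^k}$ on $\mathbb H^2\times\widetilde{\mathbb C^\times}$ with $f$ holomorphic on $\mathbb H^2$ (written $\omega=f\,dz^k$). Let $\alpha_0,\beta_0\in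 PSL_2(\mathbb R)$ be the classes of $A_0=\begin{pmatrix}2\cos(\pi/p)&1\\-1&0\end{pmatrix}$ and $B_0=\begin{pmatrix}0&1\\-1&2\cos(\pi/q)\end{pmatrix}$, and $\Gamma_{p,q}=\langle\alpha_0,\beta_0\rangle$ (the $(p,q,\infty)$-triangle group, $\cong\langle\alpha_0,\beta_0\mid\alpha_0^p=\beta_0^q=1\rangle$). Its elliptic fixed points are $a=-\cos(\pi/p)+i\sin(\pi/p)$ (for $\alpha_0$) and $b=\cos(\pi/q)+i\sin(\pi/q)$ (for $\beta_0$); it has one cusp class, that of $\infty$, stabilized by $\gamma_0=(\alpha_0\beta_0)^{-1}\colon z\mapsto z+\lambda$, $\lambda=2(\cos\frac\pi p+\cos\frac\pi q)$. Let $\widetilde\Gamma=\tilde P^{-1}(\Gamma_{p,q})$ and let $\alpha,\beta\in\widetilde\Gamma$ be the unique lifts of $\alpha_0,\beta_0$ with $\alpha^p=\beta^q=c$. Let $\theta\colon\mathbb H^2\to\mathbb C$ be a holomorphic $\Gamma_{p,q}$-invariant function inducing a bijection $\mathbb H^2/\Gamma_{p,q}\to\mathbb C$ with $\theta(a)=0$, $\theta(b)=1$ (it has a simple pole at the cusp $\infty$). Let $r=pq-p-q$ and let $f_a,f_b,f_\infty$ be holomorphic branches on $\mathbb H^2$ of $$\Big(\tfrac{(\theta')^q}{\theta(\theta-1)^{q-1}}\Big)^{1/r},\quad \Big(\tfrac{(\theta')^p}{\theta^{p-1}(\theta-1)}\Big)^{1/r},\quad \Big(\tfrac{(\theta')^{pq}}{\theta^{(p-1)q}(\theta-1)^{p(q-1)}}\Big)^{1/r}$$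 respectively, and set $\omega_a=f_a\,dz^{q/r}$, $\omega_b=f_b\,dz^{p/r}$, $\omega_\infty=f_\infty\,dz^{pq/r}$. (It is a result of the paper that $\omega_\infty=c_a\omega_a^p+c_b\omega_b^q$ for some nonzero constants $c_a,c_b$, and that $\omega_\infty$ vanishes nowhere on $\mathbb H^2\times\widetilde{\mathbb C^\times}$.) *)

(* Defs.v *)
From Stdlib Require Import Reals Lra Relations.
From Coquelicot Require Import Coquelicot.
Set Implicit Arguments.
Open Scope R_scope.

Definition Cexp (u : C) : C :=
  (exp (Re u) * cos (Im u), exp (Re u) * sin (Im u)).

Definition two_pi_i : C := (0, 2 * PI).

Definition inH (z : C) : Prop := 0 < Im z.

Definition Cderiv (f : C -> C) (z l : C) : Prop :=
  @is_derive C_AbsRing C_NormedModule f z l.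

Definition Choloat (f : C -> C) (z : C) : Prop :=
  @ex_derive C_AbsRing C_NormedModule f z.

Definition C2 : NormedModule C_AbsRing :=
  prod_NormedModule C_AbsRing C_NormedModule C_NormedModule.

Definition holo2_at (f : C * C -> C * C) (x : C * C) : Prop :=
  @ex_filterdiff C_AbsRing C2 C2 f (locally (x : C2)).

Definition C2dist (x y : C * C) : R :=
  Rmax (Cmod (fst x - fst y)%C) (Cmod (snd x - snd y)%C).

Record mat2 := Mat2 { ma : R; mb : R; mc : R; md : R }.

Definition mat_mul (M N : mat2) : mat2 :=
  Mat2 (ma M * ma N + mb M * mc N) (ma M * mb N + mb M * md N)
       (mc M * ma N + md M * mc N) (mc M * mb N + md M * md N).

Definition mat_id : mat2 := Mat2 1 0 0 1.
Definition mat_opp (M : mat2) : mat2 := Mat2 (- ma M) (- mb M) (- mc M) (- md M).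
Definition mat_det (M : mat2) : R := ma M * md M - mb M * mc M.

Definition psl_eq (M N : mat2) : Prop := M = N \/ M = mat_opp N.

Definition mob (M : mat2) (z : C) : C :=
  ((RtoC (ma M) * z + RtoC (mb M)) / (RtoC (mc M) * z + RtoC (md M)))%C.

(* An element of the universal cover ~SL_2(R) is modelled (as usual) by a
   pair (M, L) with M in SL_2(R) (taken modulo +-1) and L : H -> C a continuous
   logarithm of the derivative of the Moebius map, i.e. gamma'(z) = e^{L z}
   in the universal cover of C^x identified with C via u |-> e^u. *)
Record lift := Lift { lmat : mat2 ; llog : C -> C }.

Definition is_lift (g : lift) : Prop :=
  mat_det (lmat g) = 1 /\
  forall z, inH z ->
    continuous (llog g) z /\
    Cexp (llog g z) = Cinv ((RtoC (mc (lmat g)) * z + RtoC (md (lmat g))) ^ 2)%C.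

Definition lift_eq (g h : lift) : Prop :=
  psl_eq (lmat g) (lmat h) /\ forall z, inH z -> llog g z = llog h z.

(* group law (chain rule) *)
Definition lift_comp (g2 g1 : lift) : lift :=
  Lift (mat_mul (lmat g2) (lmat g1))
       (fun z => (llog g2 (mob (lmat g1) z) + llog g1 z)%C).

Definition lift_id : lift := Lift mat_id (fun _ => RtoC 0).

Fixpoint lift_pow (g : lift) (n : nat) : lift :=
  match n with O => lift_id | S k => lift_comp g (lift_pow g k) end.

(* generator c of the center: trivial on H, c'(z) = e^{2 pi i} *)
Definition lift_c : lift := Lift mat_id (fun _ => two_pi_i).

(* action on H x ~C^x (with ~C^x = C via e^u): gamma(z, e^u) = (gamma z, gamma'(z) e^u) *)
Definition lift_act (g : lift) (x : C * C) : C * C :=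
  (mob (lmat g) (fst x), (llog g (fst x) + snd x)%C).

Definition A0 (p : nat) : mat2 := Mat2 (2 * cos (PI / INR p)) 1 (-1) 0.
Definition B0 (q : nat) : mat2 := Mat2 0 1 (-1) (2 * cos (PI / INR q)).

Definition pt_a (p : nat) : C := (- cos (PI / INR p), sin (PI / INR p)).
Definition pt_b (q : nat) : C := (cos (PI / INR q), sin (PI / INR q)).

Definition Gamma_orb (p q : nat) : C -> C -> Prop :=
  clos_refl_sym_trans C
    (fun z w => inH z /\ (w = mob (A0 p) z \/ w = mob (B0 q) z)).

(* orbit relation on H x ~C^x of the subgroup generated by g1 and g2
   (equivalence closure of one-step moves by the generators; since the
   generators act bijectively this is exactly the orbit relation of <g1,g2>) *)
Definition orb2 (g1 g2 : lift) : C * C -> C * C -> Prop :=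
  clos_refl_sym_trans (C * C)
    (fun x y => inH (fst x) /\ (y = lift_act g1 x \/ y = lift_act g2 x)).

(* a form f dz^k evaluated at (z, e^u): f(z) * e^{k u} *)
Definition form (k : R) (f : C -> C) (x : C * C) : C :=
  (f (fst x) * Cexp (RtoC k * snd x))%C.

Definition rpq (p q : nat) : nat := (p * q - p - q)%nat.

Definition Psi (p q : nat) (fa fb : C -> C) (x : C * C) : C * C :=
  (form (INR p / INR (rpq p q)) fb x, form (INR q / INR (rpq p q)) fa x).

(* Main.v *)
Require Import Defs.
From Stdlib Require Import Reals Lra Lia Psatz ZArith Classical ClassicalEpsilon Relations List.
From Coquelicot Require Import Coquelicot.
Open Scope R_scope.

(** Write [F], [A], [B] for [finf], [fa], [fb].  A word in [A0], [B0] that fixes a point of the upper half-plane with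
    multiplier different from 1 has trace of modulus less than 2.  By cyclic reduction it is then conjugate to a
    power of [A0] or [B0]: otherwise it is conjugate to a product of blocks [A0^i B0^j] with [0 < i < p], [0 < j < q],
    and up to sign these have diagonal entries at least 1 and nonpositive off-diagonal entries, so that the trace
    has modulus at least 2.  If [theta] has order [m] at [z0], the local [m]-fold symmetry of [theta] is
    realized by an element of the group (the fibres of [theta] are orbits and they are discrete), which therefore
    fixes [z0] with multiplier a primitive [m]-th root of unity.  Hence [m = p] over 0, [m = q] over 1 and [m = 1]
    elsewhere.  It follows that [F] has no zeros, that [ca A^p = theta F] and [cb B^q = (1 - theta) F], and that
    [p A' B - q A B'] has no zeros.

    Invariance: [F] is multiplied by a constant [r]-th root of unity under a generator, so [alpha^r] and [beta^r]
    preserve the form of [F], and then those of [A] and [B] since [p] and [q] are prime to [r].  Injectivity: the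
    values of the two forms determine [theta], and [G] is transitive on each orbit of the triangle group as [r] is
    prime to [p] and [q]; what remains is a shift of the logarithmic coordinate, which is realized by the center or
    by the stabilizer of an elliptic point.  Surjectivity follows from that of [theta] and the Chinese remainder
    theorem, and local sections come from the nonvanishing Wronskian.  Holomorphic means complex differentiable at every
    point, so analyticity rests on Goursat's lemma and Cauchy's formula. *)

(** * Complex differentiability *)

(** [theta] is given only as an invariant function whose fibres are orbits, with no fundamental
    domain and no expansion at an elliptic point. Its order there comes from two opposite
    divisibilities: a stabilizer element with primitive multiplier forces its order to divide that
    of [theta], and the local symmetry of [theta], realized in the group, gives the converse.

    [fa] vanishes over 0 and [fb] over 1, so the quotient of the transformed form by the form is not
    everywhere defined; only for [finf] is it a continuous function with values in a finite set. The
    other two forms are recovered from two coprime powers, which replaces any tracking of branches.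

    The exponent [r] of the generators is dictated by the shifts [d] of the logarithmic coordinate
    that preserve the values. Where both forms are nonzero, [p d / r] and [q d / r] lie in
    [2 pi i Z], so [d] lies in [r 2 pi i Z], the lattice of [c^r = (alpha^r)^p]. At a zero of [fa]
    only [p d / r] is constrained; the lattice is finer by the factor [p], and [alpha^r] generates
    it at its fixed point. *)

Lemma Cmod_minus_sym (x y : C) : Cmod (x - y)%C = Cmod (y - x)%C.
Proof. rewrite <- Cmod_opp; f_equal; ring. Qed.

Lemma Cmod_triangle3 (x y z : C) : Cmod (x - z)%C <= Cmod (x - y)%C + Cmod (y - z)%C.
Proof. replace (x - z)%C with ((x - y) + (y - z))%C by ring; apply Cmod_triangle. Qed.

Lemma Cmod_sub_ge (x y : C) : Cmod x - Cmod y <= Cmod (x - y)%C.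
Proof. generalize (Cmod_triangle (x - y)%C y); replace (x - y + y)%C with x by ring; lra. Qed.

Lemma Cmod_sub_le (x y : C) : Cmod (x - y)%C <= Cmod x + Cmod y.
Proof. generalize (Cmod_triangle x (- y)%C); rewrite Cmod_opp; intros H; exact H. Qed.

Lemma Cmod_self (z : C) : Cmod (z - z)%C = 0.
Proof. replace (z - z)%C with (RtoC 0) by ring; apply Cmod_0. Qed.

Lemma Cmod_sub_0 (x y : C) : Cmod (x - y)%C = 0 -> x = y.
Proof.
intros H; apply Cmod_eq_0 in H.
replace x with ((x - y) + y)%C by ring; rewrite H; ring.
Qed.

Lemma Cmod_sub_pos (x y : C) : x <> y -> 0 < Cmod (x - y)%C.
Proof.
intros H; destruct (Cmod_ge_0 (x - y)%C) as [H0|H0]; trivial.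
elim H; apply Cmod_sub_0; auto.
Qed.

Lemma RtoC_neq_0 (x : R) : x <> 0 -> RtoC x <> 0.
Proof. intros H E; apply RtoC_inj in E; auto. Qed.

Lemma Cinv_neq_0 (x : C) : x <> 0 -> (/ x)%C <> 0.
Proof.
intros H; apply Cmod_gt_0; rewrite Cmod_inv by trivial.
apply Rinv_0_lt_compat, Cmod_gt_0; trivial.
Qed.

Lemma Cmult_eq_0 (x y : C) : (x * y)%C = 0 -> x = 0 \/ y = 0.
Proof.
intros H; destruct (Ceq_dec x 0) as [|Hx]; [auto|]; destruct (Ceq_dec y 0) as [|Hy]; [auto|].
elim (Cmult_neq_0 x y Hx Hy H).
Qed.

Lemma Cmult_cancel (a b c : C) : a <> 0 -> (a * b)%C = (a * c)%C -> b = c.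
Proof.
intros Ha E; transitivity (a * b / a)%C; [field; trivial|rewrite E; field; trivial].
Qed.

Lemma Cpow_eq_0 (x : C) n : (x ^ n)%C = 0 -> x = 0.
Proof.
intros H; destruct (Ceq_dec x 0) as [|Hx]; trivial; elim (Cpow_nz x n Hx H).
Qed.

Lemma Cpow_0_l n : (0 < n)%nat -> (RtoC 0 ^ n)%C = 0.
Proof. destruct n; [lia|intros _; rewrite Cpow_S; ring]. Qed.

Lemma im_le_Cmod (c : C) : Rabs (Im c) <= Cmod c.
Proof. apply Rle_trans with (2 := Rmax_Cmod c); apply Rmax_r. Qed.

Lemma Cmod_le_abs (c : C) : Cmod c <= Rabs (Re c) + Rabs (Im c).
Proof.
unfold Cmod; fold (Re c) (Im c).
rewrite <- (sqrt_Rsqr (Rabs (Re c) + Rabs (Im c))).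
2:{ generalize (Rabs_pos (Re c)) (Rabs_pos (Im c)); lra. }
apply sqrt_le_1_alt; unfold Rsqr.
rewrite <- (pow2_abs (Re c)), <- (pow2_abs (Im c)).
generalize (Rabs_pos (Re c)) (Rabs_pos (Im c)); nra.
Qed.

(** * Neighbourhoods, continuity and derivatives in terms of the modulus *)

Lemma locally_Cmod (z : C) (P : C -> Prop) :
  locally z P <-> exists d, 0 < d /\ forall w, Cmod (w - z)%C < d -> P w.
Proof.
split.
- intros H.
  apply (locally_norm_le_locally (K := C_AbsRing) (V := C_NormedModule)) in H.
  destruct H as [d Hd]; exists (pos d); split; [apply cond_pos|].
  intros w Hw; apply Hd; exact Hw.
- intros [d [Hd H]].
  apply (locally_le_locally_norm (K := C_AbsRing) (V := C_NormedModule)).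
  exists (mkposreal d Hd); intros w Hw; apply H; exact Hw.
Qed.

Lemma continuous_C (f : C -> C) (z : C) :
  continuous f z <-> forall e, 0 < e -> exists d, 0 < d /\
    forall w, Cmod (w - z)%C < d -> Cmod (f w - f z)%C < e.
Proof.
split.
- intros H e He; apply locally_Cmod; apply (H (fun y => Cmod (y - f z)%C < e)).
  apply locally_Cmod; exists e; split; auto.
- intros H P HP; apply locally_Cmod in HP; destruct HP as [e [He HP]].
  destruct (H e He) as [d [Hd Hw]]; apply locally_Cmod; exists d; split; trivial.
  intros w Hw'; apply HP; auto.
Qed.

Lemma continuous_RC (f : R -> C) (t : R) :
  continuous f t <-> forall e, 0 < e -> exists d, 0 < d /\
    forall s, Rabs (s - t) < d -> Cmod (f s - f t)%C < e.
Proof.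
split.
- intros H e He.
  assert (HH : locally t (fun s => Cmod (f s - f t)%C < e)).
  { apply (H (fun y => Cmod (y - f t)%C < e)); apply locally_Cmod; exists e; split; auto. }
  destruct HH as [d Hd]; exists (pos d); split; [apply cond_pos|].
  intros s Hs; apply Hd; exact Hs.
- intros H P HP; apply locally_Cmod in HP; destruct HP as [e [He HP]].
  destruct (H e He) as [d [Hd Hw]]; exists (mkposreal d Hd).
  intros s Hs; apply HP, Hw; exact Hs.
Qed.

(** [C] carries two uniform structures, the product one of the normed module and the one of the
    absolute value. They have the same neighbourhoods but are not convertible; derivatives take
    limits in the second one. *)
Lemma locally_CA (z : C) (P : C -> Prop) :
  @locally (AbsRing_UniformSpace C_AbsRing) z P <->
  exists d, 0 < d /\ forall w, Cmod (w - z)%C < d -> P w.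
Proof.
split.
- intros [d Hd]; exists (pos d); split; [apply cond_pos|]; intros w Hw; apply Hd; exact Hw.
- intros [d [Hd H]]; exists (mkposreal d Hd); intros w Hw; apply H; exact Hw.
Qed.

Lemma Cderiv_eps (f : C -> C) (z l : C) :
  Cderiv f z l <-> forall e, 0 < e -> exists d, 0 < d /\
    forall w, Cmod (w - z)%C < d ->
      Cmod (f w - f z - (w - z) * l)%C <= e * Cmod (w - z)%C.
Proof.
split.
- intros [_ H] e He.
  specialize (H z (fun P Q => Q) (mkposreal e He)).
  apply locally_CA in H; destruct H as [d [Hd H]].
  exists d; split; trivial; intros w Hw; exact (H w Hw).
- intros H; split; [apply is_linear_scal_l|].
  intros x Hx e.
  apply (@is_filter_lim_locally_unique C_AbsRing (AbsRing_NormedModule C_AbsRing)) in Hx; subst x.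
  destruct (H e (cond_pos e)) as [d [Hd H1]].
  apply locally_CA; exists d; split; trivial; intros w Hw; exact (H1 w Hw).
Qed.

(** Bridge to the product and chain rules, which are stated with the ring as a normed module over
    itself. *)
Lemma Cderiv_abs (f : C -> C) (z l : C) :
  Cderiv f z l <-> @is_derive C_AbsRing (AbsRing_NormedModule C_AbsRing) f z l.
Proof.
split; intros [_ H]; (split; [apply is_linear_scal_l|exact H]).
Qed.

Lemma Cderiv_ext_loc (f g : C -> C) (z l : C) d :
  0 < d -> (forall w, Cmod (w - z)%C < d -> f w = g w) -> Cderiv f z l -> Cderiv g z l.
Proof.
intros Hd H; apply (is_derive_ext_loc (K := C_AbsRing) (V := C_NormedModule)).
apply locally_CA; eauto.
Qed.

Lemma Cderiv_ext (f g : C -> C) (z l : C) :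
  (forall w, f w = g w) -> Cderiv f z l -> Cderiv g z l.
Proof. intros H; apply Cderiv_ext_loc with 1; auto; lra. Qed.

Lemma Cderiv_const (c z : C) : Cderiv (fun _ => c) z 0.
Proof. exact (@is_derive_const C_AbsRing C_NormedModule c z). Qed.

Lemma Cderiv_id (z : C) : Cderiv (fun w => w) z 1.
Proof. apply Cderiv_abs; exact (@is_derive_id C_AbsRing z). Qed.

Lemma Cderiv_plus (f g : C -> C) (z a b : C) :
  Cderiv f z a -> Cderiv g z b -> Cderiv (fun w => f w + g w)%C z (a + b)%C.
Proof. exact (@is_derive_plus C_AbsRing C_NormedModule f g z a b). Qed.

Lemma Cderiv_minus (f g : C -> C) (z a b : C) :
  Cderiv f z a -> Cderiv g z b -> Cderiv (fun w => f w - g w)%C z (a - b)%C.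
Proof. exact (@is_derive_minus C_AbsRing C_NormedModule f g z a b). Qed.

Lemma Cderiv_mult (f g : C -> C) (z a b : C) :
  Cderiv f z a -> Cderiv g z b -> Cderiv (fun w => f w * g w)%C z (a * g z + f z * b)%C.
Proof. rewrite !Cderiv_abs; intros Hf Hg; exact (@is_derive_mult C_AbsRing f g z a b Hf Hg Cmult_comm). Qed.

Lemma Cderiv_comp (f g : C -> C) (z a b : C) :
  Cderiv f (g z) a -> Cderiv g z b -> Cderiv (fun w => f (g w)) z (b * a)%C.
Proof.
rewrite (Cderiv_abs g); exact (@is_derive_comp C_AbsRing C_NormedModule f g z a b).
Qed.

Lemma Cderiv_val (f : C -> C) (z a b : C) : Cderiv f z a -> a = b -> Cderiv f z b.
Proof. intros H <-; exact H. Qed.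

Lemma Cderiv_cont (f : C -> C) (z a : C) : Cderiv f z a -> continuous f z.
Proof.
intros H.
assert (Hc := @ex_derive_continuous C_AbsRing C_NormedModule f z (ex_intro _ a H)).
intros P HP; apply locally_Cmod; apply locally_CA; exact (Hc P HP).
Qed.

Lemma Choloat_cont (f : C -> C) (z : C) : Choloat f z -> continuous f z.
Proof. intros [a H]; apply (Cderiv_cont _ _ _ H). Qed.

Lemma Cderiv_unique (f : C -> C) (z a b : C) : Cderiv f z a -> Cderiv f z b -> a = b.
Proof.
intros Ha Hb; destruct (Ceq_dec a b) as [|Hab]; trivial.
apply Cmod_sub_pos in Hab.
rewrite Cderiv_eps in Ha, Hb.
destruct (Ha (Cmod (a - b)%C / 4)) as [d1 [Hd1 H1]]; [lra|].
destruct (Hb (Cmod (a - b)%C / 4)) as [d2 [Hd2 H2]]; [lra|].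
set (d := Rmin d1 d2 / 2).
assert (Hd : 0 < d) by (unfold d; generalize (Rmin_glb_lt _ _ _ Hd1 Hd2); lra).
assert (Hm : Cmod (z + RtoC d - z)%C = d).
{ replace (z + RtoC d - z)%C with (RtoC d) by ring; rewrite Cmod_R; apply Rabs_pos_eq; lra. }
specialize (H1 (z + RtoC d)%C); specialize (H2 (z + RtoC d)%C).
rewrite Hm in H1, H2.
assert (d < d1) by (unfold d in *; generalize (Rmin_l d1 d2); lra).
assert (d < d2) by (unfold d in *; generalize (Rmin_r d1 d2); lra).
specialize (H1 H); specialize (H2 H0).
assert (H3 : Cmod ((z + RtoC d - z) * (a - b))%C <= Cmod (a - b)%C / 4 * d + Cmod (a - b)%C / 4 * d).
{ eapply Rle_trans; [|apply Rplus_le_compat; [exact H2|exact H1]].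
  eapply Rle_trans; [|apply Cmod_sub_le]; right; f_equal; ring. }
rewrite Cmod_mult, Hm in H3; nra.
Qed.

Lemma Cderiv_inv (f : C -> C) (z a : C) :
  Cderiv f z a -> f z <> 0 -> Cderiv (fun w => / f w)%C z (- a / (f z * f z))%C.
Proof.
intros Hf Hz.
assert (Hi : Cderiv Cinv (f z) (- / (f z * f z))%C).
{ generalize (f z) Hz; clear; intros y Hy.
  apply Cderiv_eps; intros e He.
  assert (Hm : 0 < Cmod y) by (apply Cmod_gt_0; auto).
  set (m := Cmod y) in *.
  exists (Rmin (m / 2) (e * (m * m * m) / 2)); split.
  { apply Rmin_glb_lt; [lra|]. apply Rdiv_lt_0_compat; [|lra].
    apply Rmult_lt_0_compat; [lra|]; apply Rmult_lt_0_compat; nra. }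
  intros w Hw.
  assert (Hw1 : Cmod (w - y)%C < m / 2) by (eapply Rlt_le_trans; [exact Hw|apply Rmin_l]).
  assert (Hw2 : Cmod (w - y)%C < e * (m * m * m) / 2) by (eapply Rlt_le_trans; [exact Hw|apply Rmin_r]).
  assert (Hwm : m / 2 < Cmod w).
  { generalize (Cmod_sub_ge y w); rewrite Cmod_minus_sym; fold m; lra. }
  assert (Hw0 : w <> 0) by (apply Cmod_gt_0; lra).
  replace (/ w - / y - (w - y) * - / (y * y))%C with ((w - y) * (w - y) * (/ w * (/ y * / y)))%C
    by (field; auto).
  rewrite !Cmod_mult, !Cmod_inv; trivial; fold m.
  set (t := Cmod (w - y)%C) in *; set (W := Cmod w) in *.
  assert (0 <= t) by apply Cmod_ge_0.
  rewrite Rmult_assoc, (Rmult_comm e); apply Rmult_le_compat_l; trivial.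
  replace (t * (/ W * (/ m * / m))) with (t / (W * (m * m))) by (field; lra).
  assert (0 < m * m) by nra.
  apply Rle_div_l; [apply Rmult_lt_0_compat; lra|].
  apply Rle_trans with (e * (m / 2 * (m * m))); [lra|].
  apply Rmult_le_compat_l; [lra|]; apply Rmult_le_compat_r; lra. }
eapply Cderiv_val; [apply Cderiv_comp with (1 := Hi) (2 := Hf)|].
field; auto.
Qed.

Lemma Cderiv_div (f g : C -> C) (z a b : C) :
  Cderiv f z a -> Cderiv g z b -> g z <> 0 ->
  Cderiv (fun w => f w / g w)%C z ((a * g z - f z * b) / (g z * g z))%C.
Proof.
intros Hf Hg Hz; eapply Cderiv_val.
- apply Cderiv_mult; [exact Hf|apply Cderiv_inv; [exact Hg|exact Hz]].
- cbv beta; field; auto.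
Qed.

Lemma Cderiv_pow (f : C -> C) (z a : C) n :
  Cderiv f z a -> Cderiv (fun w => f w ^ n)%C z (RtoC (INR n) * a * f z ^ (n - 1))%C.
Proof.
intros Hf; induction n as [|n IH].
- eapply Cderiv_val; [exact (Cderiv_const 1 z)|simpl; ring].
- eapply Cderiv_val.
  + simpl; apply Cderiv_mult; [exact Hf|exact IH].
  + destruct n as [|n]; [simpl; ring|].
    replace (S (S n) - 1)%nat with (S n) by lia.
    replace (S n - 1)%nat with n by lia.
    rewrite !S_INR, !RtoC_plus, !Cpow_S; ring.
Qed.

Lemma Choloat_const (c z : C) : Choloat (fun _ => c) z.
Proof. eexists; apply Cderiv_const. Qed.

Lemma Choloat_id (z : C) : Choloat (fun w => w) z.
Proof. eexists; apply Cderiv_id. Qed.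

Lemma Choloat_minus (f g : C -> C) (z : C) :
  Choloat f z -> Choloat g z -> Choloat (fun w => f w - g w)%C z.
Proof. intros [a Ha] [b Hb]; eexists; apply Cderiv_minus; eassumption. Qed.

Lemma Choloat_mult (f g : C -> C) (z : C) :
  Choloat f z -> Choloat g z -> Choloat (fun w => f w * g w)%C z.
Proof. intros [a Ha] [b Hb]; eexists; apply Cderiv_mult; eassumption. Qed.

Lemma Choloat_div (f g : C -> C) (z : C) :
  Choloat f z -> Choloat g z -> g z <> 0 -> Choloat (fun w => f w / g w)%C z.
Proof. intros [a Ha] [b Hb] Hz; eexists; apply Cderiv_div; eassumption. Qed.

Lemma Choloat_pow (f : C -> C) (z : C) n :
  Choloat f z -> Choloat (fun w => f w ^ n)%C z.
Proof. intros [a Ha]; eexists; apply Cderiv_pow; eassumption. Qed.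

Lemma Choloat_comp (f g : C -> C) (z : C) :
  Choloat f (g z) -> Choloat g z -> Choloat (fun w => f (g w)) z.
Proof. intros [a Ha] [b Hb]; eexists; apply Cderiv_comp; eassumption. Qed.

Lemma Choloat_ext_loc (f g : C -> C) (z : C) d :
  0 < d -> (forall w, Cmod (w - z)%C < d -> f w = g w) -> Choloat f z -> Choloat g z.
Proof. intros Hd H [a Ha]; exists a; apply (Cderiv_ext_loc _ _ _ _ _ Hd H Ha). Qed.

(** Cancelling a factor that vanishes at [z] gives identities off [z] only; this carries them to [z]
    itself. *)
Lemma cont_eq_punctured (f g : C -> C) (z : C) d :
  continuous f z -> continuous g z -> 0 < d ->
  (forall w, w <> z -> Cmod (w - z)%C < d -> f w = g w) -> f z = g z.
Proof.
intros Hf Hg Hd H; destruct (Ceq_dec (f z) (g z)) as [|Hn]; trivial.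
apply Cmod_sub_pos in Hn; set (e := Cmod (f z - g z)%C) in *.
rewrite continuous_C in Hf, Hg.
destruct (Hf (e / 2)) as [d1 [Hd1 H1]]; [lra|].
destruct (Hg (e / 2)) as [d2 [Hd2 H2]]; [lra|].
set (t := Rmin d (Rmin d1 d2) / 2).
assert (Ht : 0 < Rmin d (Rmin d1 d2)) by (repeat apply Rmin_glb_lt; trivial).
assert (Htd : t < d /\ t < d1 /\ t < d2).
{ unfold t; generalize (Rmin_l d (Rmin d1 d2)) (Rmin_r d (Rmin d1 d2)) (Rmin_l d1 d2) (Rmin_r d1 d2); lra. }
assert (Hm : Cmod (z + RtoC t - z)%C = t).
{ replace (z + RtoC t - z)%C with (RtoC t) by ring; rewrite Cmod_R; apply Rabs_pos_eq; unfold t; lra. }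
assert (Hne : (z + RtoC t)%C <> z).
{ intros E; rewrite E in Hm; replace (z - z)%C with (RtoC 0) in Hm by ring; rewrite Cmod_0 in Hm; unfold t in Hm; lra. }
specialize (H1 (z + RtoC t)%C); specialize (H2 (z + RtoC t)%C); specialize (H (z + RtoC t)%C).
rewrite Hm in *.
specialize (H Hne (proj1 Htd)); specialize (H1 (proj1 (proj2 Htd))); specialize (H2 (proj2 (proj2 Htd))).
rewrite <- H in H2; rewrite Cmod_minus_sym in H1.
generalize (Cmod_triangle3 (f z) (f (z + RtoC t)%C) (g z)); fold e; lra.
Qed.

(** * Path integrals and Goursat's lemma *)

(** The explicit rate matters: it locates the limit of the nested triangles in Goursat's lemma and
    keeps the iteration for the inverse function inside its disc. *)
Lemma geom_cauchy_R (u : nat -> R) (K : R) :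
  (forall n, Rabs (u (S n) - u n) <= K * (/ 2) ^ n) ->
  exists l, forall n, Rabs (u n - l) <= 2 * K * (/ 2) ^ n.
Proof.
intros H.
assert (Hp : forall n, 0 < (/ 2) ^ n) by (intros n; apply pow_lt; lra).
assert (HK : 0 <= K).
{ specialize (H O); simpl in H; generalize (Rabs_pos (u 1%nat - u 0%nat)); lra. }
assert (Hb : forall n k, Rabs (u (n + k)%nat - u n) <= 2 * K * (/ 2) ^ n - 2 * K * (/ 2) ^ (n + k)).
{ intros n k; induction k as [|k IH].
  - rewrite Nat.add_0_r; unfold Rminus; rewrite Rplus_opp_r, Rabs_R0; lra.
  - rewrite Nat.add_succ_r; simpl pow.
    specialize (H (n + k)%nat).
    replace (u (S (n + k)) - u n) with ((u (S (n + k)) - u (n + k)%nat) + (u (n + k)%nat - u n)) by ring.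
    eapply Rle_trans; [apply Rabs_triang|]; lra. }
assert (Hb2 : forall n k, (n <= k)%nat -> Rabs (u k - u n) <= 2 * K * (/ 2) ^ n).
{ intros n k Hk; specialize (Hb n (k - n)%nat); replace (n + (k - n))%nat with k in Hb by lia.
  specialize (Hp k); nra. }
assert (Hc : ex_finite_lim_seq u).
{ apply ex_lim_seq_cauchy_corr; intros e.
  destruct (pow_lt_1_zero (/ 2)) with (y := e / (4 * K + 1)) as [N HN].
  - rewrite Rabs_pos_eq; lra.
  - apply Rdiv_lt_0_compat; [apply cond_pos|lra].
  - exists N; intros n m Hn Hm.
    specialize (HN N (le_n N)); rewrite Rabs_pos_eq in HN by (apply Rlt_le; auto).
    apply Rlt_div_r in HN; [|lra].
    replace (u n - u m) with ((u n - u N) + - (u m - u N)) by ring.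
    eapply Rle_lt_trans; [apply Rabs_triang|]; rewrite Rabs_Ropp.
    generalize (Hb2 N n Hn) (Hb2 N m Hm) (Hp N); nra. }
destruct Hc as [l Hl]; exists l; intros n.
rewrite <- Rabs_Ropp.
apply (is_lim_seq_le_loc (fun k => Rabs (u k - u n)) (fun _ => 2 * K * (/ 2) ^ n) (Rabs (- (u n - l))) (2 * K * (/ 2) ^ n)).
- exists n; intros k Hk; apply Hb2; trivial.
- replace (- (u n - l)) with (l - u n) by ring.
  apply (is_lim_seq_abs _ (l - u n)).
  apply is_lim_seq_minus'; [trivial|apply is_lim_seq_const].
- apply is_lim_seq_const.
Qed.

Lemma geom_cauchy (u : nat -> C) (K : R) :
  (forall n, Cmod (u (S n) - u n)%C <= K * (/ 2) ^ n) ->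
  exists l, forall n, Cmod (u n - l)%C <= 4 * K * (/ 2) ^ n.
Proof.
intros H.
destruct (geom_cauchy_R (fun n => Re (u n)) K) as [x Hx].
{ intros n; eapply Rle_trans; [|apply (H n)]; exact (re_le_Cmod (u (S n) - u n)%C). }
destruct (geom_cauchy_R (fun n => Im (u n)) K) as [y Hy].
{ intros n; eapply Rle_trans; [|apply (H n)]; exact (im_le_Cmod (u (S n) - u n)%C). }
exists (x, y); intros n.
eapply Rle_trans; [apply Cmod_le_abs|].
generalize (Hx n) (Hy n); unfold Cminus, Copp, Cplus, Re, Im, Rminus; simpl; lra.
Qed.

Lemma pow_half_small (K e : R) : 0 < e -> exists N, forall n, (N <= n)%nat -> K * (/ 2) ^ n < e.
Proof.
intros He.
assert (Hp : forall n, 0 < (/ 2) ^ n) by (intros n; apply pow_lt; lra).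
destruct (pow_lt_1_zero (/ 2)) with (y := e / (Rabs K + 1)) as [N HN].
- rewrite Rabs_pos_eq; lra.
- apply Rdiv_lt_0_compat; [|generalize (Rabs_pos K)]; lra.
- exists N; intros n Hn; specialize (HN n Hn); rewrite Rabs_pos_eq in HN by (apply Rlt_le; auto).
  apply Rlt_div_r in HN; [|generalize (Rabs_pos K); lra].
  generalize (Rle_abs K) (Hp n); nra.
Qed.

(** * Integrals and derivatives of complex functions of a real variable *)

Definition isI (f : R -> C) (a b : R) (v : C) := @is_RInt C_R_NormedModule f a b v.
Definition CI (f : R -> C) (a b : R) : C := @RInt C_R_CompleteNormedModule f a b.

Lemma isI_CI (f : R -> C) (a b : R) (v : C) : isI f a b v -> CI f a b = v.
Proof. exact (@is_RInt_unique C_R_CompleteNormedModule f a b v). Qed.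

Lemma CI_correct (f : R -> C) (a b : R) : a <= b ->
  (forall t, a <= t <= b -> continuous f t) -> isI f a b (CI f a b).
Proof.
intros Hab H; apply (@RInt_correct C_R_CompleteNormedModule).
apply (@ex_RInt_continuous C_R_CompleteNormedModule).
rewrite Rmin_left, Rmax_right by lra; exact H.
Qed.

Lemma isI_unique (f : R -> C) (a b : R) (u v : C) : isI f a b u -> isI f a b v -> u = v.
Proof. intros H1 H2; rewrite <- (isI_CI _ _ _ _ H1); apply isI_CI; trivial. Qed.

Lemma isI_plus f g a b u v : isI f a b u -> isI g a b v -> isI (fun t => f t + g t)%C a b (u + v)%C.
Proof. exact (@is_RInt_plus C_R_NormedModule f g a b u v). Qed.

Lemma isI_minus f g a b u v : isI f a b u -> isI g a b v -> isI (fun t => f t - g t)%C a b (u - v)%C.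
Proof. exact (@is_RInt_minus C_R_NormedModule f g a b u v). Qed.

Lemma isI_ext f g a b v : a <= b -> (forall t, a <= t <= b -> f t = g t) -> isI f a b v -> isI g a b v.
Proof.
intros Hab H; apply (@is_RInt_ext C_R_NormedModule).
rewrite Rmin_left, Rmax_right by lra; intros x Hx; apply H; lra.
Qed.

(** The integral lives in the real normed module underlying [C], so complex scalars are not scalars
    of it and are handled by components. *)
Lemma isI_mult (c : C) f a b v : isI f a b v -> isI (fun t => c * f t)%C a b (c * v)%C.
Proof.
intros H.
assert (H1 := @is_RInt_fct_extend_fst R_NormedModule R_NormedModule f a b v H).
assert (H2 := @is_RInt_fct_extend_snd R_NormedModule R_NormedModule f a b v H).
apply (@is_RInt_fct_extend_pair R_NormedModule R_NormedModule).
- exact (@is_RInt_minus R_NormedModule _ _ a b _ _ (@is_RInt_scal R_NormedModule _ a b (fst c) _ H1)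
           (@is_RInt_scal R_NormedModule _ a b (snd c) _ H2)).
- exact (@is_RInt_plus R_NormedModule _ _ a b _ _ (@is_RInt_scal R_NormedModule _ a b (fst c) _ H2)
           (@is_RInt_scal R_NormedModule _ a b (snd c) _ H1)).
Qed.

Lemma norm_C_R (c : C) : @norm R_AbsRing C_R_NormedModule c = Cmod c.
Proof.
change (sqrt (Rabs (fst c) ^ 2 + Rabs (snd c) ^ 2) = Cmod c).
rewrite !pow2_abs; reflexivity.
Qed.

Lemma isI_bound f a b v M : a <= b -> (forall t, a <= t <= b -> Cmod (f t) <= M) -> isI f a b v ->
  Cmod v <= (b - a) * M.
Proof.
rewrite <- (norm_C_R v); intros Hab H; apply (@norm_RInt_le_const C_R_NormedModule); trivial.
intros t Ht; rewrite norm_C_R; auto.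
Qed.

Lemma isI_const (c : C) a b : isI (fun _ => c) a b (RtoC (b - a) * c)%C.
Proof.
assert (H := @is_RInt_const C_R_NormedModule a b c).
replace (RtoC (b - a) * c)%C with (scal (b - a) (c : C_R_NormedModule)); [exact H|].
rewrite scal_R_Cmult; reflexivity.
Qed.

Definition RCderiv (f : R -> C) (t : R) (l : C) := @is_derive R_AbsRing C_R_NormedModule f t l.

Lemma RCderiv_eps (f : R -> C) (t : R) (l : C) :
  RCderiv f t l <-> forall e, 0 < e -> exists d, 0 < d /\
    forall s, Rabs (s - t) < d -> Cmod (f s - f t - RtoC (s - t) * l)%C <= e * Rabs (s - t).
Proof.
split.
- intros [_ H] e He.
  specialize (H t (fun P Q => Q) (mkposreal e He)).
  destruct H as [d H].
  exists (pos d); split; [apply cond_pos|]; intros w Hw; specialize (H w Hw).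
  rewrite norm_C_R, scal_R_Cmult in H; exact H.
- intros H; split; [apply is_linear_scal_l|].
  intros x Hx e.
  apply (@is_filter_lim_locally_unique R_AbsRing R_NormedModule) in Hx; subst x.
  destruct (H e (cond_pos e)) as [d [Hd H1]].
  exists (mkposreal d Hd); intros w Hw; specialize (H1 w Hw).
  rewrite norm_C_R, scal_R_Cmult; exact H1.
Qed.

Lemma isI_FTC (F f : R -> C) a b : a <= b ->
  (forall t, a <= t <= b -> RCderiv F t (f t)) -> (forall t, a <= t <= b -> continuous f t) ->
  isI f a b (F b - F a)%C.
Proof.
intros Hab HF Hf.
apply (@is_RInt_derive C_R_CompleteNormedModule F f a b);
rewrite Rmin_left, Rmax_right by lra; trivial.
Qed.

Lemma RCderiv_cont f t l : RCderiv f t l -> continuous f t.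
Proof.
intros H; apply (@ex_derive_continuous R_AbsRing C_R_NormedModule f t); exists l; exact H.
Qed.

Lemma RCderiv_comp (F : C -> C) (g : R -> C) t l m :
  Cderiv F (g t) l -> RCderiv g t m -> RCderiv (fun s => F (g s)) t (m * l)%C.
Proof.
intros HF Hg.
assert (Hc := proj1 (continuous_RC _ _) (RCderiv_cont _ _ _ Hg)).
rewrite RCderiv_eps in Hg |- *; rewrite Cderiv_eps in HF.
intros e He.
set (A := Cmod m + 1); set (B := Cmod l + 1).
assert (HA : 0 < A) by (unfold A; generalize (Cmod_ge_0 m); lra).
assert (HB : 0 < B) by (unfold B; generalize (Cmod_ge_0 l); lra).
destruct (HF (e / (2 * A))) as [d1 [Hd1 H1]]; [apply Rdiv_lt_0_compat; lra|].
destruct (Hc d1 Hd1) as [d2 [Hd2 H2]].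
destruct (Hg (Rmin 1 (e / (2 * B)))) as [d3 [Hd3 H3]].
{ apply Rmin_glb_lt; [lra|apply Rdiv_lt_0_compat; lra]. }
exists (Rmin d2 d3); split; [apply Rmin_glb_lt; trivial|].
intros s Hs.
specialize (H2 s (Rlt_le_trans _ _ _ Hs (Rmin_l _ _))).
specialize (H3 s (Rlt_le_trans _ _ _ Hs (Rmin_r _ _))).
specialize (H1 (g s) H2).
set (h := Rabs (s - t)) in *; assert (Hh : 0 <= h) by apply Rabs_pos.
assert (Hg1 : Cmod (g s - g t)%C <= A * h).
{ replace (g s - g t)%C with ((g s - g t - RtoC (s - t) * m) + RtoC (s - t) * m)%C by ring.
  eapply Rle_trans; [apply Cmod_triangle|].
  rewrite Cmod_mult, Cmod_R; fold h.
  apply Rle_trans with (1 * h + h * Cmod m); [|unfold A; lra].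
  apply Rplus_le_compat_r; eapply Rle_trans; [exact H3|].
  apply Rmult_le_compat_r; trivial; apply Rmin_l. }
replace (F (g s) - F (g t) - RtoC (s - t) * (m * l))%C with
  ((F (g s) - F (g t) - (g s - g t) * l) + (g s - g t - RtoC (s - t) * m) * l)%C by ring.
eapply Rle_trans; [apply Cmod_triangle|]; rewrite Cmod_mult.
apply Rle_trans with (e / (2 * A) * (A * h) + (e / (2 * B) * h) * B).
- apply Rplus_le_compat.
  + eapply Rle_trans; [exact H1|]; apply Rmult_le_compat_l; trivial.
    apply Rlt_le, Rdiv_lt_0_compat; lra.
  + apply Rmult_le_compat; try apply Cmod_ge_0; [|unfold B; lra].
    eapply Rle_trans; [exact H3|]; apply Rmult_le_compat_r; trivial; apply Rmin_r.
- right; field; lra.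
Qed.

(** * Integrals along segments *)

Definition seg (a b : C) (t : R) : C := (a + RtoC t * (b - a))%C.

Lemma seg_0 a b : seg a b 0 = a.
Proof. unfold seg; ring. Qed.

Lemma seg_1 a b : seg a b 1 = b.
Proof. unfold seg; ring. Qed.

Lemma RCderiv_seg a b t : RCderiv (seg a b) t (b - a)%C.
Proof.
apply RCderiv_eps; intros e He; exists 1; split; [lra|]; intros s _.
replace (seg a b s - seg a b t - RtoC (s - t) * (b - a))%C with (RtoC 0).
- rewrite Cmod_0; generalize (Rabs_pos (s - t)); nra.
- unfold seg; rewrite RtoC_minus; ring.
Qed.

Lemma seg_cont (f : C -> C) a b t : continuous f (seg a b t) -> continuous (fun s => f (seg a b s)) t.
Proof.
intros H; apply (continuous_comp (seg a b) f t); trivial.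
apply (RCderiv_cont _ _ _ (RCderiv_seg a b t)).
Qed.

(** The contour integral of [f dz] along the segment from [a] to [b]. *)
Definition J (f : C -> C) (a b : C) : C := ((b - a) * CI (fun t => f (seg a b t)) 0 1)%C.

Definition cont_seg (f : C -> C) (a b : C) := forall t, 0 <= t <= 1 -> continuous f (seg a b t).

Lemma J_isI f a b : cont_seg f a b -> isI (fun t => (b - a) * f (seg a b t))%C 0 1 (J f a b).
Proof.
intros H; apply isI_mult, CI_correct; [lra|].
intros t Ht; apply seg_cont; auto.
Qed.

Lemma J_intro f a b v : isI (fun t => (b - a) * f (seg a b t))%C 0 1 v -> cont_seg f a b -> J f a b = v.
Proof. intros H1 H2; apply (isI_unique _ _ _ _ _ (J_isI _ _ _ H2) H1). Qed.

Lemma cont_seg_sub f a b s t : 0 <= s <= 1 -> 0 <= t <= 1 -> cont_seg f a b ->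
  cont_seg f (seg a b s) (seg a b t).
Proof.
intros Hs Ht H x Hx.
replace (seg (seg a b s) (seg a b t) x) with (seg a b (s + x * (t - s))).
- apply H; nra.
- unfold seg; rewrite RtoC_plus, RtoC_mult, RtoC_minus; ring.
Qed.

Lemma J_sub f a b s t : 0 <= s <= 1 -> 0 <= t <= 1 -> cont_seg f a b ->
  isI (fun x => (b - a) * f (seg a b x))%C s t (J f (seg a b s) (seg a b t)).
Proof.
intros Hs Ht H.
assert (Hex : ex_RInt (V := C_R_CompleteNormedModule) (fun x => (b - a) * f (seg a b x))%C s t).
{ apply (@ex_RInt_Chasles C_R_CompleteNormedModule _ s 0 t); [apply ex_RInt_swap|];
  apply (@ex_RInt_Chasles_1 C_R_CompleteNormedModule _ 0 _ 1); trivial; eexists; apply (J_isI _ _ _ H). }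
destruct Hex as [v Hv].
rewrite (J_intro f (seg a b s) (seg a b t) v); trivial.
2: apply cont_seg_sub; trivial.
assert (Hl := @is_RInt_comp_lin C_R_NormedModule (fun x => (b - a) * f (seg a b x))%C (t - s) s 0 1 v).
replace ((t - s) * 0 + s) with s in Hl by ring.
replace ((t - s) * 1 + s) with t in Hl by ring.
specialize (Hl Hv).
apply isI_ext with (3 := Hl); [lra|].
intros x _; rewrite scal_R_Cmult.
replace (seg (seg a b s) (seg a b t) x) with (seg a b ((t - s) * x + s)).
- unfold seg; rewrite RtoC_minus; ring.
- unfold seg; rewrite RtoC_plus, RtoC_mult, RtoC_minus; ring.
Qed.

Lemma J_split f a b s : 0 <= s <= 1 -> cont_seg f a b ->
  J f a b = (J f a (seg a b s) + J f (seg a b s) b)%C.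
Proof.
intros Hs H.
assert (H0 : 0 <= 0 <= 1) by lra; assert (H1 : 0 <= 1 <= 1) by lra.
assert (E1 := J_sub f a b 0 s H0 Hs H); assert (E2 := J_sub f a b s 1 Hs H1 H).
assert (E := @is_RInt_Chasles C_R_NormedModule _ _ _ _ _ _ E1 E2).
rewrite seg_0 in E; rewrite seg_1 in E.
exact (isI_unique _ _ _ _ _ (J_isI _ _ _ H) E).
Qed.

Lemma J_rev f a b : cont_seg f a b -> J f b a = (- J f a b)%C.
Proof.
intros H.
assert (H0 : 0 <= 0 <= 1) by lra; assert (H1 : 0 <= 1 <= 1) by lra.
assert (E1 := J_sub f a b 1 0 H1 H0 H).
rewrite seg_0, seg_1 in E1.
assert (E2 := @is_RInt_swap C_R_NormedModule _ _ _ _ (J_isI _ _ _ H)).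
exact (isI_unique _ _ _ _ _ E1 E2).
Qed.

Lemma J_bound f a b M : cont_seg f a b ->
  (forall t, 0 <= t <= 1 -> Cmod (f (seg a b t)) <= M) -> Cmod (J f a b) <= Cmod (b - a)%C * M.
Proof.
intros H HM.
replace (Cmod (b - a)%C * M) with ((1 - 0) * (Cmod (b - a)%C * M)) by ring.
apply isI_bound with (3 := J_isI _ _ _ H); [lra|].
intros t Ht; rewrite Cmod_mult; apply Rmult_le_compat_l; [apply Cmod_ge_0|auto].
Qed.

Lemma J_minus f g a b : cont_seg f a b -> cont_seg g a b ->
  J (fun z => f z - g z)%C a b = (J f a b - J g a b)%C.
Proof.
intros Hf Hg; apply J_intro.
- apply isI_ext with (3 := isI_minus _ _ _ _ _ _ (J_isI _ _ _ Hf) (J_isI _ _ _ Hg)); [lra|].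
  intros t _; ring.
- intros t Ht; apply (continuous_minus (V := C_NormedModule)); auto.
Qed.

Lemma J_prim F f a b : cont_seg f a b -> (forall t, 0 <= t <= 1 -> Cderiv F (seg a b t) (f (seg a b t))) ->
  J f a b = (F b - F a)%C.
Proof.
intros Hf HF; apply J_intro; trivial.
assert (E : isI (fun t => (b - a) * f (seg a b t))%C 0 1 (F (seg a b 1) - F (seg a b 0))%C).
{ apply (isI_FTC (fun t => F (seg a b t))); [lra| |].
  - intros t Ht; apply RCderiv_comp; [auto|apply RCderiv_seg].
  - intros t Ht; apply (continuous_comp (fun s => f (seg a b s)) (fun z => (b - a) * z)%C t).
    + apply seg_cont; auto.
    + apply (Cderiv_cont _ _ _ (Cderiv_mult _ _ _ _ _ (Cderiv_const (b - a)%C _) (Cderiv_id _))). }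
rewrite seg_0, seg_1 in E; exact E.
Qed.

(** * Goursat's lemma on closed convex sets *)

Definition convexC (K : C -> Prop) := forall x y t, 0 <= t <= 1 -> K x -> K y -> K (seg x y t).
Definition closedC (K : C -> Prop) :=
  forall z, (forall e, 0 < e -> exists x, K x /\ Cmod (x - z)%C < e) -> K z.

Definition tri (f : C -> C) (a b c : C) : C := (J f a b + J f b c + J f c a)%C.
Definition per (a b c : C) : R := Cmod (b - a)%C + Cmod (c - b)%C + Cmod (a - c)%C.

Lemma Cmod_seg_le (z a b : C) t r : 0 <= t <= 1 -> Cmod (a - z)%C <= r -> Cmod (b - z)%C <= r ->
  Cmod (seg a b t - z)%C <= r.
Proof.
intros Ht Ha Hb.
replace (seg a b t - z)%C with (RtoC (1 - t) * (a - z) + RtoC t * (b - z))%C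
  by (unfold seg; rewrite RtoC_minus; ring).
eapply Rle_trans; [apply Cmod_triangle|].
rewrite !Cmod_mult, !Cmod_R, !Rabs_pos_eq by lra; nra.
Qed.

Lemma Cmod_half (a b x y : C) : (x - y)%C = ((a - b) / 2)%C -> Cmod (x - y)%C = Cmod (a - b)%C / 2.
Proof.
intros ->; rewrite Cmod_div.
- rewrite Cmod_R, Rabs_pos_eq; lra.
- intros H; apply RtoC_inj in H; lra.
Qed.

Section Goursat.

Variables (f : C -> C) (K : C -> Prop).
Hypothesis HK : convexC K.
Hypothesis HKc : closedC K.
Hypothesis Hf : forall z, K z -> Choloat f z.

Lemma cont_seg_convex a b : K a -> K b -> cont_seg f a b.
Proof. intros Ha Hb t Ht; apply Choloat_cont, Hf, HK; trivial. Qed.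

(** The midpoints of the edges cut the triangle into four triangles of half the perimeter whose
    integrals add up, so one of them carries at least a quarter of the modulus. The bound on
    [a' - a] makes the first vertices of the iterated triangles a Cauchy sequence. *)
Lemma tri_quarter a b c : K a -> K b -> K c ->
  exists a' b' c', K a' /\ K b' /\ K c' /\ per a' b' c' = per a b c / 2 /\
    Cmod (a' - a)%C <= per a b c /\ Cmod (tri f a b c) <= 4 * Cmod (tri f a' b' c').
Proof.
intros Ha Hb Hc.
set (x := seg a b (/ 2)); set (y := seg b c (/ 2)); set (z := seg c a (/ 2)).
assert (Hh : 0 <= / 2 <= 1) by lra.
assert (Hx : K x) by (apply HK; trivial).
assert (Hy : K y) by (apply HK; trivial).
assert (Hz : K z) by (apply HK; trivial).
assert (E : tri f a b c = (tri f a x z + tri f x b y + tri f z y c + tri f y z x)%C).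
{ unfold tri.
  rewrite (J_split f a b (/ 2) Hh), (J_split f b c (/ 2) Hh), (J_split f c a (/ 2) Hh)
    by (apply cont_seg_convex; trivial).
  fold x y z.
  rewrite (J_rev f y z), (J_rev f z x), (J_rev f x y) by (apply cont_seg_convex; trivial).
  ring. }
assert (H2 : RtoC 2 <> 0) by (intros H; apply RtoC_inj in H; lra).
assert (E2 : forall u v, seg u v (/ 2) = ((u + v) / 2)%C).
{ intros u v; unfold seg; rewrite RtoC_inv by lra; field; auto. }
assert (P1 : per a x z = per a b c / 2).
{ unfold per; rewrite (Cmod_half b a x a), (Cmod_half c b z x), (Cmod_half a c a z); [lra| | |];
  unfold x, y, z; rewrite !E2; field; auto. }
assert (P2 : per x b y = per a b c / 2).
{ unfold per; rewrite (Cmod_half b a b x), (Cmod_half c b y b), (Cmod_half a c x y); [lra| | |];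
  unfold x, y, z; rewrite !E2; field; auto. }
assert (P3 : per z y c = per a b c / 2).
{ unfold per; rewrite (Cmod_half b a y z), (Cmod_half c b c y), (Cmod_half a c z c); [lra| | |];
  unfold x, y, z; rewrite !E2; field; auto. }
assert (P4 : per y z x = per a b c / 2).
{ unfold per; rewrite (Cmod_half a b z y), (Cmod_half b c x z), (Cmod_half c a y x);
  [rewrite (Cmod_minus_sym a b), (Cmod_minus_sym b c), (Cmod_minus_sym c a); lra| | |];
  unfold x, y, z; rewrite !E2; field; auto. }
assert (D : Cmod (x - a)%C <= per a b c /\ Cmod (z - a)%C <= per a b c /\ Cmod (y - a)%C <= per a b c).
{ assert (D1 := Cmod_half b a x a); assert (D2 := Cmod_half c a z a).
  rewrite D1, D2; [|unfold z; rewrite E2; field; auto|unfold x; rewrite E2; field; auto].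
  unfold per; rewrite (Cmod_minus_sym c a).
  generalize (Cmod_ge_0 (b - a)%C) (Cmod_ge_0 (c - b)%C) (Cmod_ge_0 (a - c)%C); intros; repeat split; try lra.
  assert (D3 := Cmod_triangle3 y b a); rewrite (Cmod_half c b y b) in D3; [lra|].
  unfold y; rewrite E2; field; auto. }
assert (HT : Cmod (tri f a b c) <= Cmod (tri f a x z) + Cmod (tri f x b y) + Cmod (tri f z y c) + Cmod (tri f y z x)).
{ rewrite E; eapply Rle_trans; [apply Cmod_triangle|]; apply Rplus_le_compat_r.
  eapply Rle_trans; [apply Cmod_triangle|]; apply Rplus_le_compat_r; apply Cmod_triangle. }
destruct (Rle_dec (Cmod (tri f a b c)) (4 * Cmod (tri f a x z))) as [T1|T1].
{ exists a, x, z; repeat split; trivial.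
  replace (a - a)%C with (RtoC 0) by ring; rewrite Cmod_0; unfold per.
  generalize (Cmod_ge_0 (b - a)%C) (Cmod_ge_0 (c - b)%C) (Cmod_ge_0 (a - c)%C); lra. }
destruct (Rle_dec (Cmod (tri f a b c)) (4 * Cmod (tri f x b y))) as [T2|T2].
{ exists x, b, y; repeat split; trivial; apply D. }
destruct (Rle_dec (Cmod (tri f a b c)) (4 * Cmod (tri f z y c))) as [T3|T3].
{ exists z, y, c; repeat split; trivial; apply D. }
exists y, z, x; repeat split; trivial; [apply D|lra].
Qed.

Lemma goursat a b c : K a -> K b -> K c -> tri f a b c = 0.
Proof.
intros Ha Hb Hc.
(* Triangles are bundled with the membership of their vertices in [K], so that the choice of a
   quarter can be iterated. *)
set (T := {t : C * C * C | K (fst (fst t)) /\ K (snd (fst t)) /\ K (snd t)}).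
set (va := fun t : T => fst (fst (proj1_sig t))).
set (vb := fun t : T => snd (fst (proj1_sig t))).
set (vc := fun t : T => snd (proj1_sig t)).
assert (Hstep : forall t : T, {t' : T | per (va t') (vb t') (vc t') = per (va t) (vb t) (vc t) / 2 /\
   Cmod (va t' - va t)%C <= per (va t) (vb t) (vc t) /\
   Cmod (tri f (va t) (vb t) (vc t)) <= 4 * Cmod (tri f (va t') (vb t') (vc t'))}).
{ intros [[[x y] z] [Hx [Hy Hz]]]; apply constructive_indefinite_description.
  destruct (tri_quarter x y z Hx Hy Hz) as [x' [y' [z' [Hx' [Hy' [Hz' HH]]]]]].
  exists (exist _ ((x', y'), z') (conj Hx' (conj Hy' Hz'))); exact HH. }
set (u := fix u n := match n with O => exist _ ((a, b), c) (conj Ha (conj Hb Hc)) : T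
                                | S n => proj1_sig (Hstep (u n)) end).
assert (Hu : forall n, per (va (u (S n))) (vb (u (S n))) (vc (u (S n))) = per (va (u n)) (vb (u n)) (vc (u n)) / 2 /\
   Cmod (va (u (S n)) - va (u n))%C <= per (va (u n)) (vb (u n)) (vc (u n)) /\
   Cmod (tri f (va (u n)) (vb (u n)) (vc (u n))) <= 4 * Cmod (tri f (va (u (S n))) (vb (u (S n))) (vc (u (S n))))).
{ intros n; exact (proj2_sig (Hstep (u n))). }
set (P := per a b c).
assert (Hper : forall n, per (va (u n)) (vb (u n)) (vc (u n)) = P * (/ 2) ^ n).
{ intros n; induction n as [|n IH]; [simpl; fold P; unfold va, vb, vc; simpl; fold P; ring|].
  rewrite (proj1 (Hu n)), IH; simpl pow; field. }
assert (HT : forall n, Cmod (tri f a b c) <= 4 ^ n * Cmod (tri f (va (u n)) (vb (u n)) (vc (u n)))).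
{ intros n; induction n as [|n IH]; [unfold va, vb, vc; simpl; lra|].
  eapply Rle_trans; [exact IH|]; simpl pow.
  rewrite (Rmult_comm 4), Rmult_assoc; apply Rmult_le_compat_l; [apply pow_le; lra|].
  apply Hu. }
destruct (geom_cauchy (fun n => va (u n)) P) as [l Hl].
{ intros n; rewrite <- Hper; apply Hu. }
assert (HP0 : 0 <= P).
{ unfold P, per; generalize (Cmod_ge_0 (b - a)%C) (Cmod_ge_0 (c - b)%C) (Cmod_ge_0 (a - c)%C); lra. }
assert (Hp2 : forall n, 0 < (/ 2) ^ n) by (intros n; apply pow_lt; lra).
assert (HKl : K l).
{ apply HKc; intros e He.
  destruct (pow_half_small (4 * P) e He) as [N HN].
  exists (va (u N)); split; [apply (proj2_sig (u N))|].
  eapply Rle_lt_trans; [apply Hl|apply HN; lia]. }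
destruct (Hf l HKl) as [m Hm]; assert (Hm' := Hm); rewrite Cderiv_eps in Hm'.
destruct (Rle_lt_or_eq_dec 0 (Cmod (tri f a b c)) (Cmod_ge_0 _)) as [H0|H0].
2:{ apply Cmod_eq_0; auto. }
exfalso.
(* The estimate below ends in [5 * P ^ 2 * e]; this [e] makes that strictly smaller than the
   integral itself. *)
set (e := Cmod (tri f a b c) / (6 * (P * P) + 1)).
assert (He : 0 < e) by (apply Rdiv_lt_0_compat; nra).
destruct (Hm' e He) as [d [Hd Hdl]].
destruct (pow_half_small (5 * P) d Hd) as [N HN].
specialize (HN N (le_n N)); specialize (Hl N); specialize (Hper N); specialize (HT N).
destruct (proj2_sig (u N)) as [Ka [Kb Kc]].
change (K (va (u N))) in Ka; change (K (vb (u N))) in Kb; change (K (vc (u N))) in Kc.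
revert Hl Hper HT Ka Kb Kc; generalize (va (u N)) (vb (u N)) (vc (u N)).
intros x y z Hl Hper HT Kx Ky Kz.
set (g := fun w => (f w - (f l + (w - l) * m))%C).
set (q := (/ 2) ^ N) in *; assert (Hq : 0 < q) by apply Hp2.
(* The affine part of [f] at [l] has a primitive, so over a triangle [f] has the same integral as
   its remainder [g]. *)
set (L := fun w => (f l + (w - l) * m)%C).
assert (HL : forall w, Cderiv (fun w => f l * w + m * ((w - l) * (w - l) / 2))%C w (L w)).
{ assert (H2 : RtoC 2 <> 0) by (intros H; apply RtoC_inj in H; lra).
  intros w; eapply Cderiv_val.
  - apply Cderiv_plus; [apply Cderiv_mult; [apply Cderiv_const|apply Cderiv_id]|].
    apply Cderiv_mult; [apply Cderiv_const|].
    apply Cderiv_div; [|apply Cderiv_const|trivial].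
    apply Cderiv_mult; (apply Cderiv_minus; [apply Cderiv_id|apply Cderiv_const]).
  - cbv beta; unfold L; field; auto. }
assert (HLc : forall w, continuous L w).
{ intros w; unfold L; eapply Cderiv_cont.
  apply Cderiv_plus; [apply Cderiv_const|]; apply Cderiv_mult;
  [apply Cderiv_minus; [apply Cderiv_id|apply Cderiv_const]|apply Cderiv_const]. }
assert (EJ : forall u v, K u -> K v -> J g u v = (J f u v - J L u v)%C).
{ intros u' v' Hu' Hv'; apply (J_minus f L); [apply cont_seg_convex; trivial|intros t _; apply HLc]. }
assert (ET : tri f x y z = tri g x y z).
{ unfold tri; rewrite !EJ; trivial.
  rewrite !(J_prim _ L _ _ (fun t _ => HLc _) (fun t _ => HL _)); ring. }
assert (Hgc : forall u v, K u -> K v -> cont_seg g u v).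
{ intros u' v' Hu' Hv' t Ht; apply (continuous_minus (V := C_NormedModule) f L);
  [apply cont_seg_convex; trivial|apply HLc]. }
(* The first vertex is within [4 * P * q] of the limit, and the perimeter [P * q] bounds the way to
   the other two. *)
assert (Hnear : Cmod (x - l)%C <= 5 * P * q /\ Cmod (y - l)%C <= 5 * P * q /\ Cmod (z - l)%C <= 5 * P * q).
{ unfold per in Hper.
  generalize (Cmod_ge_0 (y - x)%C) (Cmod_ge_0 (z - y)%C) (Cmod_ge_0 (x - z)%C); intros.
  generalize (Cmod_triangle3 y x l) (Cmod_triangle3 z x l); rewrite (Cmod_minus_sym z x).
  intros; repeat split; nra. }
assert (Hgb : forall u v, K u -> K v -> Cmod (u - l)%C <= 5 * P * q -> Cmod (v - l)%C <= 5 * P * q ->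
   Cmod (J g u v) <= Cmod (v - u)%C * (e * (5 * P * q))).
{ intros u' v' Hu' Hv' H1 H2; apply J_bound; [apply Hgc; trivial|].
  intros t Ht; assert (Hs := Cmod_seg_le l u' v' t _ Ht H1 H2).
  unfold g; replace (f (seg u' v' t) - (f l + (seg u' v' t - l) * m))%C
    with (f (seg u' v' t) - f l - (seg u' v' t - l) * m)%C by ring.
  eapply Rle_trans; [apply Hdl; lra|]; apply Rmult_le_compat_l; lra. }
assert (HTb : Cmod (tri f x y z) <= (P * q) * (e * (5 * P * q))).
{ rewrite ET; unfold tri.
  rewrite <- Hper at 1; unfold per; rewrite !Rmult_plus_distr_r.
  eapply Rle_trans; [apply Cmod_triangle|]; apply Rplus_le_compat; [|apply Hgb; tauto].
  eapply Rle_trans; [apply Cmod_triangle|]; apply Rplus_le_compat; apply Hgb; tauto. }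
(* Perimeter and distance to [l] both shrink like [q], and their product compensates the factor
   [4 ^ N] lost by quartering. *)
assert (Hpq : 4 ^ N * (q * q) = 1).
{ unfold q; rewrite <- !Rpow_mult_distr; replace (4 * (/ 2 * / 2)) with 1 by field; apply pow1. }
assert (HF : Cmod (tri f a b c) <= 5 * (P * P) * e).
{ eapply Rle_trans; [exact HT|].
  apply Rle_trans with (4 ^ N * ((P * q) * (e * (5 * P * q)))).
  - apply Rmult_le_compat_l; [apply pow_le; lra|trivial].
  - replace (4 ^ N * (P * q * (e * (5 * P * q)))) with (4 ^ N * (q * q) * (5 * (P * P) * e)) by ring.
    rewrite Hpq; lra. }
assert (He2 : e * (6 * (P * P) + 1) = Cmod (tri f a b c)) by (unfold e; field; nra).
nra.
Qed.

End Goursat.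

Lemma convex_disc z0 r : convexC (fun z => Cmod (z - z0)%C <= r).
Proof. intros x y t Ht Hx Hy; apply Cmod_seg_le; trivial. Qed.

Lemma closed_disc z0 r : closedC (fun z => Cmod (z - z0)%C <= r).
Proof.
intros z H; apply Rnot_lt_le; intros Hz.
destruct (H (Cmod (z - z0)%C - r)) as [x [Hx Hxz]]; [lra|].
generalize (Cmod_triangle3 z x z0); rewrite Cmod_minus_sym in Hxz; lra.
Qed.

Lemma convex_and K1 K2 : convexC K1 -> convexC K2 -> convexC (fun z => K1 z /\ K2 z).
Proof. intros H1 H2 x y t Ht [] []; split; auto. Qed.

Lemma closed_and K1 K2 : closedC K1 -> closedC K2 -> closedC (fun z => K1 z /\ K2 z).
Proof.
intros H1 H2 z H; split; [apply H1|apply H2]; intros e He; destruct (H e He) as [x [[] Hx]]; eauto.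
Qed.

(** The real inner product of [z - w] with [v]; its superlevel sets are half-planes that can be
    chosen to miss [w]. *)
Definition lin (w v z : C) : R := Re ((z - w) * Cconj v)%C.

Lemma lin_seg w v x y t : lin w v (seg x y t) = (1 - t) * lin w v x + t * lin w v y.
Proof.
unfold lin, seg, Re, Cconj, Cmult, Cminus, Cplus, Copp, RtoC; simpl; ring.
Qed.

Lemma convex_half w v k : convexC (fun z => k <= lin w v z).
Proof. intros x y t Ht Hx Hy; rewrite lin_seg; nra. Qed.

Lemma closed_half w v k : closedC (fun z => k <= lin w v z).
Proof.
intros z H; apply Rnot_lt_le; intros Hz.
assert (Hv : 0 < Cmod v + 1) by (generalize (Cmod_ge_0 v); lra).
destruct (H ((k - lin w v z) / (Cmod v + 1))) as [x [Hx Hxz]].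
{ apply Rdiv_lt_0_compat; lra. }
apply Rlt_div_r in Hxz; [|lra].
assert (Hd : lin w v x - lin w v z <= Cmod (x - z)%C * Cmod v).
{ replace (lin w v x - lin w v z) with (Re ((x - z) * Cconj v)%C).
  - eapply Rle_trans; [apply Rle_abs|]; eapply Rle_trans; [apply re_le_Cmod|].
    rewrite Cmod_mult, Cmod_conj; lra.
  - unfold lin, Re, Cconj, Cmult, Cminus, Cplus, Copp; simpl; ring. }
generalize (Cmod_ge_0 (x - z)%C); nra.
Qed.

Lemma J_point f a : J f a a = 0.
Proof. unfold J; ring. Qed.

Lemma J_local (f : C -> C) (z : C) e :
  0 < e -> continuous f z -> (exists d, 0 < d /\ forall w, Cmod (w - z)%C < d -> continuous f w) ->
  exists d, 0 < d /\ forall w, Cmod (w - z)%C < d ->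
    Cmod (J f z w - (w - z) * f z)%C <= e * Cmod (w - z)%C.
Proof.
intros He Hc [d1 [Hd1 H1]].
assert (Hc' := Hc); rewrite continuous_C in Hc'; destruct (Hc' e He) as [d2 [Hd2 H2]].
exists (Rmin d1 d2); split; [apply Rmin_glb_lt; trivial|].
intros w Hw.
assert (Hs : forall t, 0 <= t <= 1 -> Cmod (seg z w t - z)%C <= Cmod (w - z)%C).
{ intros t Ht; apply Cmod_seg_le; trivial; [|lra].
  replace (z - z)%C with (RtoC 0) by ring; rewrite Cmod_0; apply Cmod_ge_0. }
assert (Hcs : cont_seg f z w).
{ intros t Ht; apply H1; generalize (Hs t Ht) (Rmin_l d1 d2); lra. }
assert (Hcc : cont_seg (fun _ => f z) z w).
{ intros t Ht; apply continuous_const. }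
replace ((w - z) * f z)%C with (J (fun _ => f z) z w).
- rewrite <- J_minus; trivial; rewrite Rmult_comm; apply J_bound.
  + intros t Ht; apply (continuous_minus (V := C_NormedModule)); auto.
  + intros t Ht; apply Rlt_le, H2; generalize (Hs t Ht) (Rmin_r d1 d2); lra.
- rewrite (J_prim (fun v => f z * v)%C); trivial; [ring|].
  intros t _; eapply Cderiv_val;
  [apply Cderiv_mult; [apply Cderiv_const|apply Cderiv_id]|cbv beta; ring].
Qed.

(** * Primitives on a disc with one exceptional point *)

Section Star.

Variables (g : C -> C) (z0 w : C) (r : R).
Hypothesis Hw : Cmod (w - z0)%C <= r.
Hypothesis Hg : forall z, Cmod (z - z0)%C <= r -> z <> w -> Choloat g z.
Hypothesis Hgw : continuous g w.

Lemma star_cont z : Cmod (z - z0)%C <= r -> continuous g z.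
Proof.
intros Hz; destruct (Ceq_dec z w) as [->|Hn]; trivial.
apply Choloat_cont, Hg; trivial.
Qed.

Lemma star_cont_seg a b : Cmod (a - z0)%C <= r -> Cmod (b - z0)%C <= r -> cont_seg g a b.
Proof. intros Ha Hb t Ht; apply star_cont, Cmod_seg_le; trivial. Qed.

(* The triangle minus a small triangle at the exceptional point [w] is covered by Goursat's lemma, and the integral
   over the small triangle tends to 0 with its size. *)
Lemma star_goursat b c : Cmod (b - z0)%C <= r -> Cmod (c - z0)%C <= r ->
  Cmod (c - b)%C < Cmod (b - w)%C -> tri g w b c = 0.
Proof.
intros Hb Hc Hbc.
set (v := (b - w)%C) in *.
assert (Hlb : 0 < lin w v b).
{ assert (E : lin w v b = Cmod v ^ 2).
  { rewrite Cmod2_alt; unfold lin; fold v; unfold Re, Im, Cconj, Cmult; simpl; ring. }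
  rewrite E; apply pow_lt; generalize (Cmod_ge_0 (c - b)%C); lra. }
(* The condition [|c - b| < |b - w|] keeps [c] strictly on the same side as [b] of the line through
   [w] orthogonal to [v]. *)
assert (Hlc : 0 < lin w v c).
{ assert (E : lin w v c = lin w v b + Re ((c - b) * Cconj v)%C).
  { unfold lin, Re, Cconj, Cmult, Cminus, Cplus, Copp; simpl; ring. }
  assert (E1 : lin w v b = Cmod v ^ 2).
  { rewrite Cmod2_alt; unfold lin; fold v; unfold Re, Im, Cconj, Cmult; simpl; ring. }
  assert (E2 := re_le_Cmod ((c - b) * Cconj v)%C); rewrite Cmod_mult, Cmod_conj in E2.
  apply Rabs_le_between in E2; generalize (Cmod_ge_0 (c - b)%C); nra. }
set (k := Rmin (lin w v b) (lin w v c)).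
assert (Hk : 0 < k) by (apply Rmin_glb_lt; trivial).
assert (Hlw : lin w v w = 0).
{ unfold lin; replace (w - w)%C with (RtoC 0) by ring; unfold Re, RtoC, Cmult, Cconj; simpl; ring. }
assert (Hsplit : forall t, 0 < t <= 1 -> tri g w b c = tri g w (seg w b t) (seg w c t)).
{ intros t Ht.
  assert (Ht' : 0 <= t <= 1) by lra.
  set (bt := seg w b t); set (ct := seg w c t).
  assert (Hbt : Cmod (bt - z0)%C <= r) by (apply Cmod_seg_le; trivial).
  assert (Hct : Cmod (ct - z0)%C <= r) by (apply Cmod_seg_le; trivial).
  (* This part of the disc contains the vertices [b], [c], [bt], [ct] of the trapezoid left after
     removing the small triangle, and it misses [w]. *)
  set (K := fun z => Cmod (z - z0)%C <= r /\ t * k <= lin w v z).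
  assert (HK : forall x y z, K x -> K y -> K z -> tri g x y z = 0).
  { apply goursat.
    - apply convex_and; [apply convex_disc|apply convex_half].
    - apply closed_and; [apply closed_disc|apply closed_half].
    - intros z [Hz1 Hz2]; apply Hg; trivial; intros ->; rewrite Hlw in Hz2; nra. }
  assert (kb := Rmin_l (lin w v b) (lin w v c)); assert (kc := Rmin_r (lin w v b) (lin w v c)).
  fold k in kb, kc.
  assert (Kb : K b) by (split; [trivial|nra]).
  assert (Kc : K c) by (split; [trivial|nra]).
  assert (Kbt : K bt) by (split; [trivial|unfold bt; rewrite lin_seg, Hlw; nra]).
  assert (Kct : K ct) by (split; [trivial|unfold ct; rewrite lin_seg, Hlw; nra]).
  assert (E1 := HK _ _ _ Kbt Kb Kc); assert (E2 := HK _ _ _ Kbt Kc Kct).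
  replace (tri g w b c) with (tri g w bt ct + tri g bt b c + tri g bt c ct)%C;
    [rewrite E1, E2; ring|].
  unfold tri.
  rewrite (J_split g w b t Ht') by (apply star_cont_seg; trivial).
  rewrite (J_rev g w c), (J_split g w c t Ht') by (apply star_cont_seg; trivial).
  fold bt ct.
  rewrite (J_rev g bt ct), (J_rev g bt c), (J_rev g w ct), (J_rev g ct c) by (apply star_cont_seg; trivial).
  ring. }
apply Cmod_eq_0.
destruct (Rle_lt_or_eq_dec 0 (Cmod (tri g w b c)) (Cmod_ge_0 _)) as [H0|H0]; [exfalso|auto].
assert (Hc' := Hgw); rewrite continuous_C in Hc'; destruct (Hc' 1 Rlt_0_1) as [d [Hd Hd']].
set (P := per w b c); set (M := Cmod (g w) + 1).
assert (HM : 1 <= M) by (unfold M; generalize (Cmod_ge_0 (g w)); lra).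
assert (HP : Cmod (b - w)%C <= P /\ Cmod (c - w)%C <= P).
{ unfold P, per; rewrite (Cmod_minus_sym c w).
  generalize (Cmod_ge_0 (b - w)%C) (Cmod_ge_0 (c - b)%C) (Cmod_ge_0 (w - c)%C); lra. }
assert (HP0 : 0 <= P) by (generalize (Cmod_ge_0 (b - w)%C); lra).
(* Small enough that the small triangle stays where [g] is bounded by [M] and that its perimeter
   times [M] is below the supposed nonzero modulus. *)
set (t := Rmin 1 (Rmin (d / (P + 1) / 2) (Cmod (tri g w b c) / (P * M + 1)) )).
assert (Hd1 : 0 < d / (P + 1)) by (apply Rdiv_lt_0_compat; lra).
assert (Ht2 : 0 < Cmod (tri g w b c) / (P * M + 1)) by (apply Rdiv_lt_0_compat; nra).
assert (Ht : 0 < t <= 1) by (split; [repeat apply Rmin_glb_lt; lra|apply Rmin_l]).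
assert (Htd : t * P < d).
{ assert (t <= d / (P + 1) / 2) by (eapply Rle_trans; [apply Rmin_r|apply Rmin_l]).
  assert (d / (P + 1) * (P + 1) = d) by (field; lra). nra. }
assert (Htt : t * (P * M + 1) <= Cmod (tri g w b c)).
{ apply Rle_div_r; [nra|]; eapply Rle_trans; [apply Rmin_r|apply Rmin_r]. }
rewrite (Hsplit t Ht) in Htt.
assert (Hsm : forall x, Cmod (seg w x t - w)%C = t * Cmod (x - w)%C).
{ intros x; replace (seg w x t - w)%C with (RtoC t * (x - w))%C by (unfold seg; ring).
  rewrite Cmod_mult, Cmod_R, Rabs_pos_eq; lra. }
assert (Hper : Cmod (seg w b t - w)%C + Cmod (seg w c t - seg w b t)%C + Cmod (w - seg w c t)%C = t * P).
{ unfold P, per; rewrite (Cmod_minus_sym w (seg w c t)), !Hsm, (Cmod_minus_sym w c).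
  replace (seg w c t - seg w b t)%C with (RtoC t * (c - b))%C by (unfold seg; ring).
  rewrite Cmod_mult, Cmod_R, Rabs_pos_eq; lra. }
assert (Hnear : forall x y s, 0 <= s <= 1 -> Cmod (x - w)%C <= t * P -> Cmod (y - w)%C <= t * P ->
   Cmod (g (seg x y s)) <= M).
{ intros x y s Hs Hx Hy.
  assert (Cmod (seg x y s - w)%C <= t * P) by (apply Cmod_seg_le; trivial).
  specialize (Hd' (seg x y s)); unfold M.
  generalize (Cmod_sub_ge (g (seg x y s)) (g w)); lra. }
assert (Hbt : Cmod (seg w b t - z0)%C <= r) by (apply Cmod_seg_le; trivial; lra).
assert (Hct : Cmod (seg w c t - z0)%C <= r) by (apply Cmod_seg_le; trivial; lra).
assert (Hb1 : Cmod (seg w b t - w)%C <= t * P) by (rewrite Hsm; nra).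
assert (Hc1 : Cmod (seg w c t - w)%C <= t * P) by (rewrite Hsm; nra).
assert (Hw1 : Cmod (w - w)%C <= t * P).
{ replace (w - w)%C with (RtoC 0) by ring; rewrite Cmod_0; nra. }
assert (HJ : forall x y, Cmod (x - z0)%C <= r -> Cmod (y - z0)%C <= r ->
   Cmod (x - w)%C <= t * P -> Cmod (y - w)%C <= t * P -> Cmod (J g x y) <= Cmod (y - x)%C * M).
{ intros x y H1 H2 H3 H4; apply J_bound; [apply star_cont_seg; trivial|]; intros s Hs; auto. }
assert (HF : Cmod (tri g w (seg w b t) (seg w c t)) <= t * P * M).
{ rewrite <- Hper, !Rmult_plus_distr_r; unfold tri.
  eapply Rle_trans; [apply Cmod_triangle|]; apply Rplus_le_compat; [|apply HJ; trivial].
  eapply Rle_trans; [apply Cmod_triangle|]; apply Rplus_le_compat; apply HJ; trivial. }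
nra.
Qed.

(** Integrating from the exceptional point itself means that every triangle involved has [w] as a
    vertex, the case covered by [star_goursat]. At [z = w] the increment is already an integral from
    [w], and [J_local] suffices. *)
Lemma star_primitive z : Cmod (z - z0)%C < r -> Cderiv (fun y => J g w y) z (g z).
Proof.
intros Hz; apply Cderiv_eps; intros e He.
set (s := r - Cmod (z - z0)%C).
assert (Hs : 0 < s) by (unfold s; lra).
assert (Hin : forall y, Cmod (y - z)%C < s -> Cmod (y - z0)%C <= r).
{ intros y Hy; generalize (Cmod_triangle3 y z z0); unfold s in *; lra. }
destruct (J_local g z e He) as [d [Hd HJ]].
{ apply star_cont; lra. }
{ exists s; split; trivial; intros y Hy; apply star_cont; auto. }
(* For [y] closer to [z] than [w] is, the triangle [w z y] meets the condition of [star_goursat];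
   for [z = w] the value 1 is a placeholder. *)
set (d' := if Ceq_dec z w then 1 else Cmod (z - w)%C).
assert (Hd' : 0 < d').
{ unfold d'; destruct (Ceq_dec z w); [lra|apply Cmod_sub_pos; trivial]. }
exists (Rmin d (Rmin s d')); split; [repeat apply Rmin_glb_lt; trivial|].
intros y Hy.
assert (Hy1 : Cmod (y - z)%C < d) by (eapply Rlt_le_trans; [exact Hy|apply Rmin_l]).
assert (Hy2 : Cmod (y - z)%C < s) by (eapply Rlt_le_trans; [exact Hy|eapply Rle_trans; [apply Rmin_r|apply Rmin_l]]).
assert (Hy3 : Cmod (y - z)%C < d') by (eapply Rlt_le_trans; [exact Hy|eapply Rle_trans; [apply Rmin_r|apply Rmin_r]]).
replace (J g w y - J g w z)%C with (J g z y); [auto|].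
unfold d' in Hy3; destruct (Ceq_dec z w) as [->|Hn].
- rewrite (J_point g w); ring.
- assert (E : tri g w z y = 0) by (apply star_goursat; auto; lra).
  unfold tri in E; rewrite (J_rev g w y) in E by (apply star_cont_seg; auto).
  replace (J g z y) with ((J g w z + J g z y + - J g w y) + J g w y - J g w z)%C by ring.
  rewrite E; ring.
Qed.

End Star.

(** * Cauchy's formula and its consequences *)

Lemma is_derive_eps (f : R -> R) t l : is_derive f t l ->
  forall e, 0 < e -> exists d, 0 < d /\
    forall s, Rabs (s - t) < d -> Rabs (f s - f t - (s - t) * l) <= e * Rabs (s - t).
Proof.
intros [_ H] e He.
specialize (H t (fun P Q => Q) (mkposreal e He)).
destruct H as [d H].
exists (pos d); split; [apply cond_pos|]; intros w Hw; exact (H w Hw).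
Qed.

Lemma RCderiv_pair (x y : R -> R) t x' y' :
  is_derive x t x' -> is_derive y t y' -> RCderiv (fun s => (x s, y s)) t (x', y').
Proof.
intros Hx Hy; apply RCderiv_eps; intros e He.
destruct (is_derive_eps x t x' Hx (e / 2)) as [d1 [Hd1 H1]]; [lra|].
destruct (is_derive_eps y t y' Hy (e / 2)) as [d2 [Hd2 H2]]; [lra|].
exists (Rmin d1 d2); split; [apply Rmin_glb_lt; trivial|].
intros s Hs.
specialize (H1 s (Rlt_le_trans _ _ _ Hs (Rmin_l _ _))).
specialize (H2 s (Rlt_le_trans _ _ _ Hs (Rmin_r _ _))).
eapply Rle_trans; [apply Cmod_le_abs|].
unfold Re, Im, Cminus, Cplus, Copp, Cmult, RtoC; simpl.
replace (x s + - x t + - ((s - t) * x' - 0 * y')) with (x s - x t - (s - t) * x') by ring.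
replace (y s + - y t + - ((s - t) * y' + 0 * x')) with (y s - y t - (s - t) * y') by ring.
lra.
Qed.

Definition cis (t : R) : C := (cos t, sin t).

Lemma cis_plus s t : cis (s + t) = (cis s * cis t)%C.
Proof. unfold cis, Cmult; simpl; rewrite cos_plus, sin_plus; f_equal; ring. Qed.

Lemma Cmod_cis t : Cmod (cis t) = 1.
Proof.
transitivity (sqrt 1); [unfold Cmod, cis; simpl; f_equal|apply sqrt_1].
generalize (sin2_cos2 t); unfold Rsqr; lra.
Qed.

Lemma cis_neq_0 t : cis t <> 0.
Proof. apply Cmod_gt_0; rewrite Cmod_cis; lra. Qed.

Lemma RCderiv_cis t : RCderiv cis t (Ci * cis t)%C.
Proof.
replace (Ci * cis t)%C with (- sin t, cos t).
- apply (RCderiv_pair cos sin); [apply is_derive_cos|apply is_derive_sin].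
- unfold Ci, cis, Cmult; simpl; f_equal; ring.
Qed.

Lemma cis_2PI : cis (2 * PI) = 1.
Proof. unfold cis; rewrite cos_2PI, sin_2PI; reflexivity. Qed.

Lemma cis_0 : cis 0 = 1.
Proof. unfold cis; rewrite cos_0, sin_0; reflexivity. Qed.

Lemma cis_2PI_n k : cis (INR k * (2 * PI)) = 1.
Proof.
induction k as [|k IH]; [simpl; rewrite Rmult_0_l; apply cis_0|].
rewrite S_INR, Rmult_plus_distr_r, cis_plus, IH, Rmult_1_l, cis_2PI; ring.
Qed.

Lemma cis_opp t : cis (- t) = (/ cis t)%C.
Proof.
assert (Et : (cis (- t) * cis t)%C = 1).
{ rewrite <- cis_plus; replace (- t + t) with 0 by ring; apply cis_0. }
replace (cis (- t)) with ((cis (- t) * cis t) * / cis t)%C by (field; apply cis_neq_0).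
rewrite Et; ring.
Qed.

Lemma cis_pow t n : (cis t ^ n)%C = cis (INR n * t).
Proof.
induction n as [|n IH]; [simpl; rewrite Rmult_0_l, cis_0; reflexivity|].
rewrite Cpow_S, IH, <- cis_plus; f_equal; rewrite S_INR; ring.
Qed.

Lemma angle_pow n : (2 <= n)%nat -> ((cis (- (PI / INR n)) ^ 2) ^ n)%C = 1.
Proof.
intros Hn; rewrite <- Cpow_mult_r, cis_pow, mult_INR.
replace (INR 2 * INR n * - (PI / INR n)) with (- (2 * PI)).
- rewrite cis_opp, cis_2PI; field; apply RtoC_neq_0; lra.
- simpl; field; apply not_0_INR; lia.
Qed.

Lemma RCderiv_cis_lin (a t : R) : RCderiv (fun t => cis (a * t)) t (RtoC a * Ci * cis (a * t))%C.
Proof.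
replace (RtoC a * Ci * cis (a * t))%C with (- a * sin (a * t), a * cos (a * t)).
- apply (RCderiv_pair (fun t => cos (a * t)) (fun t => sin (a * t))); auto_derive; trivial; ring.
- unfold cis, Ci, Cmult, RtoC; simpl fst; simpl snd; f_equal; ring.
Qed.

Lemma zero_one_neq : RtoC 0 <> RtoC 1.
Proof. intros H; apply RtoC_inj in H; lra. Qed.

Lemma Cmult_eps (x0 y0 : C) e : 0 < e -> exists d, 0 < d /\
  forall x y, Cmod (x - x0)%C < d -> Cmod (y - y0)%C < d -> Cmod (x * y - x0 * y0)%C < e.
Proof.
intros He; set (A := Cmod x0 + Cmod y0 + 2).
assert (HA : 0 < A) by (unfold A; generalize (Cmod_ge_0 x0) (Cmod_ge_0 y0); lra).
exists (Rmin 1 (e / A)); split; [apply Rmin_glb_lt; [lra|apply Rdiv_lt_0_compat; lra]|].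
intros x y Hx Hy.
assert (Hx1 := Rlt_le_trans _ _ _ Hx (Rmin_r _ _)); assert (Hy1 := Rlt_le_trans _ _ _ Hy (Rmin_r _ _)).
assert (Hy2 := Rlt_le_trans _ _ _ Hy (Rmin_l _ _)).
apply Rlt_div_r in Hx1; trivial; apply Rlt_div_r in Hy1; trivial.
replace (x * y - x0 * y0)%C with ((x - x0) * (y - y0) + (x - x0) * y0 + x0 * (y - y0))%C by ring.
eapply Rle_lt_trans; [apply Cmod_triangle|].
eapply Rle_lt_trans; [apply Rplus_le_compat_r, Cmod_triangle|].
rewrite !Cmod_mult; unfold A in *.
revert Hx1 Hy1 Hy2; generalize (Cmod_ge_0 x0) (Cmod_ge_0 y0) (Cmod_ge_0 (x - x0)%C) (Cmod_ge_0 (y - y0)%C).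
generalize (Cmod x0) (Cmod y0) (Cmod (x - x0)%C) (Cmod (y - y0)%C); intros a b u v; intros.
destruct (Rle_dec u v); nra.
Qed.

Lemma continuous_Cmult (f g : C -> C) z : continuous f z -> continuous g z -> continuous (fun w => f w * g w)%C z.
Proof.
rewrite !continuous_C; intros G1 G2 e He.
destruct (Cmult_eps (f z) (g z) e He) as [d' [Hd' G]].
destruct (G1 d' Hd') as [a1 [Ha1 A1]]; destruct (G2 d' Hd') as [a2 [Ha2 A2]].
exists (Rmin a1 a2); split; [apply Rmin_glb_lt; trivial|]; intros w Hw; apply G; [apply A1|apply A2];
eapply Rlt_le_trans; try exact Hw; [apply Rmin_l|apply Rmin_r].
Qed.

Lemma continuous_Cpow (f : C -> C) z n : continuous f z -> continuous (fun w => f w ^ n)%C z.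
Proof.
intros H; apply (continuous_comp f (fun w => w ^ n)%C); trivial.
apply Choloat_cont, Choloat_pow, Choloat_id.
Qed.

Lemma continuous_Cmult_path (f g : R -> C) t : continuous f t -> continuous g t -> continuous (fun s => f s * g s)%C t.
Proof.
rewrite !continuous_RC; intros Hf Hg e He.
destruct (Cmult_eps (f t) (g t) e He) as [d [Hd H]].
destruct (Hf d Hd) as [d1 [Hd1 H1]]; destruct (Hg d Hd) as [d2 [Hd2 H2]].
exists (Rmin d1 d2); split; [apply Rmin_glb_lt; trivial|].
intros s Hs; apply H; [apply H1|apply H2]; eapply Rlt_le_trans; try exact Hs; [apply Rmin_l|apply Rmin_r].
Qed.

(** * The Cauchy kernel on a circle *)

Section Kernel.

Variables (phi : R -> C) (rho M : R).
Hypothesis Hrho : 0 < rho.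
Hypothesis Hphi : forall t, 0 <= t <= 2 * PI -> continuous phi t.
Hypothesis HM : forall t, 0 <= t <= 2 * PI -> Cmod (phi t) <= M.

Let zeta (t : R) : C := (RtoC rho * cis t)%C.

(** With [zeta = rho e^(i t)] one has [d zeta = i zeta dt], so up to the factor [i] this is the
    Cauchy integral of [phi * zeta ^ (- n)]. If [phi] is a holomorphic function on the circle, it is
    [2 pi] times the remainder of its Taylor series after [n] terms, divided by [w ^ n]. *)
Definition kern n (w : C) : C :=
  CI (fun t => phi t * ((/ (RtoC rho * cis t)) ^ n * (RtoC rho * cis t / (RtoC rho * cis t - w))))%C 0 (2 * PI).

Lemma zeta_mod t : Cmod (zeta t) = rho.
Proof. unfold zeta; rewrite Cmod_mult, Cmod_cis, Cmod_R, Rabs_pos_eq; lra. Qed.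

Lemma zeta_neq_0 t : zeta t <> 0.
Proof. apply Cmod_gt_0; rewrite zeta_mod; lra. Qed.

Lemma zeta_minus w t : Cmod w < rho -> rho - Cmod w <= Cmod (zeta t - w)%C.
Proof. intros Hw; generalize (Cmod_sub_ge (zeta t) w); rewrite zeta_mod; trivial. Qed.

Lemma zeta_minus_neq w t : Cmod w < rho -> (zeta t - w)%C <> 0.
Proof. intros Hw; apply Cmod_gt_0; generalize (zeta_minus w t Hw); lra. Qed.

Lemma kern_cont (F : C -> C) t : 0 <= t <= 2 * PI -> Choloat F (zeta t) ->
  continuous (fun t => phi t * F (zeta t))%C t.
Proof.
intros Ht HF; apply continuous_Cmult_path; auto.
apply (continuous_comp zeta F).
- apply (continuous_Cmult_path (fun _ => RtoC rho)); [apply continuous_const|].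
  apply (RCderiv_cont _ _ _ (RCderiv_cis t)).
- apply Choloat_cont; trivial.
Qed.

Lemma kern_isI n w : Cmod w < rho ->
  isI (fun t => phi t * ((/ zeta t) ^ n * (zeta t / (zeta t - w))))%C 0 (2 * PI) (kern n w).
Proof.
intros Hw; apply CI_correct; [generalize PI_RGT_0; lra|].
intros t Ht; apply (kern_cont (fun z => (/ z) ^ n * (z / (z - w)))%C); trivial.
apply Choloat_mult.
- apply (Choloat_pow (fun z => / z)%C).
  destruct (Choloat_div (fun _ => RtoC 1) (fun z => z) (zeta t)) as [l Hl];
    [apply Choloat_const|apply Choloat_id|apply zeta_neq_0|].
  exists l; apply Cderiv_ext with (2 := Hl); intros x; unfold Cdiv; ring.
- apply Choloat_div; [apply Choloat_id| |apply zeta_minus_neq; trivial].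
  apply Choloat_minus; [apply Choloat_id|apply Choloat_const].
Qed.

(** The partial fraction [zeta / (zeta - w) = 1 + (w / zeta) * (zeta / (zeta - w))]; the value of
    [kern n] at 0 is the plain moment of [phi]. *)
Lemma kern_step n w : Cmod w < rho -> kern n w = (kern n 0 + w * kern (S n) w)%C.
Proof.
intros Hw.
assert (H0 : Cmod 0 < rho) by (rewrite Cmod_0; lra).
apply (isI_unique _ _ _ _ _ (kern_isI n w Hw)).
apply isI_ext with (3 := isI_plus _ _ _ _ _ _ (kern_isI n 0 H0) (isI_mult w _ _ _ _ (kern_isI (S n) w Hw))).
- generalize PI_RGT_0; lra.
- intros t _; rewrite Cpow_S; field; split; [|apply zeta_neq_0].
  apply zeta_minus_neq; trivial.
Qed.

Lemma Cmod_inv_zeta_pow n t : Cmod ((/ zeta t) ^ n)%C = (/ rho) ^ n.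
Proof. rewrite Cmod_pow, Cmod_inv, zeta_mod; trivial; apply zeta_neq_0. Qed.

Lemma kern_bound n w : Cmod w < rho / 2 -> Cmod (kern n w) <= 2 * PI * (2 * M * (/ rho) ^ n).
Proof.
intros Hw.
assert (Hw' : Cmod w < rho) by lra.
replace (2 * PI) with (2 * PI - 0) at 1 by ring.
apply isI_bound with (3 := kern_isI n w Hw'); [generalize PI_RGT_0; lra|].
intros t Ht; rewrite !Cmod_mult, Cmod_inv_zeta_pow, Cmod_div, zeta_mod by (apply zeta_minus_neq; trivial).
assert (Hz := zeta_minus w t Hw').
assert (Hq : rho / Cmod (zeta t - w)%C <= 2) by (apply Rle_div_l; lra).
assert (Hp : 0 < (/ rho) ^ n) by (apply pow_lt, Rinv_0_lt_compat; lra).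
assert (0 <= rho / Cmod (zeta t - w)%C) by (apply Rlt_le, Rdiv_lt_0_compat; lra).
specialize (HM t Ht); generalize (Cmod_ge_0 (phi t)); intros.
apply Rle_trans with (M * ((/ rho) ^ n * 2)); [|lra].
apply Rmult_le_compat; trivial; [nra|]; apply Rmult_le_compat_l; lra.
Qed.

Lemma kern_lip n w1 w2 : Cmod w1 < rho / 2 -> Cmod w2 < rho / 2 ->
  Cmod (kern n w1 - kern n w2)%C <= 2 * PI * (4 / rho * M * (/ rho) ^ n) * Cmod (w1 - w2)%C.
Proof.
intros Hw1 Hw2.
assert (Hw1' : Cmod w1 < rho) by lra; assert (Hw2' : Cmod w2 < rho) by lra.
replace (2 * PI) with (2 * PI - 0) at 1 by ring; rewrite Rmult_assoc.
apply isI_bound with (3 := isI_minus _ _ _ _ _ _ (kern_isI n w1 Hw1') (kern_isI n w2 Hw2')); [generalize PI_RGT_0; lra|].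
intros t Ht.
assert (N1 := zeta_minus_neq w1 t Hw1'); assert (N2 := zeta_minus_neq w2 t Hw2').
replace (phi t * ((/ zeta t) ^ n * (zeta t / (zeta t - w1))) - phi t * ((/ zeta t) ^ n * (zeta t / (zeta t - w2))))%C
  with (phi t * ((/ zeta t) ^ n * (zeta t / (zeta t - w1) * (/ (zeta t - w2) * (w1 - w2)))))%C
  by (field; auto using zeta_neq_0).
rewrite !Cmod_mult, Cmod_inv_zeta_pow, Cmod_div, Cmod_inv, zeta_mod by trivial.
assert (Z1 := zeta_minus w1 t Hw1'); assert (Z2 := zeta_minus w2 t Hw2').
assert (Hp : 0 < (/ rho) ^ n) by (apply pow_lt, Rinv_0_lt_compat; lra).
assert (Q1 : rho / Cmod (zeta t - w1)%C <= 2) by (apply Rle_div_l; lra).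
assert (Q2 : / Cmod (zeta t - w2)%C <= 2 / rho).
{ replace (2 / rho) with (/ (rho / 2)) by (field; lra); apply Rinv_le_contravar; lra. }
assert (0 <= rho / Cmod (zeta t - w1)%C) by (apply Rlt_le, Rdiv_lt_0_compat; lra).
assert (0 <= / Cmod (zeta t - w2)%C) by (apply Rlt_le, Rinv_0_lt_compat; lra).
assert (D0 := Cmod_ge_0 (w1 - w2)%C).
specialize (HM t Ht); generalize (Cmod_ge_0 (phi t)); intros.
apply Rle_trans with (M * ((/ rho) ^ n * (2 * (2 / rho * Cmod (w1 - w2)%C)))).
- apply Rmult_le_compat; trivial.
  + apply Rmult_le_pos; [lra|]; apply Rmult_le_pos; trivial; apply Rmult_le_pos; trivial.
  + apply Rmult_le_compat_l; [lra|]; apply Rmult_le_compat; trivial.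
    * apply Rmult_le_pos; trivial.
    * apply Rmult_le_compat_r; trivial.
- right; field; lra.
Qed.

End Kernel.

(** The higher moments of the constant function vanish, having an explicit periodic primitive. Hence
    [kern 1 w = w ^ n * kern (n + 1) w] for all [n], which tends to 0, and only the zeroth moment
    [2 pi] remains. *)
Lemma kern_one rho w : 0 < rho -> Cmod w < rho / 2 -> kern (fun _ => RtoC 1) rho 0 w = RtoC (2 * PI).
Proof.
intros Hr Hw.
assert (Hc : forall t, 0 <= t <= 2 * PI -> continuous (fun _ : R => RtoC 1) t) by (intros; apply continuous_const).
assert (Hb : forall t, 0 <= t <= 2 * PI -> Cmod ((fun _ : R => RtoC 1) t) <= 1) by (intros; rewrite Cmod_1; lra).
assert (Hw' : Cmod w < rho) by lra.
assert (H0 : Cmod 0 < rho) by (rewrite Cmod_0; lra).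
assert (HPI := PI_RGT_0).
assert (K0 : kern (fun _ => RtoC 1) rho 0 0 = RtoC (2 * PI)).
{ apply isI_CI.
  replace (RtoC (2 * PI)) with (RtoC (2 * PI - 0) * 1)%C by (rewrite Rminus_0_r; ring).
  apply isI_ext with (3 := isI_const 1 0 (2 * PI)); [lra|].
  intros t _; simpl.
  assert (Hz := zeta_neq_0 rho Hr t); cbv beta in Hz; field; auto.
  replace (RtoC rho * cis t - 0)%C with (RtoC rho * cis t)%C by ring; split; auto using cis_neq_0.
  apply RtoC_neq_0; lra. }
assert (KS : forall n, kern (fun _ => RtoC 1) rho (S n) 0 = 0).
{ intros n; apply isI_CI.
  set (a := - INR (S n)).
  assert (Hn : RtoC a <> 0).
  { apply RtoC_neq_0; unfold a; generalize (lt_0_INR (S n) (Nat.lt_0_succ n)); lra. }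
  assert (Hr0 : RtoC rho <> 0) by (apply RtoC_neq_0; lra).
  set (F := fun t => ((/ (RtoC rho)) ^ S n * ((- Ci / RtoC a) * cis (a * t)))%C).
  assert (E : (F (2 * PI)%R - F 0%R)%C = 0).
  { unfold F; rewrite Rmult_0_r, cis_0.
    replace (a * (2 * PI)) with (- (INR (S n) * (2 * PI))) by (unfold a; ring).
    rewrite cis_opp, cis_2PI_n; field; auto. }
  match goal with |- isI ?f ?a ?b _ => cut (isI f a b (F (2 * PI)%R - F 0%R)%C) end; [rewrite E; trivial|].
  assert (Hcp : forall t k, ((/ cis t) ^ k)%C = cis (- (INR k * t))).
  { intros t k; rewrite <- cis_opp, cis_pow; f_equal; ring. }
  assert (HFd : forall t, RCderiv F t ((/ RtoC rho) ^ S n * cis (a * t))%C).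
  { intros t; unfold F.
    assert (D2 : Cderiv (fun z => (/ (RtoC rho)) ^ S n * ((- Ci / RtoC a) * z))%C (cis (a * t))
       ((/ RtoC rho) ^ S n * (- Ci / RtoC a))%C).
    { eapply Cderiv_val; [apply Cderiv_mult; [apply Cderiv_const|apply Cderiv_mult; [apply Cderiv_const|apply Cderiv_id]]|].
      cbv beta; ring. }
    assert (D3 := RCderiv_comp _ (fun t => cis (a * t)) _ _ _ D2 (RCderiv_cis_lin a t)); cbv beta in D3.
    replace ((/ RtoC rho) ^ S n * cis (a * t))%C with
     (RtoC a * Ci * cis (a * t) * ((/ RtoC rho) ^ S n * (- Ci / RtoC a)))%C; [exact D3|].
    assert (EI : (Ci * Ci)%C = (- (1))%C) by (unfold Ci, Cmult, Copp, RtoC; simpl; f_equal; ring).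
    transitivity (- (Ci * Ci) * ((/ RtoC rho) ^ S n * cis (a * t)))%C; [field; auto|rewrite EI; ring]. }
  apply isI_ext with (f := fun t => ((/ RtoC rho) ^ S n * cis (a * t))%C); [lra| |].
  - intros t _; replace (a * t) with (- (INR (S n) * t)) by (unfold a; ring).
    rewrite <- Hcp, <- Cpow_mult_l.
    assert (Hz := zeta_neq_0 rho Hr t); cbv beta in Hz.
    replace (/ (RtoC rho * cis t))%C with (/ RtoC rho * / cis t)%C by (field; split; auto using cis_neq_0).
    replace (RtoC rho * cis t - 0)%C with (RtoC rho * cis t)%C by ring.
    unfold Cdiv; rewrite Cinv_r by trivial; ring.
  - apply isI_FTC; [lra|intros t _; apply HFd|].
    intros t _; apply (continuous_Cmult_path (fun _ => ((/ RtoC rho) ^ S n)%C)); [apply continuous_const|].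
    apply (RCderiv_cont _ _ _ (RCderiv_cis_lin a t)). }
assert (Hn : forall n, kern (fun _ => RtoC 1) rho 1 w = (w ^ n * kern (fun _ => RtoC 1) rho (S n) w)%C).
{ intros n; induction n as [|n IH]; [simpl; ring|].
  rewrite IH, (kern_step _ rho Hr Hc (S n) w Hw'), KS, Cpow_S; ring. }
rewrite (kern_step _ rho Hr Hc 0 w Hw'), K0.
replace (kern (fun _ : R => RtoC 1) rho 1 w) with (RtoC 0); [ring|].
symmetry; apply Cmod_eq_0.
destruct (Rle_lt_or_eq_dec 0 (Cmod (kern (fun _ : R => RtoC 1) rho 1 w)) (Cmod_ge_0 _)) as [HH|HH]; [exfalso|auto].
destruct (pow_half_small (4 * PI * / rho) _ HH) as [N HN].
specialize (HN N (le_n N)); rewrite (Hn N) in HN.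
revert HN; apply Rle_not_lt; rewrite Cmod_mult, Cmod_pow.
assert (B := kern_bound _ rho 1 Hr Hc Hb (S N) w Hw).
assert (Hwp : Cmod w ^ N <= (rho / 2) ^ N) by (apply pow_incr; generalize (Cmod_ge_0 w); lra).
apply Rle_trans with ((rho / 2) ^ N * (2 * PI * (2 * 1 * (/ rho) ^ S N))).
- apply Rmult_le_compat; trivial; [apply pow_le, Cmod_ge_0|apply Cmod_ge_0].
- replace ((rho / 2) ^ N) with (rho ^ N * (/ 2) ^ N) by (rewrite <- Rpow_mult_distr; reflexivity).
  simpl pow; generalize ((/ 2) ^ N); intros h; rewrite pow_inv.
  assert (rho ^ N <> 0) by (apply pow_nonzero; lra).
  right; field; split; trivial; lra.
Qed.

(** * Cauchy's formula, Taylor remainders, order of vanishing and local inverses *)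

Definition holo_disc (f : C -> C) (z0 : C) (D0 : R) := forall z, Cmod (z - z0)%C < D0 -> Choloat f z.

(** Holomorphic off [w] and continuous at [w] is exactly the regularity that [star_primitive]
    accepts, so no removable singularity theorem enters. *)
Lemma divided_difference (f : C -> C) (w : C) (D0 : R) (z0 : C) :
  holo_disc f z0 D0 -> Cmod (w - z0)%C < D0 ->
  exists g, (forall z, z <> w -> g z = ((f z - f w) / (z - w))%C) /\
    (forall z, Cmod (z - z0)%C < D0 -> z <> w -> Choloat g z) /\ continuous g w /\ Cderiv f w (g w).
Proof.
intros Hf Hw; destruct (Hf w Hw) as [l Hl].
set (g := fun z => if Ceq_dec z w then l else ((f z - f w) / (z - w))%C).
assert (Hg : forall z, z <> w -> g z = ((f z - f w) / (z - w))%C).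
{ intros z Hz; unfold g; destruct (Ceq_dec z w); tauto. }
assert (Hgw : g w = l) by (unfold g; destruct (Ceq_dec w w); tauto).
exists g; split; [trivial|split; [|split]].
- intros z Hz Hzw.
  assert (Hn : (z - w)%C <> 0) by (apply Cmod_gt_0, Cmod_sub_pos; trivial).
  apply Choloat_ext_loc with (f := fun z => ((f z - f w) / (z - w))%C) (d := Cmod (z - w)%C).
  + apply Cmod_sub_pos; trivial.
  + intros y Hy; symmetry; apply Hg; intros ->; rewrite Cmod_minus_sym in Hy; lra.
  + apply Choloat_div; trivial; apply Choloat_minus; auto using Choloat_const, Choloat_id.
- apply continuous_C; intros e He; rewrite Hgw.
  assert (Hl' := Hl); rewrite Cderiv_eps in Hl'.
  destruct (Hl' (e / 2)) as [d [Hd H]]; [lra|].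
  exists d; split; trivial; intros z Hz; unfold g.
  destruct (Ceq_dec z w) as [E|E].
  + replace (l - l)%C with (RtoC 0) by ring; rewrite Cmod_0; trivial.
  + assert (Hp := Cmod_sub_pos _ _ E).
    assert (Hn : (z - w)%C <> 0) by (apply Cmod_gt_0; trivial).
    replace ((f z - f w) / (z - w) - l)%C with ((f z - f w - (z - w) * l) / (z - w))%C by (field; trivial).
    rewrite Cmod_div by trivial; specialize (H z Hz).
    apply Rle_lt_trans with (e / 2); [|lra]; apply Rle_div_l; trivial.
- rewrite Hgw; trivial.
Qed.

Lemma circle_cont (f : C -> C) z0 rho t : continuous f (z0 + RtoC rho * cis t)%C ->
  continuous (fun t => f (z0 + RtoC rho * cis t)%C) t.
Proof.
intros H; apply (continuous_comp (fun t => z0 + RtoC rho * cis t)%C f); trivial.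
apply (continuous_comp cis (fun z => z0 + RtoC rho * z)%C).
- apply (RCderiv_cont _ _ _ (RCderiv_cis t)).
- eapply Cderiv_cont; apply Cderiv_plus; [apply Cderiv_const|].
  apply Cderiv_mult; [apply Cderiv_const|apply Cderiv_id].
Qed.

(** The divided difference at [z0 + w] has a primitive, so its integral over the closed circle is 0;
    splitting the quotient leaves the kernel of [f] minus [f (z0 + w)] times the kernel of 1. *)
Lemma cauchy_formula (f : C -> C) z0 D0 rho w :
  holo_disc f z0 D0 -> 0 < rho < D0 -> Cmod w < rho / 2 ->
  kern (fun t => f (z0 + RtoC rho * cis t)%C) rho 0 w = (RtoC (2 * PI) * f (z0 + w))%C.
Proof.
intros Hf Hr Hw; set (v := (z0 + w)%C).
assert (Hv : (v - z0)%C = w) by (unfold v; ring).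
assert (HvR : Cmod (v - z0)%C < D0) by (rewrite Hv; lra).
destruct (divided_difference f v D0 z0 Hf HvR) as [g [Hg1 [Hg2 [Hg3 _]]]].
(* A closed disc strictly between the circle and the domain, since the primitive is differentiable
   only in the interior of its disc. *)
set (r := (rho + D0) / 2).
assert (Hvr : Cmod (v - z0)%C <= r) by (rewrite Hv; unfold r; lra).
assert (Hg2' : forall z, Cmod (z - z0)%C <= r -> z <> v -> Choloat g z).
{ intros z Hz; apply Hg2; unfold r in *; lra. }
set (c := fun t => (z0 + RtoC rho * cis t)%C).
assert (Hc : forall t, Cmod (c t - z0)%C = rho).
{ intros t; unfold c; replace (z0 + RtoC rho * cis t - z0)%C with (RtoC rho * cis t)%C by ring.
  apply zeta_mod; lra. }
assert (Hcv : forall t, c t <> v).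
{ intros t E; specialize (Hc t); rewrite E, Hv in Hc; lra. }
assert (Hcd : forall t, RCderiv c t (Ci * (RtoC rho * cis t))%C).
{ intros t; assert (D : Cderiv (fun z => z0 + RtoC rho * z)%C (cis t) (RtoC rho)).
  { eapply Cderiv_val; [apply Cderiv_plus; [apply Cderiv_const|]; apply Cderiv_mult; [apply Cderiv_const|apply Cderiv_id]|cbv beta; ring]. }
  assert (D2 := RCderiv_comp _ _ _ _ _ D (RCderiv_cis t)); cbv beta in D2.
  replace (Ci * (RtoC rho * cis t))%C with (Ci * cis t * RtoC rho)%C by ring; exact D2. }
assert (I1 : isI (fun t => (Ci * (RtoC rho * cis t)) * g (c t))%C 0 (2 * PI)
               (J g v (c (2 * PI)%R) - J g v (c 0%R))%C).
{ apply (isI_FTC (fun t => J g v (c t))); [generalize PI_RGT_0; lra| |].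
  - intros t _; apply RCderiv_comp; trivial.
    apply (star_primitive g z0 v r Hvr Hg2' Hg3); rewrite Hc; unfold r; lra.
  - intros t _; apply continuous_Cmult_path.
    + apply (continuous_Cmult_path (fun _ => Ci)); [apply continuous_const|].
      apply (continuous_Cmult_path (fun _ => RtoC rho)); [apply continuous_const|].
      apply (RCderiv_cont _ _ _ (RCderiv_cis t)).
    + apply circle_cont; fold (c t); apply Choloat_cont, Hg2'; trivial.
      rewrite Hc; unfold r; lra. }
assert (E0 : (J g v (c (2 * PI)%R) - J g v (c 0%R))%C = 0).
{ unfold c; rewrite cis_2PI, cis_0; ring. }
rewrite E0 in I1.
assert (Hphi : forall t, 0 <= t <= 2 * PI -> continuous (fun t => f (c t)) t).
{ intros t _; apply circle_cont; fold (c t); apply Choloat_cont, Hf; rewrite Hc; lra. }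
assert (Hone : forall t, 0 <= t <= 2 * PI -> continuous (fun _ : R => RtoC 1) t) by (intros; apply continuous_const).
assert (Hr0 : 0 < rho) by lra; assert (Hw' : Cmod w < rho) by lra.
assert (I2 := kern_isI _ rho Hr0 Hphi 0 w Hw'); assert (I3 := kern_isI _ rho Hr0 Hone 0 w Hw').
assert (I4 := isI_mult Ci _ _ _ _ (isI_minus _ _ _ _ _ _ I2 (isI_mult (f v) _ _ _ _ I3))).
assert (E : (Ci * (kern (fun t => f (c t)) rho 0 w - f v * kern (fun _ => RtoC 1) rho 0 w))%C = 0).
{ apply (isI_unique _ _ _ _ _ I4); apply isI_ext with (3 := I1); [generalize PI_RGT_0; lra|].
  intros t _; rewrite Hg1 by trivial.
  assert (Hn := zeta_minus_neq rho Hr0 w t Hw'); cbv beta in Hn.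
  replace (c t - v)%C with (RtoC rho * cis t - w)%C by (unfold c, v; ring).
  simpl Cpow; field; trivial. }
rewrite (kern_one rho w Hr0 Hw) in E.
assert (HCi : Ci <> 0) by (intros H; injection H; lra).
change (kern (fun t => f (c t)) rho 0 w = (RtoC (2 * PI) * f v)%C).
replace (kern (fun t => f (c t)) rho 0 w) with
  (/ Ci * (Ci * (kern (fun t => f (c t)) rho 0 w - f v * RtoC (2 * PI)%R)) + RtoC (2 * PI)%R * f v)%C
  by (field; trivial).
rewrite E; ring.
Qed.

(* The remainders [r n] of the Taylor expansion, defined by [r n w = a_n + w * r (n+1) w]. *)
Lemma taylor (f : C -> C) z0 D0 : 0 < D0 -> holo_disc f z0 D0 ->
  exists rho L r, 0 < rho <= D0 /\ 0 <= L /\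
    (forall w, Cmod w < rho -> f (z0 + w)%C = r O w) /\
    (forall n w, Cmod w < rho -> r n w = (r n (RtoC 0) + w * r (S n) w)%C) /\
    (forall n w, Cmod w < rho -> Cmod (r n w) <= L * (/ (2 * rho)) ^ n) /\
    (forall n w1 w2, Cmod w1 < rho -> Cmod w2 < rho ->
       Cmod (r n w1 - r n w2)%C <= L * (/ (2 * rho)) ^ n * Cmod (w1 - w2)%C).
Proof.
intros HR Hf.
assert (Hc : continuous f z0).
{ apply Choloat_cont, Hf; replace (z0 - z0)%C with (RtoC 0) by ring; rewrite Cmod_0; trivial. }
rewrite continuous_C in Hc; destruct (Hc 1 Rlt_0_1) as [d [Hd Hdf]].
(* The radius of the circle of integration: inside the domain, and where [f] differs from [f z0] by
   less than 1. *)
set (s := Rmin d D0 / 2).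
assert (Hs0 : 0 < Rmin d D0) by (apply Rmin_glb_lt; trivial).
assert (Hs : 0 < s < D0) by (unfold s; generalize (Rmin_r d D0); lra).
assert (Hsd : s < d) by (unfold s; generalize (Rmin_l d D0); lra).
set (phi := fun t => f (z0 + RtoC s * cis t)%C); set (M := Cmod (f z0) + 1).
assert (HM0 : 0 <= M) by (unfold M; generalize (Cmod_ge_0 (f z0)); lra).
assert (Hcm : forall t, Cmod (z0 + RtoC s * cis t - z0)%C = s).
{ intros t; replace (z0 + RtoC s * cis t - z0)%C with (RtoC s * cis t)%C by ring.
  apply zeta_mod; lra. }
assert (Hphi : forall t, 0 <= t <= 2 * PI -> continuous phi t).
{ intros t _; apply circle_cont, Choloat_cont, Hf; rewrite Hcm; lra. }
assert (HM : forall t, 0 <= t <= 2 * PI -> Cmod (phi t) <= M).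
{ intros t _; unfold phi, M; specialize (Hdf (z0 + RtoC s * cis t)%C); rewrite Hcm in Hdf.
  generalize (Cmod_sub_ge (f (z0 + RtoC s * cis t)%C) (f z0)); lra. }
assert (HPI := PI_RGT_0).
assert (HP : RtoC (2 * PI) <> 0) by (apply RtoC_neq_0; lra).
assert (HPm : Cmod (/ RtoC (2 * PI))%C = / (2 * PI)).
{ rewrite Cmod_inv, Cmod_R, Rabs_pos_eq by (trivial; lra); reflexivity. }
assert (Hp : forall n, 0 <= (/ s) ^ n) by (intros n; apply pow_le, Rlt_le, Rinv_0_lt_compat; lra).
assert (H4s : 0 <= 4 / s * M).
{ apply Rmult_le_pos; trivial; apply Rlt_le, Rdiv_lt_0_compat; lra. }
(* Staying in half the circle keeps the kernel bounded; in terms of [rho = s / 2] the ratio [/ s]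
   reads [/ (2 * rho)]. [L] is the sum of the constants of the size bound and of the Lipschitz
   bound. *)
exists (s / 2), (2 * M + 4 / s * M), (fun n w => / RtoC (2 * PI) * kern phi s n w)%C.
replace (2 * (s / 2)) with s by field.
split; [lra|]; split; [lra|]; split; [|split; [|split]].
- intros w Hw; unfold phi; rewrite (cauchy_formula f z0 D0 s w Hf Hs Hw); field; trivial.
- intros n w Hw; rewrite (kern_step phi s (proj1 Hs) Hphi n w) by lra; ring.
- intros n w Hw; rewrite Cmod_mult, HPm.
  assert (B := kern_bound phi s M (proj1 Hs) Hphi HM n w Hw).
  apply Rle_trans with (/ (2 * PI) * (2 * PI * (2 * M * (/ s) ^ n))).
  + apply Rmult_le_compat_l; trivial; apply Rlt_le, Rinv_0_lt_compat; lra.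
  + rewrite <- Rmult_assoc, Rinv_l, Rmult_1_l by lra; specialize (Hp n); nra.
- intros n w1 w2 Hw1 Hw2.
  assert (B := kern_lip phi s M (proj1 Hs) Hphi HM n w1 w2 Hw1 Hw2).
  replace (/ RtoC (2 * PI) * kern phi s n w1 - / RtoC (2 * PI) * kern phi s n w2)%C with
    (/ RtoC (2 * PI) * (kern phi s n w1 - kern phi s n w2))%C by ring.
  rewrite Cmod_mult, HPm.
  apply Rle_trans with (/ (2 * PI) * (2 * PI * (4 / s * M * (/ s) ^ n) * Cmod (w1 - w2)%C)).
  + apply Rmult_le_compat_l; trivial; apply Rlt_le, Rinv_0_lt_compat; lra.
  + specialize (Hp n); revert Hp; generalize ((/ s) ^ n) (Cmod_ge_0 (w1 - w2)%C).
    generalize (Cmod (w1 - w2)%C); intros c h Hc0 Hh0.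
    replace (/ (2 * PI) * (2 * PI * (4 / s * M * h) * c)) with (4 / s * M * h * c) by (field; lra).
    apply Rmult_le_compat_r; trivial; apply Rmult_le_compat_r; lra.
Qed.

(** Strict differentiability replaces continuity of the derivative. It comes from the first Taylor
    remainder: its Lipschitz bound controls both terms of [(w1 - w2) * (r 1 w1 - r 1 0) + w2 * (r 1
    w1 - r 1 w2)]. *)
Lemma holo_strict (f : C -> C) z0 D0 : 0 < D0 -> holo_disc f z0 D0 ->
  exists l, Cderiv f z0 l /\ forall e, 0 < e -> exists d, 0 < d <= D0 /\
    forall z1 z2, Cmod (z1 - z0)%C < d -> Cmod (z2 - z0)%C < d ->
      Cmod (f z1 - f z2 - (z1 - z2) * l)%C <= e * Cmod (z1 - z2)%C.
Proof.
intros HR Hf; destruct (taylor f z0 D0 HR Hf) as [rho [L [r [Hrho [HL [H0 [H1 [_ H3]]]]]]]].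
set (K := L * (/ (2 * rho)) ^ 1).
assert (HK : 0 <= K).
{ apply Rmult_le_pos; trivial; apply pow_le, Rlt_le, Rinv_0_lt_compat; lra. }
assert (HS : forall e, 0 < e -> exists d, 0 < d <= D0 /\
    forall z1 z2, Cmod (z1 - z0)%C < d -> Cmod (z2 - z0)%C < d ->
      Cmod (f z1 - f z2 - (z1 - z2) * r 1%nat (RtoC 0))%C <= e * Cmod (z1 - z2)%C).
{ intros e He; exists (Rmin rho (e / (2 * K + 1))).
  assert (He' : 0 < e / (2 * K + 1)) by (apply Rdiv_lt_0_compat; lra).
  split; [split; [apply Rmin_glb_lt; lra|generalize (Rmin_l rho (e / (2 * K + 1))); lra]|].
  intros z1 z2 Hz1 Hz2.
  assert (Hr1 := Rlt_le_trans _ _ _ Hz1 (Rmin_l _ _)); assert (Hr2 := Rlt_le_trans _ _ _ Hz2 (Rmin_l _ _)).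
  assert (Hk1 := Rlt_le_trans _ _ _ Hz1 (Rmin_r _ _)); assert (Hk2 := Rlt_le_trans _ _ _ Hz2 (Rmin_r _ _)).
  set (w1 := (z1 - z0)%C) in *; set (w2 := (z2 - z0)%C) in *.
  apply Rlt_div_r in Hk1; [|lra]; apply Rlt_div_r in Hk2; [|lra].
  replace (f z1) with (r O w1) by (rewrite <- H0 by trivial; f_equal; unfold w1; ring).
  replace (f z2) with (r O w2) by (rewrite <- H0 by trivial; f_equal; unfold w2; ring).
  rewrite (H1 O w1), (H1 O w2) by trivial.
  replace (z1 - z2)%C with (w1 - w2)%C by (unfold w1, w2; ring).
  replace (r O (RtoC 0) + w1 * r 1%nat w1 - (r O (RtoC 0) + w2 * r 1%nat w2) - (w1 - w2) * r 1%nat (RtoC 0))%C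
    with ((w1 - w2) * (r 1%nat w1 - r 1%nat (RtoC 0)) + w2 * (r 1%nat w1 - r 1%nat w2))%C by ring.
  eapply Rle_trans; [apply Cmod_triangle|]; rewrite !Cmod_mult.
  assert (A1 := H3 1%nat w1 (RtoC 0) Hr1); assert (A2 := H3 1%nat w1 w2 Hr1 Hr2).
  rewrite Cmod_0 in A1; specialize (A1 (proj1 Hrho)); fold K in A1, A2.
  replace (w1 - RtoC 0)%C with w1 in A1 by ring.
  revert A1 A2 Hk1 Hk2; generalize (Cmod_ge_0 w1) (Cmod_ge_0 w2) (Cmod_ge_0 (w1 - w2)%C).
  generalize (Cmod w1) (Cmod w2) (Cmod (w1 - w2)%C) (Cmod (r 1%nat w1 - r 1%nat (RtoC 0))%C) (Cmod (r 1%nat w1 - r 1%nat w2)%C).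
  intros a b c u v Ha Hb Hc A1 A2 Hk1 Hk2.
  assert (c * u <= c * (K * a)) by (apply Rmult_le_compat_l; lra).
  assert (b * v <= b * (K * c)) by (apply Rmult_le_compat_l; lra).
  assert (c * (K * a + K * b) <= c * e) by (apply Rmult_le_compat_l; nra).
  nra. }
exists (r 1%nat (RtoC 0)); split; trivial.
apply Cderiv_eps; intros e He; destruct (HS e He) as [d [Hd H]]; exists d; split; [lra|].
intros w Hw; apply H; trivial.
replace (z0 - z0)%C with (RtoC 0) by ring; rewrite Cmod_0; lra.
Qed.

(** The first nonzero Taylor coefficient of positive index gives [m], and the remainder at that
    index is [g]. If there is none, [f z - f z0] is [(z - z0) ^ (n + 1)] times a remainder for every
    [n], and on the disc of radius [rho] this decays like [2 ^ (- n)]. *)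
Lemma holo_order (f : C -> C) z0 D0 : 0 < D0 -> holo_disc f z0 D0 ->
  (exists d, 0 < d /\ forall z, Cmod (z - z0)%C < d -> f z = f z0) \/
  (exists m g d, (0 < m)%nat /\ 0 < d <= D0 /\ holo_disc g z0 d /\ g z0 <> 0 /\
     forall z, Cmod (z - z0)%C < d -> f z = (f z0 + (z - z0) ^ m * g z)%C).
Proof.
intros HR Hf; destruct (taylor f z0 D0 HR Hf) as [rho [L [r [Hrho [HL [H0 [H1 [H2 H3]]]]]]]].
assert (Hz : forall z, f z = f (z0 + (z - z0))%C) by (intros z; f_equal; ring).
assert (Hf0 : f z0 = r O (RtoC 0)).
{ rewrite <- H0 by (rewrite Cmod_0; lra); f_equal; ring. }
destruct (classic (exists n, r (S n) (RtoC 0) <> 0)) as [Hex|Hnex].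
- right.
  assert (Hmin : exists m, r (S m) (RtoC 0) <> 0 /\ forall k, (k < m)%nat -> r (S k) (RtoC 0) = 0).
  { destruct Hex as [n Hn]; revert Hn; induction n as [n IH] using lt_wf_ind; intros Hn.
    destruct (classic (exists k, (k < n)%nat /\ r (S k) (RtoC 0) <> 0)) as [[k [Hk Hk']]|Hno]; [eauto|].
    exists n; split; trivial; intros k Hk; apply NNPP; intros Hk'; apply Hno; eauto. }
  destruct Hmin as [m [Hm Hk]].
  set (g := fun z => r (S m) (z - z0)%C).
  assert (Hg : forall z, Cmod (z - z0)%C < rho -> f z = (f z0 + (z - z0) ^ S m * g z)%C).
  { intros z Hzr; rewrite (Hz z), (H0 _ Hzr), (H1 O _ Hzr), Hf0; f_equal.
    unfold g; clear Hm; induction m as [|m IH].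
    - simpl; ring.
    - rewrite IH by auto; rewrite (H1 (S m) _ Hzr), Hk by lia; rewrite !Cpow_S; ring. }
  assert (Hz00 : (z0 - z0)%C = 0) by ring.
  exists (S m), g, rho; split; [lia|]; split; [trivial|]; split; [|split; [unfold g; rewrite Hz00; trivial|exact Hg]].
  (* At [z0] the next remainder provides the derivative of [g]; elsewhere [g] is a quotient of
     holomorphic functions. *)
  intros z Hzr; destruct (Ceq_dec z z0) as [->|Hne].
  + exists (r (S (S m)) (RtoC 0)); apply Cderiv_eps; intros e He.
    set (K := L * (/ (2 * rho)) ^ S (S m)).
    assert (HK : 0 <= K).
    { apply Rmult_le_pos; trivial; apply pow_le, Rlt_le, Rinv_0_lt_compat; lra. }
    assert (He' : 0 < e / (K + 1)) by (apply Rdiv_lt_0_compat; lra).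
    exists (Rmin rho (e / (K + 1))); split; [apply Rmin_glb_lt; lra|].
    intros w Hw.
    assert (Hr1 := Rlt_le_trans _ _ _ Hw (Rmin_l _ _)); assert (Hr2 := Rlt_le_trans _ _ _ Hw (Rmin_r _ _)).
    unfold g; rewrite Hz00, (H1 (S m) _ Hr1).
    replace (r (S m) (RtoC 0) + (w - z0) * r (S (S m)) (w - z0) - r (S m) (RtoC 0) - (w - z0) * r (S (S m)) (RtoC 0))%C
      with ((w - z0) * (r (S (S m)) (w - z0) - r (S (S m)) (RtoC 0)))%C by ring.
    rewrite Cmod_mult, Rmult_comm; apply Rmult_le_compat_r; [apply Cmod_ge_0|].
    eapply Rle_trans; [apply H3; trivial; rewrite Cmod_0; lra|]; fold K.
    replace (w - z0 - RtoC 0)%C with (w - z0)%C by ring.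
    apply Rlt_div_r in Hr2; [|lra]; generalize (Cmod_ge_0 (w - z0)%C); nra.
  + apply Choloat_ext_loc with (f := fun z => ((f z - f z0) / (z - z0) ^ S m)%C)
      (d := Rmin (Cmod (z - z0)%C) (rho - Cmod (z - z0)%C)).
    * apply Rmin_glb_lt; [apply Cmod_sub_pos; trivial|lra].
    * intros w Hw.
      assert (Hw1 := Rlt_le_trans _ _ _ Hw (Rmin_l _ _)); assert (Hw2 := Rlt_le_trans _ _ _ Hw (Rmin_r _ _)).
      rewrite Hg by (generalize (Cmod_triangle3 w z z0); lra).
      field; apply Cpow_nz; intros E; apply Cmod_gt_0 with (x := (w - z0)%C); trivial.
      generalize (Cmod_sub_ge (z - z0)%C (w - z0)%C).
      replace (z - z0 - (w - z0))%C with (z - w)%C by ring; rewrite (Cmod_minus_sym z w), E, Cmod_0; lra.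
    * apply Choloat_div.
      -- apply Choloat_minus; [apply Hf; lra|apply Choloat_const].
      -- apply Choloat_pow, Choloat_minus; [apply Choloat_id|apply Choloat_const].
      -- apply Cpow_nz, Cmod_gt_0, Cmod_sub_pos; trivial.
- left; exists rho; split; [lra|]; intros z Hzr.
  rewrite (Hz z), (H0 _ Hzr), (H1 O _ Hzr), Hf0.
  assert (Hn : forall n, r 1%nat (z - z0)%C = ((z - z0) ^ n * r (S n) (z - z0)%C)%C).
  { intros n; induction n as [|n IH]; [simpl; ring|].
    rewrite IH, (H1 (S n) _ Hzr).
    replace (r (S n) (RtoC 0)) with (RtoC 0); [rewrite Cpow_S; ring|].
    symmetry; apply NNPP; intros E; apply Hnex; eauto. }
  replace (r 1%nat (z - z0)%C) with (RtoC 0); [ring|symmetry].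
  apply Cmod_eq_0.
  destruct (Rle_lt_or_eq_dec 0 (Cmod (r 1%nat (z - z0)%C)) (Cmod_ge_0 _)) as [HH|HH]; [exfalso|auto].
  destruct (pow_half_small (L * / (2 * rho)) _ HH) as [N HN].
  specialize (HN N (le_n N)); revert HN; apply Rle_not_lt.
  rewrite (Hn N), Cmod_mult, Cmod_pow.
  apply Rle_trans with (rho ^ N * (L * (/ (2 * rho)) ^ S N)).
  + apply Rmult_le_compat; [apply pow_le, Cmod_ge_0|apply Cmod_ge_0| |auto].
    apply pow_incr; split; [apply Cmod_ge_0|lra].
  + replace ((/ (2 * rho)) ^ S N) with (/ (2 * rho) * ((/ 2) ^ N * / rho ^ N)).
    * assert (rho ^ N <> 0) by (apply pow_nonzero; lra).
      generalize ((/ 2) ^ N); intros h; right; field; split; trivial; lra.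
    * rewrite <- pow_inv, <- Rpow_mult_distr, <- Rinv_mult; reflexivity.
Qed.

(** Newton's iteration with the slope frozen at [l]: strict differentiability with constant
    [|l| / 2] makes consecutive steps shrink by one half. The same estimate bounds [f z1 - f z2]
    from below, whence injectivity and the differentiability of the inverse. *)
Lemma inverse_function (f : C -> C) z0 D0 l : 0 < D0 -> holo_disc f z0 D0 -> Cderiv f z0 l -> l <> 0 ->
  exists d e k, 0 < d /\ 0 < e <= D0 /\ k (f z0) = z0 /\
    (forall y, Cmod (y - f z0)%C < d -> Cmod (k y - z0)%C < e /\ f (k y) = y /\ Choloat k y) /\
    (forall z1 z2, Cmod (z1 - z0)%C < e -> Cmod (z2 - z0)%C < e ->
       Cmod l / 2 * Cmod (z1 - z2)%C <= Cmod (f z1 - f z2)%C).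
Proof.
intros HD Hf Hl Hl0.
destruct (holo_strict f z0 D0 HD Hf) as [l' [Hl' HS]].
assert (E := Cderiv_unique _ _ _ _ Hl' Hl); subst l'.
assert (Hm : 0 < Cmod l) by (apply Cmod_gt_0; trivial).
set (m := Cmod l) in *.
destruct (HS (m / 2)) as [e [He Hs]]; [lra|]; clear HS Hl'.
assert (Hlow : forall z1 z2, Cmod (z1 - z0)%C < e -> Cmod (z2 - z0)%C < e ->
       m / 2 * Cmod (z1 - z2)%C <= Cmod (f z1 - f z2)%C).
{ intros z1 z2 H1 H2; specialize (Hs z1 z2 H1 H2).
  assert (A := Cmod_sub_ge ((z1 - z2) * l)%C (f z1 - f z2)%C).
  rewrite (Cmod_minus_sym ((z1 - z2) * l)) in A; rewrite Cmod_mult in A; fold m in A; lra. }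
(* The first step has length [K = |y - f z0| / m] and the limit is within [4 * K] of [z0]; the
   factor 5 keeps it strictly inside the disc of radius [e]. *)
assert (Hex : forall y, Cmod (y - f z0)%C < m * e / 5 -> exists z, Cmod (z - z0)%C < e /\ f z = y).
{ intros y Hy; set (K := Cmod (y - f z0)%C / m).
  assert (HK0 : 0 <= K) by (apply Rmult_le_pos; [apply Cmod_ge_0|apply Rlt_le, Rinv_0_lt_compat; trivial]).
  assert (HK : 5 * K < e).
  { apply Rmult_lt_reg_r with m; trivial.
    replace (5 * K * m) with (5 * Cmod (y - f z0)%C) by (unfold K; field; lra); lra. }
  set (u := fix u n := match n with O => z0 | S n => (u n + (y - f (u n)) / l)%C end).
  assert (Hp : forall n, 0 < (/ 2) ^ n) by (intros n; apply pow_lt; lra).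
  assert (Hstep : forall n, (u (S n) - u n)%C = ((y - f (u n)) / l)%C) by (intros n; simpl; ring).
  assert (Hind : forall n, Cmod (u n - z0)%C <= 2 * K * (1 - (/ 2) ^ n) /\ Cmod (u (S n) - u n)%C <= K * (/ 2) ^ n).
  { intros n; induction n as [|n [IH1 IH2]].
    - split; [simpl; rewrite Cmod_self; lra|].
      rewrite Hstep, Cmod_div by trivial; simpl; fold m K; unfold K, Rdiv; lra.
    - assert (B1 : Cmod (u (S n) - z0)%C <= 2 * K * (1 - (/ 2) ^ S n)).
      { generalize (Cmod_triangle3 (u (S n)) (u n) z0); simpl pow; lra. }
      split; trivial.
      assert (B2 : Cmod (u (S n) - z0)%C < e) by (specialize (Hp (S n)); nra).
      assert (B3 : Cmod (u n - z0)%C < e) by (specialize (Hp n); nra).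
      specialize (Hs _ _ B2 B3).
      replace (u (S (S n)) - u (S n))%C with (- ((f (u (S n)) - f (u n) - (u (S n) - u n) * l) / l))%C.
      + rewrite Cmod_opp, Cmod_div by trivial; fold m.
        apply Rle_div_l; trivial; eapply Rle_trans; [exact Hs|]; simpl pow; nra.
      + rewrite (Hstep (S n)), (Hstep n); field; trivial. }
  destruct (geom_cauchy u K (fun n => proj2 (Hind n))) as [z Hz].
  assert (Hzz : Cmod (z - z0)%C < e).
  { specialize (Hz O); simpl in Hz; rewrite Cmod_minus_sym in Hz; lra. }
  exists z; split; trivial.
  apply NNPP; intros Hne; apply Cmod_sub_pos in Hne.
  destruct (pow_half_small (8 * m * K) _ Hne) as [N HN].
  specialize (HN N (le_n N)); specialize (Hz N); destruct (Hind N) as [I1 I2].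
  rewrite Hstep, Cmod_div in I2 by trivial; fold m in I2.
  apply (proj1 (Rle_div_l _ _ _ Hm)) in I2.
  assert (B3 : Cmod (u N - z0)%C < e) by (specialize (Hp N); nra).
  specialize (Hs _ _ B3 Hzz).
  assert (T1 := Cmod_triangle3 (f z) (f (u N)) y).
  rewrite (Cmod_minus_sym (f (u N)) y) in T1.
  assert (T2 : Cmod (f z - f (u N))%C <= 3 / 2 * m * Cmod (u N - z)%C).
  { rewrite Cmod_minus_sym.
    replace (f (u N) - f z)%C with ((f (u N) - f z - (u N - z) * l) + (u N - z) * l)%C by ring.
    eapply Rle_trans; [apply Cmod_triangle|]; rewrite Cmod_mult; fold m; lra. }
  specialize (Hp N).
  assert (3 / 2 * m * Cmod (u N - z)%C <= 3 / 2 * m * (4 * K * (/ 2) ^ N)) by (apply Rmult_le_compat_l; lra).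
  assert (0 <= m * K * (/ 2) ^ N) by (apply Rmult_le_pos; [apply Rmult_le_pos|]; lra).
  lra. }
(* A global function is chosen; its values are meaningful only for [y] near [f z0]. *)
set (k := fun y => epsilon (inhabits z0) (fun z => Cmod (z - z0)%C < e /\ f z = y)).
assert (Hk : forall y, Cmod (y - f z0)%C < m * e / 5 -> Cmod (k y - z0)%C < e /\ f (k y) = y).
{ intros y Hy; apply (epsilon_spec (inhabits z0) (fun z => Cmod (z - z0)%C < e /\ f z = y)); auto. }
assert (Hinj : forall z1 z2, Cmod (z1 - z0)%C < e -> Cmod (z2 - z0)%C < e -> f z1 = f z2 -> z1 = z2).
{ intros z1 z2 H1 H2 E; apply Cmod_sub_0; generalize (Hlow z1 z2 H1 H2) (Cmod_ge_0 (z1 - z2)%C).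
  rewrite E, Cmod_self; nra. }
assert (Hd : 0 < m * e / 5) by nra.
exists (m * e / 5), e, k; split; [trivial|]; split; [trivial|]; split.
{ destruct (Hk (f z0)) as [K1 K2]; [rewrite Cmod_self; trivial|].
  apply Hinj; trivial; rewrite Cmod_self; lra. }
split; [|exact Hlow].
intros y Hy; destruct (Hk y Hy) as [K1 K2]; split; [trivial|]; split; [trivial|].
set (x := k y) in *.
destruct (Hf x) as [a Ha]; [lra|].
assert (Ha' := Ha); rewrite Cderiv_eps in Ha'.
(* A zero derivative at [x] would contradict the lower bound on difference quotients. *)
assert (Ha0 : (a : C) <> RtoC 0).
{ intros ->; destruct (Ha' (m / 4)) as [d [Hd1 H]]; [lra|].
  set (t := Rmin d (e - Cmod (x - z0)%C) / 2).
  assert (Ht : 0 < t /\ t < d /\ t < e - Cmod (x - z0)%C).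
  { assert (0 < Rmin d (e - Cmod (x - z0)%C)) by (apply Rmin_glb_lt; lra).
    unfold t; generalize (Rmin_l d (e - Cmod (x - z0)%C)) (Rmin_r d (e - Cmod (x - z0)%C)); lra. }
  assert (Et : Cmod (x + RtoC t - x)%C = t).
  { replace (x + RtoC t - x)%C with (RtoC t) by ring; rewrite Cmod_R, Rabs_pos_eq; lra. }
  specialize (H (x + RtoC t)%C); rewrite Et in H; specialize (H (proj1 (proj2 Ht))).
  assert (A := Hlow (x + RtoC t)%C x).
  rewrite Et in A.
  replace (f (x + RtoC t) - f x - (x + RtoC t - x) * RtoC 0)%C with (f (x + RtoC t) - f x)%C in H by ring.
  assert (Cmod (x + RtoC t - z0)%C < e) by (generalize (Cmod_triangle3 (x + RtoC t)%C x z0); rewrite Et; lra).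
  specialize (A H0 K1); nra. }
exists (/ a)%C; apply Cderiv_eps; intros eps Heps.
assert (Hma : 0 < Cmod a) by (apply Cmod_gt_0; trivial).
destruct (Ha' (eps * Cmod a * m / 2)) as [d [Hd1 H]]; [repeat apply Rmult_lt_0_compat; lra|].
exists (Rmin (m * e / 5 - Cmod (y - f z0)%C) (d * m / 2)); split.
{ apply Rmin_glb_lt; [lra|nra]. }
intros y' Hy'.
assert (Y1 := Rlt_le_trans _ _ _ Hy' (Rmin_l _ _)); assert (Y2 := Rlt_le_trans _ _ _ Hy' (Rmin_r _ _)).
destruct (Hk y') as [K1' K2']; [generalize (Cmod_triangle3 y' y (f z0)); lra|].
fold x; set (x' := k y') in *.
assert (A := Hlow x' x K1' K1); rewrite K2, K2' in A.
assert (Hx' : Cmod (x' - x)%C < d) by nra.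
specialize (H x' Hx').
replace (x' - x - (y' - y) * / a)%C with (- ((f x' - f x - (x' - x) * a) / a))%C
  by (rewrite K2, K2'; field; trivial).
rewrite Cmod_opp, Cmod_div by trivial.
apply Rle_div_l; trivial.
eapply Rle_trans; [exact H|].
assert (0 < eps * Cmod a) by (apply Rmult_lt_0_compat; trivial).
nra.
Qed.

(** * The complex exponential, local logarithms and roots of unity *)

Lemma Cexp_cis (u : C) : Cexp u = (RtoC (exp (Re u)) * cis (Im u))%C.
Proof. unfold Cexp, cis, Cmult, RtoC; simpl; f_equal; ring. Qed.

Lemma Cexp_plus (u v : C) : Cexp (u + v)%C = (Cexp u * Cexp v)%C.
Proof.
rewrite !Cexp_cis; change (Re (u + v)%C) with (Re u + Re v); change (Im (u + v)%C) with (Im u + Im v).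
rewrite exp_plus, cis_plus, RtoC_mult; ring.
Qed.

Lemma Cexp_0 : Cexp 0 = 1.
Proof. unfold Cexp; simpl; rewrite exp_0, cos_0, sin_0; unfold RtoC; f_equal; ring. Qed.

Lemma Cmod_Cexp u : Cmod (Cexp u) = exp (Re u).
Proof.
rewrite Cexp_cis, Cmod_mult, Cmod_cis, Cmod_R, Rabs_pos_eq; [ring|apply Rlt_le, exp_pos].
Qed.

Lemma Cexp_neq_0 u : Cexp u <> 0.
Proof. apply Cmod_gt_0; rewrite Cmod_Cexp; apply exp_pos. Qed.

Lemma Cexp_opp u : Cexp (- u)%C = (/ Cexp u)%C.
Proof.
assert (E : (Cexp (- u) * Cexp u)%C = 1).
{ rewrite <- Cexp_plus; replace (- u + u)%C with (RtoC 0) by ring; apply Cexp_0. }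
replace (Cexp (- u)%C) with (Cexp (- u) * Cexp u * / Cexp u)%C by (field; apply Cexp_neq_0).
rewrite E; ring.
Qed.

Lemma Cexp_pow u n : (Cexp u ^ n)%C = Cexp (RtoC (INR n) * u)%C.
Proof.
induction n as [|n IH].
- simpl; replace (RtoC 0 * u)%C with (RtoC 0) by ring; rewrite Cexp_0; reflexivity.
- rewrite Cpow_S, IH, <- Cexp_plus; f_equal; rewrite S_INR, RtoC_plus; ring.
Qed.

Lemma Cexp_deriv_0 : Cderiv Cexp 0 1.
Proof.
apply Cderiv_eps; intros e He.
destruct (is_derive_eps exp 0 (exp 0) (is_derive_exp 0) (Rmin 1 (e / 3))) as [d1 [Hd1 H1]].
{ apply Rmin_glb_lt; lra. }
assert (Hc := RCderiv_cis 0); rewrite cis_0 in Hc; rewrite RCderiv_eps in Hc.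
destruct (Hc (e / 3)) as [d2 [Hd2 H2]]; [lra|].
assert (Hcc := proj1 (continuous_RC _ _) (RCderiv_cont _ _ _ (RCderiv_cis 0))).
destruct (Hcc (e / 6)) as [d3 [Hd3 H3]]; [lra|].
exists (Rmin d1 (Rmin d2 d3)); split; [repeat apply Rmin_glb_lt; trivial|].
intros h Hh; replace (h - 0)%C with h in * by ring.
set (x := Re h); set (y := Im h).
assert (Hx := re_le_Cmod h); assert (Hy := im_le_Cmod h); fold x y in Hx, Hy.
assert (M1 := Rlt_le_trans _ _ _ Hh (Rmin_l _ _)).
assert (M2 := Rlt_le_trans _ _ _ Hh (Rle_trans _ _ _ (Rmin_r _ _) (Rmin_l _ _))).
assert (M3 := Rlt_le_trans _ _ _ Hh (Rle_trans _ _ _ (Rmin_r _ _) (Rmin_r _ _))).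
specialize (H1 x); specialize (H2 y); specialize (H3 y).
rewrite Rminus_0_r in H1, H2, H3; rewrite exp_0 in H1; rewrite cis_0 in H2, H3.
rewrite Cexp_0, Cexp_cis; fold x y.
replace (RtoC (exp x) * cis y - 1 - h * 1)%C with
  (RtoC (exp x - 1) * (cis y - 1) + (RtoC (exp x - 1 - x * 1) + (cis y - 1 - RtoC y * (Ci * 1))))%C.
2:{ unfold x, y; destruct h as [a b]; unfold cis, Ci, Cminus, Cplus, Copp, Cmult, RtoC, Re, Im; simpl; f_equal; ring. }
eapply Rle_trans; [apply Cmod_triangle|].
rewrite Cmod_mult, Cmod_R.
assert (B1 : Rabs (exp x - 1 - x * 1) <= e / 3 * Cmod h).
{ eapply Rle_trans; [apply H1; lra|]; apply Rmult_le_compat; try apply Rabs_pos; trivial.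
  - apply Rmin_glb; lra.
  - apply Rmin_r. }
assert (B2 : Rabs (exp x - 1) <= 2 * Cmod h).
{ replace (exp x - 1) with ((exp x - 1 - x * 1) + x) by ring.
  eapply Rle_trans; [apply Rabs_triang|].
  assert (Rabs (exp x - 1 - x * 1) <= 1 * Rabs x); [|lra].
  eapply Rle_trans; [apply H1; lra|]; apply Rmult_le_compat_r; [apply Rabs_pos|apply Rmin_l]. }
assert (B3 : Cmod (cis y - 1)%C < e / 6) by (apply H3; lra).
assert (B4 : Cmod (cis y - 1 - RtoC y * (Ci * 1))%C <= e / 3 * Cmod h).
{ eapply Rle_trans; [apply H2; lra|]; apply Rmult_le_compat_l; lra. }
assert (B5 : Cmod (RtoC (exp x - 1 - x * 1) + (cis y - 1 - RtoC y * (Ci * 1)))%C <= e / 3 * Cmod h + e / 3 * Cmod h).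
{ eapply Rle_trans; [apply Cmod_triangle|]; rewrite Cmod_R; lra. }
generalize (Rabs_pos (exp x - 1)) (Cmod_ge_0 (cis y - 1)%C) (Cmod_ge_0 h); intros.
assert (Rabs (exp x - 1) * Cmod (cis y - 1)%C <= 2 * Cmod h * (e / 6)) by (apply Rmult_le_compat; lra).
lra.
Qed.

Lemma Cexp_deriv z : Cderiv Cexp z (Cexp z).
Proof.
apply Cderiv_ext with (f := fun w => (Cexp z * Cexp (w - z))%C).
{ intros w; rewrite <- Cexp_plus; f_equal; ring. }
eapply Cderiv_val.
- apply Cderiv_mult; [apply Cderiv_const|].
  apply (Cderiv_comp Cexp (fun w => w - z)%C z 1).
  + replace (z - z)%C with (RtoC 0) by ring; apply Cexp_deriv_0.
  + apply Cderiv_minus; [apply Cderiv_id|apply Cderiv_const].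
- cbv beta; ring.
Qed.

Lemma Choloat_Cexp (f : C -> C) z : Choloat f z -> Choloat (fun w => Cexp (f w)) z.
Proof. intros H; apply Choloat_comp with (2 := H); eexists; apply Cexp_deriv. Qed.

(** A branch near 1 is all that is used: logarithms and roots of a function [f] near [z0] are taken
    of the quotient [f z / f z0]. *)
Lemma local_log : exists d lg, 0 < d /\ lg (RtoC 1) = RtoC 0 /\
  forall w, Cmod (w - 1)%C < d -> Cexp (lg w) = w /\ Choloat lg w.
Proof.
destruct (inverse_function Cexp 0 1 1) as [d [e [k [Hd [He [Hk0 [Hk _]]]]]]].
- lra.
- intros z _; eexists; apply Cexp_deriv.
- apply Cexp_deriv_0.
- apply RtoC_neq_0; lra.
- exists d, k; rewrite Cexp_0 in *; split; [trivial|]; split; [trivial|].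
  intros w Hw; destruct (Hk w Hw) as [_ HH]; exact HH.
Qed.

Lemma Cexp_surj (w : C) : w <> 0 -> exists u, Cexp u = w.
Proof.
intros Hw; assert (Hm : 0 < Cmod w) by (apply Cmod_gt_0; trivial).
set (x := Re w / Cmod w); set (y := Im w / Cmod w).
assert (Hxy : x * x + y * y = 1).
{ assert (E := Cmod2_alt w); unfold x, y.
  replace (Re w / Cmod w * (Re w / Cmod w) + Im w / Cmod w * (Im w / Cmod w))
    with ((Re w ^ 2 + Im w ^ 2) / Cmod w ^ 2) by (field; lra).
  rewrite <- E; field; lra. }
assert (Hx : -1 <= x <= 1) by nra.
assert (Hphi : exists phi, cos phi = x /\ sin phi = y).
{ assert (Hs : sqrt (1 - x²) = Rabs y).
  { rewrite <- sqrt_Rsqr_abs; f_equal; unfold Rsqr; lra. }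
  destruct (Rle_dec 0 y) as [H|H].
  - exists (acos x); rewrite cos_acos, sin_acos, Hs, Rabs_pos_eq; auto.
  - exists (- acos x); rewrite cos_neg, sin_neg, cos_acos, sin_acos, Hs, Rabs_left by lra; split; ring. }
destruct Hphi as [phi [Hc Hs]].
exists (ln (Cmod w), phi); unfold Cexp; simpl; rewrite exp_ln, Hc, Hs by trivial.
unfold x, y; transitivity (Re w, Im w); [|destruct w; reflexivity].
f_equal; field; lra.
Qed.

Lemma Cexp_eq_1 (u : C) : Cexp u = 1 -> exists n : Z, u = (RtoC (IZR n) * two_pi_i)%C.
Proof.
intros H; assert (Hm := Cmod_Cexp u); rewrite H, Cmod_1 in Hm.
assert (Hx : Re u = 0) by (apply exp_inv; rewrite exp_0; auto).
rewrite Cexp_cis, Hx, exp_0 in H.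
assert (Hc : cos (Im u) = 1).
{ apply (f_equal Re) in H; unfold Cmult, cis, RtoC, Re in H; simpl in H; lra. }
assert (Hs : sin (Im u / 2) = 0).
{ assert (E := cos_2a_sin (Im u / 2)); replace (2 * (Im u / 2)) with (Im u) in E by field; nra. }
destruct (sin_eq_0_0 _ Hs) as [n Hn].
exists n; destruct u as [a b]; unfold Re, Im in *; simpl in *.
unfold two_pi_i, Cmult, RtoC; simpl; f_equal; [lra|].
replace b with (2 * (b / 2)) by field; rewrite Hn; ring.
Qed.

Lemma Cexp_2PI_Z (n : Z) : Cexp (RtoC (IZR n) * two_pi_i)%C = 1.
Proof.
assert (G : forall k, Cexp (RtoC (INR k) * two_pi_i)%C = 1).
{ intros k; rewrite Cexp_cis.
  replace (Re (RtoC (INR k) * two_pi_i)%C) with 0 by (unfold Re, two_pi_i, Cmult, RtoC; simpl; ring).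
  replace (Im (RtoC (INR k) * two_pi_i)%C) with (INR k * (2 * PI)) by (unfold Im, two_pi_i, Cmult, RtoC; simpl; ring).
  rewrite exp_0, cis_2PI_n; ring. }
destruct (Z_le_dec 0 n) as [H|H].
- rewrite <- (Z2Nat.id n) by trivial; rewrite <- INR_IZR_INZ; apply G.
- replace (RtoC (IZR n) * two_pi_i)%C with (- (RtoC (INR (Z.to_nat (- n))) * two_pi_i))%C.
  + rewrite Cexp_opp, G; field; apply RtoC_neq_0; lra.
  + rewrite INR_IZR_INZ, Z2Nat.id by lia; rewrite opp_IZR, RtoC_opp; ring.
Qed.

Lemma Cexp_eq (u v : C) : Cexp u = Cexp v -> Cexp (u - v)%C = 1.
Proof.
intros H; unfold Cminus; rewrite Cexp_plus, Cexp_opp, H; field; apply Cexp_neq_0.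
Qed.

Lemma root_of_unity (x : C) n : (0 < n)%nat -> (x ^ n)%C = 1 ->
  exists k : Z, x = Cexp (RtoC (IZR k / INR n) * two_pi_i)%C.
Proof.
intros Hn Hx.
assert (Hx0 : x <> 0).
{ intros ->; destruct n; [lia|]; rewrite Cpow_S in Hx; replace (0 * 0 ^ n)%C with (RtoC 0) in Hx by ring.
  apply RtoC_inj in Hx; lra. }
destruct (Cexp_surj x Hx0) as [u Hu]; rewrite <- Hu, Cexp_pow in Hx.
destruct (Cexp_eq_1 _ Hx) as [k Hk]; exists k; rewrite <- Hu; f_equal.
assert (Hn' : INR n <> 0) by (apply not_0_INR; lia).
assert (Hn0 : RtoC (INR n) <> 0) by (apply RtoC_neq_0; trivial).
rewrite RtoC_div by trivial.
replace u with ((RtoC (INR n) * u) / RtoC (INR n))%C by (field; trivial).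
rewrite Hk; field; trivial.
Qed.

Lemma nth_root (w : C) n : (0 < n)%nat -> w <> 0 -> exists x, (x ^ n)%C = w.
Proof.
intros Hn Hw; destruct (Cexp_surj w Hw) as [u Hu].
assert (Hn0 : RtoC (INR n) <> 0) by (apply RtoC_neq_0, not_0_INR; lia).
exists (Cexp (u / RtoC (INR n))%C); rewrite Cexp_pow, <- Hu; f_equal; field; trivial.
Qed.

(** * Local holomorphic sections *)

Definition D2 (f : C * C -> C) (x : C * C) : Prop :=
  @ex_filterdiff C_AbsRing C2 C_NormedModule f (locally (x : C2)).

Lemma D2_abs f x : D2 f x <-> @ex_filterdiff C_AbsRing C2 (AbsRing_NormedModule C_AbsRing) f (locally (x : C2)).
Proof.
split; intros [l [[H1 H2 H3] H4]]; exists l; (split; [split; [exact H1|exact H2|exact H3]|exact H4]).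
Qed.

Lemma D2_fst x : D2 fst x.
Proof. apply ex_filterdiff_linear, is_linear_fst. Qed.

Lemma D2_snd x : D2 snd x.
Proof. apply ex_filterdiff_linear, is_linear_snd. Qed.

Lemma D2_const c x : D2 (fun _ => c) x.
Proof. apply ex_filterdiff_const. Qed.

Lemma D2_plus f g x : D2 f x -> D2 g x -> D2 (fun y => f y + g y)%C x.
Proof. intros Hf Hg; exact (@ex_filterdiff_plus_fct C_AbsRing C2 C_NormedModule _ _ f g Hf Hg). Qed.

Lemma D2_minus f g x : D2 f x -> D2 g x -> D2 (fun y => f y - g y)%C x.
Proof. intros Hf Hg; exact (@ex_filterdiff_minus_fct C_AbsRing C2 C_NormedModule _ _ f g Hf Hg). Qed.

Lemma D2_mult f g x : D2 f x -> D2 g x -> D2 (fun y => f y * g y)%C x.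
Proof.
rewrite !D2_abs; intros Hf Hg.
exact (@ex_filterdiff_mult_fct C_AbsRing C2 f g x Cmult_comm Hf Hg).
Qed.

Lemma D2_comp (g : C -> C) f x : Choloat g (f x) -> D2 f x -> D2 (fun y => g (f y)) x.
Proof.
intros [l Hl] Hf; apply (ex_filterdiff_comp' (V := C_NormedModule) f g); trivial.
exists (fun y => scal y l); split.
- destruct Hl as [[H1 H2 H3] _]; split; [exact H1|exact H2|exact H3].
- intros z Hz e.
  apply (@is_filter_lim_locally_unique C_AbsRing C_NormedModule) in Hz; subst z.
  destruct (proj1 (Cderiv_eps _ _ _) Hl e (cond_pos e)) as [d [Hd H]].
  apply locally_Cmod; exists d; split; trivial; intros w Hw; exact (H w Hw).
Qed.

Lemma holo2_pair f g x : D2 f x -> D2 g x -> holo2_at (fun y => (f y, g y)) x.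
Proof.
intros Hf Hg.
apply (ex_filterdiff_comp'_2 (T := C2) (U := C_NormedModule) (V := C_NormedModule) (W := C2) f g (fun a b => (a, b))); trivial.
apply (ex_filterdiff_ext (U := C2) (V := C2) (fun y => y)); [intros [a b]; reflexivity|].
apply ex_filterdiff_id.
Qed.

Lemma form_D2 k f x : Choloat f (fst x) -> D2 (form k f) x.
Proof.
intros H; apply D2_mult.
- apply (D2_comp f fst); trivial; apply D2_fst.
- apply (D2_comp Cexp (fun y => RtoC k * snd y)%C); [eexists; apply Cexp_deriv|].
  apply D2_mult; [apply D2_const|apply D2_snd].
Qed.

(** Two equations in [(z, u)] are reduced to one in [z]: the first is solved for [u] by a logarithm
    of [f1], and substitution in the second leaves [h z = snd y * phi (fst y)] with
    [h = f2 * (f1 / f1 z0) ^ (- k2 / k1)]. The derivative of [h] at [z0] is the weighted Wronskian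
    divided by [k1 * f1 z0], so [h] is locally invertible. *)
Lemma local_section (f1 f2 : C -> C) (z0 u0 : C) (D0 k1 k2 : R) (a1 a2 : C) :
  0 < D0 -> holo_disc f1 z0 D0 -> holo_disc f2 z0 D0 -> Cderiv f1 z0 a1 -> Cderiv f2 z0 a2 ->
  f1 z0 <> 0 -> k1 <> 0 -> (RtoC k1 * a2 * f1 z0 - RtoC k2 * f2 z0 * a1)%C <> 0 ->
  exists (eps : posreal) s, forall y,
    Cmod (form k1 f1 (z0, u0) - fst y)%C < eps -> Cmod (form k2 f2 (z0, u0) - snd y)%C < eps ->
    Cmod (fst (s y) - z0)%C < D0 /\ form k1 f1 (s y) = fst y /\ form k2 f2 (s y) = snd y /\ holo2_at s y.
Proof.
intros HD H1 H2 Ha1 Ha2 Hf1 Hk1 HW.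
destruct local_log as [dl [lg [Hdl [Hlg0 Hlg]]]].
assert (Hlg1 : Cderiv lg 1 1).
{ destruct (Hlg (RtoC 1)) as [_ [m Hm]]; [rewrite Cmod_self; trivial|].
  eapply Cderiv_val; [exact Hm|].
  assert (E := Cderiv_comp _ _ _ _ _ (Cexp_deriv (lg (RtoC 1))) Hm); rewrite Hlg0, Cexp_0 in E.
  apply (Cderiv_ext_loc _ (fun w => w) _ _ dl Hdl) in E; [|intros w Hw; apply Hlg; trivial].
  assert (E2 := Cderiv_unique _ _ _ _ E (Cderiv_id _)).
  transitivity (m * 1)%C; [symmetry; apply Cmult_1_r|exact E2]. }
assert (Hkc : RtoC k1 <> 0) by (apply RtoC_neq_0; trivial).
set (c := (RtoC k2 / RtoC k1)%C).
assert (Hz0 : Cmod (z0 - z0)%C < D0) by (rewrite Cmod_self; trivial).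
assert (Hrho : exists rho, 0 < rho <= D0 /\ forall z, Cmod (z - z0)%C < rho -> Cmod (f1 z / f1 z0 - 1)%C < dl).
{ assert (Hc : continuous (fun z => f1 z / f1 z0)%C z0).
  { apply Choloat_cont, Choloat_div; [apply H1; trivial|apply Choloat_const|trivial]. }
  rewrite continuous_C in Hc; destruct (Hc dl Hdl) as [d [Hd H]].
  exists (Rmin d D0); split; [split; [apply Rmin_glb_lt; trivial|apply Rmin_r]|].
  intros z Hz; specialize (H z (Rlt_le_trans _ _ _ Hz (Rmin_l _ _))).
  replace (f1 z0 / f1 z0)%C with (RtoC 1) in H by (field; trivial); exact H. }
destruct Hrho as [rho [Hrho Hr1]].
set (h := fun z => (f2 z * Cexp (- c * lg (f1 z / f1 z0)%C))%C).
assert (Hq : forall z, Cmod (z - z0)%C < rho -> Choloat (fun z => lg (f1 z / f1 z0)%C) z).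
{ intros z Hz; apply (Choloat_comp lg (fun z => f1 z / f1 z0)%C).
  - apply Hlg; auto.
  - apply Choloat_div; [apply H1; lra|apply Choloat_const|trivial]. }
assert (Hh : holo_disc h z0 rho).
{ intros z Hz; apply Choloat_mult; [apply H2; lra|].
  apply (Choloat_Cexp (fun z => - c * lg (f1 z / f1 z0)%C)%C).
  apply Choloat_mult; [apply Choloat_const|auto]. }
assert (E1 : (f1 z0 / f1 z0)%C = 1) by (field; trivial).
assert (Hh' : Cderiv h z0 ((RtoC k1 * a2 * f1 z0 - RtoC k2 * f2 z0 * a1) / (RtoC k1 * f1 z0))%C).
{ eapply Cderiv_val.
  - apply Cderiv_mult; [exact Ha2|].
    apply (Cderiv_comp Cexp (fun z => - c * lg (f1 z / f1 z0)%C)%C); [apply Cexp_deriv|].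
    apply Cderiv_mult; [apply Cderiv_const|].
    apply (Cderiv_comp lg (fun z => f1 z / f1 z0)%C); [rewrite E1; exact Hlg1|].
    apply Cderiv_div; [exact Ha1|apply Cderiv_const|trivial].
  - cbv beta; rewrite E1, Hlg0.
    replace (- c * RtoC 0)%C with (RtoC 0) by ring; rewrite Cexp_0; unfold c; field; auto. }
assert (Hhz : h z0 = f2 z0).
{ unfold h; rewrite E1, Hlg0; replace (- c * RtoC 0)%C with (RtoC 0) by ring; rewrite Cexp_0; ring. }
destruct (inverse_function h z0 rho _ (proj1 Hrho) Hh Hh') as [d [e [K [Hd [He [HK0 [HK _]]]]]]].
{ unfold Cdiv; apply Cmult_neq_0; trivial.
  apply Cinv_neq_0, Cmult_neq_0; trivial. }
rewrite Hhz in HK, HK0.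
set (y1 := (f1 z0 * Cexp (RtoC k1 * u0))%C); set (y2 := (f2 z0 * Cexp (RtoC k2 * u0))%C).
assert (Hy1 : y1 <> 0) by (apply Cmult_neq_0; [trivial|apply Cexp_neq_0]).
(* The factor that elimination of [u] puts next to the second coordinate; [snd y * phi (fst y)]
   equals [h z0] at the base point. *)
set (phi := fun t => Cexp (- (RtoC k2 * u0) - c * lg (t / y1)%C)%C).
set (A := fun y : C * C => (snd y * phi (fst y))%C).
assert (Ey : (y1 / y1)%C = 1) by (field; trivial).
assert (Hphi0 : (y2 * phi y1)%C = f2 z0).
{ unfold phi, y2; rewrite Ey, Hlg0.
  replace (- (RtoC k2 * u0) - c * RtoC 0)%C with (- (RtoC k2 * u0))%C by ring.
  rewrite Cexp_opp; field; apply Cexp_neq_0. }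
assert (Hlgy : forall t, Cmod (t / y1 - 1)%C < dl -> Choloat (fun t => lg (t / y1)%C) t).
{ intros t Ht; apply (Choloat_comp lg (fun t => t / y1)%C); [apply Hlg; trivial|].
  apply Choloat_div; [apply Choloat_id|apply Choloat_const|trivial]. }
assert (Hphi : forall t, Cmod (t / y1 - 1)%C < dl -> Choloat phi t).
{ intros t Ht; apply (Choloat_Cexp (fun t => - (RtoC k2 * u0) - c * lg (t / y1)%C)%C).
  apply Choloat_minus; [apply Choloat_const|].
  apply Choloat_mult; [apply Choloat_const|auto]. }
destruct (Cmult_eps y2 (phi y1) d Hd) as [d3 [Hd3 HM]].
assert (Hc : continuous phi y1).
{ apply Choloat_cont, Hphi; rewrite Ey, Cmod_self; trivial. }
rewrite continuous_C in Hc; destruct (Hc d3 Hd3) as [d4 [Hd4 H4]].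
assert (Hm1 : 0 < Cmod y1) by (apply Cmod_gt_0; trivial).
set (eps := Rmin d3 (Rmin d4 (dl * Cmod y1))).
assert (Heps : 0 < eps) by (repeat apply Rmin_glb_lt; trivial; nra).
(* The second component is the logarithmic solution of the first equation at [z = K (A y)]. *)
set (s := fun y : C * C => (K (A y), (u0 + / RtoC k1 * (lg (fst y / y1)%C - lg (f1 (K (A y)) / f1 z0)%C))%C)).
exists (mkposreal eps Heps), s; simpl pos; intros y Hb1 Hb2.
change (form k1 f1 (z0, u0)) with y1 in Hb1; change (form k2 f2 (z0, u0)) with y2 in Hb2.
rewrite Cmod_minus_sym in Hb1, Hb2.
assert (B3 := Rlt_le_trans _ _ _ Hb2 (Rmin_l _ _)).
assert (B4 := Rlt_le_trans _ _ _ Hb1 (Rle_trans _ _ _ (Rmin_r _ _) (Rmin_l _ _))).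
assert (B5 := Rlt_le_trans _ _ _ Hb1 (Rle_trans _ _ _ (Rmin_r _ _) (Rmin_r _ _))).
assert (Hfy : Cmod (fst y / y1 - 1)%C < dl).
{ replace (fst y / y1 - 1)%C with ((fst y - y1) / y1)%C by (field; trivial).
  rewrite Cmod_div by trivial; apply Rlt_div_l; trivial. }
assert (HA : Cmod (A y - f2 z0)%C < d).
{ rewrite <- Hphi0; apply HM; auto. }
destruct (HK (A y) HA) as [K1 [K2 K3]].
assert (Hz : Cmod (f1 (K (A y)) / f1 z0 - 1)%C < dl) by (apply Hr1; lra).
assert (F1 : form k1 f1 (s y) = fst y).
{ unfold form, s; simpl fst; simpl snd.
  replace (RtoC k1 * (u0 + / RtoC k1 * (lg (fst y / y1)%C - lg (f1 (K (A y)) / f1 z0)%C)))%C with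
    (RtoC k1 * u0 + (lg (fst y / y1)%C + - lg (f1 (K (A y)) / f1 z0)%C))%C by (field; trivial).
  rewrite !Cexp_plus, Cexp_opp, (proj1 (Hlg _ Hfy)), (proj1 (Hlg _ Hz)).
  assert (N1 : f1 (K (A y)) <> 0).
  { intros N; rewrite N in Hz; apply (Cexp_neq_0 (lg (0 / f1 z0)%C)).
    rewrite (proj1 (Hlg _ Hz)); field; trivial. }
  unfold y1; field; repeat split; trivial; apply Cexp_neq_0. }
assert (F2 : form k2 f2 (s y) = snd y).
{ unfold form, s; simpl fst; simpl snd.
  replace (RtoC k2 * (u0 + / RtoC k1 * (lg (fst y / y1)%C - lg (f1 (K (A y)) / f1 z0)%C)))%C with
    (- c * lg (f1 (K (A y)) / f1 z0)%C + - (- (RtoC k2 * u0) - c * lg (fst y / y1)%C))%C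
    by (unfold c; field; trivial).
  rewrite Cexp_plus, Cmult_assoc; change (f2 (K (A y)) * Cexp (- c * lg (f1 (K (A y)) / f1 z0)%C))%C with (h (K (A y))).
  rewrite K2, Cexp_opp; unfold A; change (Cexp (- (RtoC k2 * u0) - c * lg (fst y / y1)%C)%C) with (phi (fst y)).
  field; apply Cexp_neq_0. }
split; [simpl; lra|]; split; [trivial|]; split; [trivial|].
assert (DA : D2 A y).
{ apply D2_mult; [apply D2_snd|]; apply (D2_comp phi fst); [auto|apply D2_fst]. }
assert (DK : D2 (fun y => K (A y)) y) by (apply D2_comp; trivial).
apply holo2_pair; trivial.
apply D2_plus; [apply D2_const|]; apply D2_mult; [apply D2_const|]; apply D2_minus.
- apply (D2_comp (fun t => lg (t / y1)%C) fst); [auto|apply D2_fst].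
- apply (D2_comp (fun z => lg (f1 z / f1 z0)%C) (fun y => K (A y))); trivial; apply Hq; lra.
Qed.

(** * The triangle group *)

(** The automorphy factor: a cocycle for the group, and [mob M] has derivative [/ jfac M z ^ 2] when
    the determinant is 1. *)
Definition jfac (M : mat2) (z : C) : C := (RtoC (mc M) * z + RtoC (md M))%C.
Definition mtr (M : mat2) : R := ma M + md M.

Fixpoint mpow (M : mat2) (n : nat) : mat2 :=
  match n with O => mat_id | S n => mat_mul M (mpow M n) end.

Ltac mat_eq := unfold mat_mul, mat_opp, mat_id, mat_det, mtr in *; simpl; f_equal; ring.

Lemma mat_mul_assoc M N P : mat_mul M (mat_mul N P) = mat_mul (mat_mul M N) P.
Proof. mat_eq. Qed.

Lemma mat_mul_id_l M : mat_mul mat_id M = M.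
Proof. destruct M; mat_eq. Qed.

Lemma mat_mul_id_r M : mat_mul M mat_id = M.
Proof. destruct M; mat_eq. Qed.

Lemma mat_opp_opp M : mat_opp (mat_opp M) = M.
Proof. destruct M; mat_eq. Qed.

Lemma mat_mul_opp_l M N : mat_mul (mat_opp M) N = mat_opp (mat_mul M N).
Proof. mat_eq. Qed.

Lemma mat_mul_opp_r M N : mat_mul M (mat_opp N) = mat_opp (mat_mul M N).
Proof. mat_eq. Qed.

Lemma mat_det_mul M N : mat_det (mat_mul M N) = mat_det M * mat_det N.
Proof. unfold mat_det, mat_mul; simpl; ring. Qed.

Lemma mtr_mul_comm M N : mtr (mat_mul M N) = mtr (mat_mul N M).
Proof. unfold mtr, mat_mul; simpl; ring. Qed.

Lemma mpow_add M i j : mpow M (i + j) = mat_mul (mpow M i) (mpow M j).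
Proof.
induction i as [|i IH]; simpl; [rewrite mat_mul_id_l; reflexivity|].
rewrite IH, mat_mul_assoc; reflexivity.
Qed.

Lemma mpow_det M i : mat_det M = 1 -> mat_det (mpow M i) = 1.
Proof.
intros H; induction i as [|i IH]; simpl; [unfold mat_det, mat_id; simpl; ring|].
rewrite mat_det_mul, H, IH; ring.
Qed.

Lemma psl_refl M : psl_eq M M.
Proof. left; reflexivity. Qed.

Lemma psl_sym M N : psl_eq M N -> psl_eq N M.
Proof. intros [->| ->]; [left; reflexivity|right; rewrite mat_opp_opp; reflexivity]. Qed.

Lemma psl_trans M N P : psl_eq M N -> psl_eq N P -> psl_eq M P.
Proof.
intros [->| ->] [->| ->]; rewrite ?mat_opp_opp; [left|right|right|left]; reflexivity.
Qed.

Lemma psl_mul M N M' N' : psl_eq M M' -> psl_eq N N' -> psl_eq (mat_mul M N) (mat_mul M' N').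
Proof.
intros [->| ->] [->| ->]; rewrite ?mat_mul_opp_l, ?mat_mul_opp_r, ?mat_opp_opp; [left|right|right|left]; reflexivity.
Qed.

Lemma psl_mtr2 M N : psl_eq M N -> mtr M * mtr M = mtr N * mtr N.
Proof. intros [->| ->]; unfold mtr, mat_opp; simpl; ring. Qed.

Lemma jfac_opp M z : jfac (mat_opp M) z = (- jfac M z)%C.
Proof. unfold jfac, mat_opp; simpl; rewrite !RtoC_opp; ring. Qed.

Lemma psl_jfac2 M N z : psl_eq M N -> (jfac M z ^ 2)%C = (jfac N z ^ 2)%C.
Proof. intros [->| ->]; rewrite ?jfac_opp; simpl; ring. Qed.

Lemma jfac_neq_0 M z : mat_det M = 1 -> inH z -> jfac M z <> 0.
Proof.
unfold mat_det, inH; intros HM Hz E.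
destruct z as [x y]; simpl in Hz.
assert (E1 := f_equal Im E); assert (E2 := f_equal Re E).
unfold jfac, Re, Im, Cplus, Cmult, RtoC in E1, E2; simpl in E1, E2.
assert (mc M * y = 0) by lra.
assert (mc M = 0) by nra; rewrite H0 in *; nra.
Qed.

Lemma psl_mob M N z : mat_det N = 1 -> inH z -> psl_eq M N -> mob M z = mob N z.
Proof.
intros HN Hz [->| ->]; trivial.
assert (Hj := jfac_neq_0 N z HN Hz).
unfold mob, mat_opp; simpl; unfold jfac in Hj; rewrite !RtoC_opp; field; split; trivial.
intros E; apply Hj; transitivity (- (- RtoC (mc N) * z + - RtoC (md N)))%C; [ring|rewrite E; ring].
Qed.

Lemma Im_mob M z : mat_det M = 1 -> inH z -> Im (mob M z) * (Cmod (jfac M z) ^ 2) = Im z.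
Proof.
intros HM Hz; assert (Hj := jfac_neq_0 M z HM Hz).
assert (E : (mob M z * RtoC (Cmod (jfac M z) ^ 2))%C =
  ((RtoC (ma M) * z + RtoC (mb M)) * Cconj (jfac M z))%C).
{ rewrite Cmod2_conj; unfold mob; fold (jfac M z); field; trivial. }
assert (E1 := f_equal Im E).
transitivity (Im (mob M z * RtoC (Cmod (jfac M z) ^ 2))%C).
- unfold Im, Cmult, RtoC; simpl; ring.
- rewrite E1; unfold jfac, Im, Cconj, Cmult, Cplus, RtoC; simpl.
  unfold mat_det in HM; destruct z as [x y]; simpl.
  transitivity ((ma M * md M - mb M * mc M) * y); [ring|rewrite HM; ring].
Qed.

Lemma inH_mob M z : mat_det M = 1 -> inH z -> inH (mob M z).
Proof.
intros HM Hz; assert (E := Im_mob M z HM Hz); unfold inH in *.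
assert (Hj : 0 < Cmod (jfac M z)) by (apply Cmod_gt_0, jfac_neq_0; trivial).
assert (0 < Cmod (jfac M z) ^ 2) by (apply pow_lt; trivial).
apply Rmult_lt_reg_r with (Cmod (jfac M z) ^ 2); trivial; lra.
Qed.

Lemma jfac_mul M N z : mat_det N = 1 -> inH z ->
  jfac (mat_mul M N) z = (jfac M (mob N z) * jfac N z)%C.
Proof.
intros HN Hz; assert (Hj := jfac_neq_0 N z HN Hz).
unfold jfac at 1 2, mob; fold (jfac N z); unfold mat_mul; simpl.
rewrite !RtoC_plus, !RtoC_mult; field_simplify; trivial; unfold jfac; ring.
Qed.

Lemma mob_mul M N z : mat_det M = 1 -> mat_det N = 1 -> inH z -> mob (mat_mul M N) z = mob M (mob N z).
Proof.
intros HM HN Hz; assert (HjN := jfac_neq_0 N z HN Hz).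
assert (HjM := jfac_neq_0 M _ HM (inH_mob N z HN Hz)).
unfold mob at 1 2; fold (jfac (mat_mul M N) z) (jfac M (mob N z)).
rewrite jfac_mul by trivial.
replace (RtoC (ma (mat_mul M N)) * z + RtoC (mb (mat_mul M N)))%C with
  ((RtoC (ma M) * mob N z + RtoC (mb M)) * jfac N z)%C.
- field; split; trivial.
- unfold mob; fold (jfac N z); unfold mat_mul; simpl; rewrite !RtoC_plus, !RtoC_mult.
  field_simplify; trivial; unfold jfac; ring.
Qed.

Lemma mob_id z : mob mat_id z = z.
Proof. unfold mob, mat_id; simpl; field; apply RtoC_neq_0; lra. Qed.

Lemma mob_deriv M z : mat_det M = 1 -> inH z -> Cderiv (mob M) z (/ (jfac M z ^ 2))%C.
Proof.
intros HM Hz; assert (Hj := jfac_neq_0 M z HM Hz).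
assert (E : (RtoC (ma M) * RtoC (md M) - RtoC (mb M) * RtoC (mc M))%C = 1).
{ rewrite <- !RtoC_mult, <- RtoC_minus; f_equal; exact HM. }
unfold mob; eapply Cderiv_val.
- apply Cderiv_div; [| |exact Hj]; (apply Cderiv_plus; [apply Cderiv_mult; [apply Cderiv_const|apply Cderiv_id]|apply Cderiv_const]).
- cbv beta; fold (jfac M z).
  transitivity ((RtoC (ma M) * RtoC (md M) - RtoC (mb M) * RtoC (mc M)) / (jfac M z * jfac M z))%C.
  + f_equal; unfold jfac; ring.
  + rewrite E; simpl; field; trivial.
Qed.

Definition minv (M : mat2) : mat2 := Mat2 (md M) (- mb M) (- mc M) (ma M).

Lemma minv_det M : mat_det (minv M) = mat_det M.
Proof. unfold minv, mat_det; simpl; ring. Qed.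

Lemma minv_l M : mat_det M = 1 -> mat_mul (minv M) M = mat_id.
Proof.
unfold mat_det; intros H; unfold mat_mul, minv, mat_id; simpl; f_equal; lra.
Qed.

Lemma minv_r M : mat_det M = 1 -> mat_mul M (minv M) = mat_id.
Proof.
unfold mat_det; intros H; unfold mat_mul, minv, mat_id; simpl; f_equal; lra.
Qed.

Lemma mob_minv_l M z : mat_det M = 1 -> inH z -> mob (minv M) (mob M z) = z.
Proof.
intros HM Hz; rewrite <- mob_mul, minv_l, mob_id; trivial; rewrite minv_det; trivial.
Qed.

Lemma mob_minv_r M z : mat_det M = 1 -> inH z -> mob M (mob (minv M) z) = z.
Proof.
intros HM Hz; rewrite <- mob_mul, minv_r, mob_id; trivial; rewrite minv_det; trivial.
Qed.

(* At a fixed point, [jfac] is an eigenvalue; it is real when the trace has modulus at least 2. *)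
Lemma fixed_nonelliptic M z : mat_det M = 1 -> inH z -> mob M z = z -> 4 <= mtr M * mtr M ->
  (jfac M z ^ 2)%C = 1.
Proof.
intros HM Hz Hf Ht; assert (Hj := jfac_neq_0 M z HM Hz).
assert (E : (RtoC (ma M) * z + RtoC (mb M))%C = (z * jfac M z)%C).
{ rewrite <- Hf at 2; unfold mob; fold (jfac M z); field; trivial. }
destruct z as [x y]; unfold inH, mat_det, mtr in *; simpl in Hz.
assert (E1 := f_equal Re E); assert (E2 := f_equal Im E).
unfold jfac, Re, Im, Cplus, Cmult, RtoC in E1, E2; simpl in E1, E2.
assert (E3 : ma M - md M = 2 * mc M * x) by (apply Rmult_eq_reg_r with y; lra).
assert (E4 : mb M = - mc M * (x * x + y * y)) by nra.
assert (E5 : mtr M * mtr M = 4 - 4 * (mc M * y) * (mc M * y)).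
{ unfold mtr; replace (ma M) with (md M + 2 * mc M * x) in * by lra; rewrite E4 in HM; nra. }
unfold mtr in E5; assert (Hcy : mc M * y = 0) by nra.
assert (Hc : mc M = 0) by nra.
unfold jfac, Cmult, Cplus, RtoC; simpl; rewrite Hc in *.
assert (md M * md M = 1) by nra.
apply injective_projections; simpl; [transitivity (md M * md M); [ring|trivial]|ring].
Qed.

(** * Powers of the elliptic generators *)

Definition sr (t x : R) : R := sin (x * t) / sin t.

Lemma sr_rec t x : sin t <> 0 -> sr t (x + 1) = 2 * cos t * sr t x - sr t (x - 1).
Proof.
intros H; unfold sr.
replace ((x + 1) * t) with (x * t + t) by ring; replace ((x - 1) * t) with (x * t - t) by ring.
rewrite sin_plus, sin_minus; field; trivial.
Qed.

Lemma sr_0 t : sr t 0 = 0.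
Proof. unfold sr; rewrite Rmult_0_l, sin_0; unfold Rdiv; ring. Qed.

Lemma sr_1 t : sin t <> 0 -> sr t 1 = 1.
Proof. intros H; unfold sr; rewrite Rmult_1_l; field; trivial. Qed.

Lemma sr_m1 t : sin t <> 0 -> sr t (- 1) = - 1.
Proof. intros H; unfold sr; replace (- 1 * t) with (- t) by ring; rewrite sin_neg; field; trivial. Qed.

Definition MA (t : R) : mat2 := Mat2 (2 * cos t) 1 (-1) 0.
Definition MB (t : R) : mat2 := Mat2 0 1 (-1) (2 * cos t).

(** The entries are values of Chebyshev polynomials of the second kind at [cos t]. The real argument
    of [sr] lets the index [INR k - 1] make sense for [k = 0]. *)
Lemma MA_pow t k : sin t <> 0 ->
  mpow (MA t) k = Mat2 (sr t (INR k + 1)) (sr t (INR k)) (- sr t (INR k)) (- sr t (INR k - 1)).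
Proof.
intros H; induction k as [|k IH].
- simpl; rewrite Rplus_0_l, Rminus_0_l, sr_0, sr_1, sr_m1 by trivial; unfold mat_id; f_equal; ring.
- simpl mpow; rewrite IH, S_INR; unfold mat_mul, MA; simpl.
  replace (INR k + 1 - 1) with (INR k) by ring.
  rewrite (sr_rec t (INR k + 1) H); replace (INR k + 1 - 1) with (INR k) by ring.
  rewrite (sr_rec t (INR k) H); f_equal; ring.
Qed.

Lemma MB_pow t k : sin t <> 0 ->
  mpow (MB t) k = Mat2 (- sr t (INR k - 1)) (sr t (INR k)) (- sr t (INR k)) (sr t (INR k + 1)).
Proof.
intros H; induction k as [|k IH].
- simpl; rewrite Rplus_0_l, Rminus_0_l, sr_0, sr_1, sr_m1 by trivial; unfold mat_id; f_equal; ring.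
- simpl mpow; rewrite IH, S_INR; unfold mat_mul, MB; simpl.
  replace (INR k + 1 - 1) with (INR k) by ring.
  rewrite (sr_rec t (INR k + 1) H); replace (INR k + 1 - 1) with (INR k) by ring.
  rewrite (sr_rec t (INR k) H); f_equal; ring.
Qed.

Section Angle.

Variable n : nat.
Hypothesis Hn : (2 <= n)%nat.
Let t := PI / INR n.

Lemma angle_range : 0 < PI / INR n <= PI / 2 /\ INR n * (PI / INR n) = PI.
Proof.
assert (H2 : 2 <= INR n) by (apply (le_INR 2); trivial).
assert (HPI := PI_RGT_0); split; [split|].
- apply Rdiv_lt_0_compat; lra.
- apply Rmult_le_compat_l; [lra|]; apply Rinv_le_contravar; lra.
- field; lra.
Qed.

Lemma sin_angle : 0 < sin (PI / INR n).
Proof.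
destruct angle_range as [H1 _]; apply sin_gt_0; generalize PI_RGT_0; lra.
Qed.

Lemma sr_n : sr t (INR n) = 0.
Proof. unfold sr, t; rewrite (proj2 angle_range), sin_PI; unfold Rdiv; ring. Qed.

Lemma sr_ge_0 x : 0 <= x <= INR n -> 0 <= sr t x.
Proof.
intros Hx; destruct angle_range as [H1 H2]; fold t in H1, H2.
apply Rmult_le_pos; [apply sin_ge_0; nra|].
apply Rlt_le, Rinv_0_lt_compat, sin_angle.
Qed.

(** On [[t, PI - t]] the sine is at least [sin t], by monotonicity on each half. This is the source
    of the lower bound 1 in the positivity of blocks. *)
Lemma sr_ge_1 x : 1 <= x <= INR n - 1 -> 1 <= sr t x.
Proof.
intros Hx; destruct angle_range as [H1 H2]; fold t in H1, H2.
assert (Hs := sin_angle); fold t in Hs.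
apply Rle_div_r; trivial; rewrite Rmult_1_l.
assert (t <= x * t <= PI - t) by nra.
destruct (Rle_dec (x * t) (PI / 2)) as [Hle|Hle].
- apply sin_incr_1; lra.
- rewrite <- (sin_PI_x (x * t)); apply sin_incr_1; lra.
Qed.

Lemma MA_n : mpow (MA t) n = mat_opp mat_id.
Proof.
assert (Hs : sin t <> 0) by (generalize sin_angle; fold t; lra).
rewrite MA_pow by trivial; rewrite sr_n.
assert (E := proj2 angle_range); fold t in E.
unfold sr; replace ((INR n + 1) * t) with (PI + t) by lra; replace ((INR n - 1) * t) with (PI - t) by lra.
rewrite sin_PI_x, sin_plus, sin_PI, cos_PI; unfold mat_opp, mat_id; simpl; f_equal; field; trivial.
Qed.

Lemma MB_n : mpow (MB t) n = mat_opp mat_id.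
Proof.
assert (Hs : sin t <> 0) by (generalize sin_angle; fold t; lra).
rewrite MB_pow by trivial; rewrite sr_n.
assert (E := proj2 angle_range); fold t in E.
unfold sr; replace ((INR n + 1) * t) with (PI + t) by lra; replace ((INR n - 1) * t) with (PI - t) by lra.
rewrite sin_PI_x, sin_plus, sin_PI, cos_PI; unfold mat_opp, mat_id; simpl; f_equal; field; trivial.
Qed.

End Angle.

Lemma mpow_mod M n i : (0 < n)%nat -> mpow M n = mat_opp mat_id -> psl_eq (mpow M i) (mpow M (i mod n)).
Proof.
intros Hn H.
assert (G : forall k, psl_eq (mpow M (n * k)) mat_id).
{ intros k; induction k as [|k IH]; [rewrite Nat.mul_0_r; apply psl_refl|].
  replace (n * S k)%nat with (n + n * k)%nat by ring; rewrite mpow_add.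
  apply psl_trans with (mat_mul mat_id mat_id); [|rewrite mat_mul_id_l; apply psl_refl].
  apply psl_mul; trivial; right; trivial. }
rewrite (Nat.div_mod i n) at 1 by lia; rewrite mpow_add.
apply psl_trans with (mat_mul mat_id (mpow M (i mod n))); [|rewrite mat_mul_id_l; apply psl_refl].
apply psl_mul; [apply G|apply psl_refl].
Qed.

Lemma mob_mpow_fixed M w k : mat_det M = 1 -> inH w -> mob M w = w ->
  mob (mpow M k) w = w /\ jfac (mpow M k) w = (jfac M w ^ k)%C.
Proof.
intros HM Hw Hf; induction k as [|k [IH1 IH2]]; simpl mpow.
- split; [apply mob_id|unfold jfac; simpl; ring].
- rewrite mob_mul, jfac_mul, IH1, IH2 by (trivial; apply mpow_det; trivial); split; trivial.
Qed.

(** The fixed point equation of such a matrix is [s * (z ^ 2 + 2 * c * z + 1) = 0], whose root in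
    the upper half-plane does not depend on [s]. If [s = 0] the matrix is plus or minus the
    identity, excluded by the multiplier. *)
Lemma fixed_point_eq M s c y0 z : mat_det M = 1 -> mb M = s -> mc M = - s -> ma M - md M = 2 * c * s ->
  c * c + y0 * y0 = 1 -> 0 < y0 -> inH z -> mob M z = z -> (jfac M z ^ 2)%C <> 1 -> z = (- c, y0).
Proof.
intros HD Hb Hc Had Hcy Hy0 Hz Hf Hj.
assert (Hj0 := jfac_neq_0 M z HD Hz).
assert (E : (RtoC (ma M) * z + RtoC (mb M))%C = (z * jfac M z)%C).
{ rewrite <- Hf at 2; unfold mob; fold (jfac M z); field; trivial. }
unfold mat_det in HD; rewrite Hb, Hc in HD.
destruct (Req_dec s 0) as [Hs|Hs].
- exfalso; apply Hj; unfold jfac; rewrite Hc, Hs.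
  transitivity (RtoC (md M * md M)); [rewrite RtoC_mult, RtoC_opp; ring|f_equal; nra].
- destruct z as [x y]; unfold inH in Hz; simpl in Hz.
  assert (E1 := f_equal Re E); assert (E2 := f_equal Im E).
  unfold jfac, Re, Im, Cplus, Cmult, RtoC in E1, E2; simpl in E1, E2; rewrite Hb, Hc in E1; rewrite Hc in E2.
  assert (X : x = - c).
  { apply Rmult_eq_reg_l with (2 * s * y); [|apply Rmult_integral_contrapositive_currified; nra]; nra. }
  subst x.
  assert (Y : y * y = y0 * y0) by (apply Rmult_eq_reg_l with s; trivial; nra).
  f_equal; nra.
Qed.

Lemma MA_fixed_unique t k z : 0 < sin t -> inH z -> mob (mpow (MA t) k) z = z ->
  (jfac (mpow (MA t) k) z ^ 2)%C <> 1 -> z = (- cos t, sin t).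
Proof.
intros Hs.
assert (HD : mat_det (mpow (MA t) k) = 1) by (apply mpow_det; unfold mat_det, MA; simpl; ring).
rewrite MA_pow in * by lra; apply fixed_point_eq with (sr t (INR k)); trivial; simpl.
- rewrite (sr_rec t (INR k)) by lra; ring.
- generalize (sin2_cos2 t); unfold Rsqr; lra.
Qed.

Lemma MB_fixed_unique t k z : 0 < sin t -> inH z -> mob (mpow (MB t) k) z = z ->
  (jfac (mpow (MB t) k) z ^ 2)%C <> 1 -> z = (cos t, sin t).
Proof.
intros Hs.
assert (HD : mat_det (mpow (MB t) k) = 1) by (apply mpow_det; unfold mat_det, MB; simpl; ring).
rewrite MB_pow in * by lra; rewrite <- (Ropp_involutive (cos t)); apply fixed_point_eq with (sr t (INR k)); trivial; simpl.
- rewrite (sr_rec t (INR k)) by lra; ring.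
- generalize (sin2_cos2 t); unfold Rsqr; lra.
Qed.

(** Conjugation by [diag(1, -1)] turns these into nonnegative matrices with diagonal entries at
    least 1, which explains the closure under products. *)
Definition posmat (M : mat2) := 1 <= ma M /\ 1 <= md M /\ mb M <= 0 /\ mc M <= 0.

Lemma posmat_mul M N : posmat M -> posmat N -> posmat (mat_mul M N).
Proof.
intros [A1 [A2 [A3 A4]]] [B1 [B2 [B3 B4]]]; unfold posmat, mat_mul; simpl; repeat split; nra.
Qed.

Lemma list_rcons_cases {T} (l : list T) : l = nil \/ exists l' x, l = l' ++ x :: nil.
Proof.
destruct l as [|y l]; [auto|right].
destruct (exists_last (l := y :: l)) as [l' [x E]]; [discriminate|eauto].
Qed.

(** * Words in the generators, their traces and their fixed points *)

Section Words.

Variables p q : nat.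
Hypothesis Hp : (2 <= p)%nat.
Hypothesis Hq : (2 <= q)%nat.

Let A := A0 p.
Let B := B0 q.

(** A pair [(i, j)] stands for [A0^i B0^j]. Natural exponents suffice since the generators have
    finite order modulo sign, and zero exponents are allowed, so that lone powers of one generator
    are words too. *)
Definition word (l : list (nat * nat)) : mat2 :=
  fold_right (fun ij M => mat_mul (mat_mul (mpow (A0 p) (fst ij)) (mpow (B0 q) (snd ij))) M) mat_id l.

Lemma det_A : mat_det A = 1.
Proof. unfold A, A0, mat_det; simpl; ring. Qed.

Lemma det_B : mat_det B = 1.
Proof. unfold B, B0, mat_det; simpl; ring. Qed.

Lemma A_p : mpow A p = mat_opp mat_id.
Proof. exact (MA_n p Hp). Qed.

Lemma B_q : mpow B q = mat_opp mat_id.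
Proof. exact (MB_n q Hq). Qed.

Lemma word_app l1 l2 : word (l1 ++ l2) = mat_mul (word l1) (word l2).
Proof.
induction l1 as [|ij l1 IH]; simpl; [rewrite mat_mul_id_l; reflexivity|].
rewrite IH, !mat_mul_assoc; reflexivity.
Qed.

Lemma word_1 i j : word ((i, j) :: nil) = mat_mul (mpow A i) (mpow B j).
Proof. simpl; rewrite mat_mul_id_r; reflexivity. Qed.

Lemma det_word l : mat_det (word l) = 1.
Proof.
induction l as [|[i j] l IH]; simpl; [unfold mat_det, mat_id; simpl; ring|].
rewrite !mat_det_mul, IH, !mpow_det by (apply det_A || apply det_B); ring.
Qed.

(** Modulo sign, [(n - 1) * k] serves as the exponent [- k] of a generator of order [n]. *)
Lemma word_inv l : exists l', psl_eq (word l') (minv (word l)).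
Proof.
assert (G : forall M n k, (0 < n)%nat -> mpow M n = mat_opp mat_id ->
  psl_eq (mat_mul (mpow M ((n - 1) * k)) (mpow M k)) mat_id).
{ intros M n k Hn H; rewrite <- mpow_add.
  replace ((n - 1) * k + k)%nat with (k * n)%nat by nia.
  apply psl_trans with (1 := mpow_mod M n (k * n) Hn H).
  rewrite Nat.Div0.mod_mul; apply psl_refl. }
assert (H : exists l', psl_eq (mat_mul (word l') (word l)) mat_id).
{ induction l as [|[i j] l [l' IH]].
  - exists nil; simpl; rewrite mat_mul_id_l; apply psl_refl.
  (* Inversion reverses the two syllables of a block, so each is padded by a zero exponent. *)
  - exists (l' ++ (0, (q - 1) * j)%nat :: ((p - 1) * i, 0)%nat :: nil).
    rewrite word_app; simpl; rewrite !mat_mul_id_r, mat_mul_id_l.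
    assert (GA := G _ _ i (Nat.lt_le_trans _ _ _ Nat.lt_0_2 Hp) A_p).
    assert (GB := G _ _ j (Nat.lt_le_trans _ _ _ Nat.lt_0_2 Hq) B_q).
    apply psl_trans with (2 := IH).
    apply psl_trans with (mat_mul (word l') (mat_mul (mat_mul (mpow B ((q - 1) * j)) (mat_mul (mat_mul (mpow A ((p - 1) * i)) (mpow A i)) (mpow B j))) (word l))).
    { left; rewrite !mat_mul_assoc; reflexivity. }
    apply psl_mul; [apply psl_refl|].
    apply psl_trans with (mat_mul mat_id (word l)); [|rewrite mat_mul_id_l; apply psl_refl].
    apply psl_mul; [|apply psl_refl].
    apply psl_trans with (2 := GB); apply psl_mul; [apply psl_refl|].
    apply psl_trans with (mat_mul mat_id (mpow B j)); [|rewrite mat_mul_id_l; apply psl_refl].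
    apply psl_mul; [exact GA|apply psl_refl]. }
destruct H as [l' H]; exists l'.
assert (H1 := psl_mul _ _ _ _ H (psl_refl (minv (word l)))).
rewrite <- mat_mul_assoc, minv_r, mat_mul_id_r, mat_mul_id_l in H1 by apply det_word; trivial.
Qed.

(** Conjugacy to a power of a generator is written [M g = g X^k], which avoids inverses of words. *)
Definition tame (M : mat2) : Prop :=
  4 <= mtr M * mtr M \/
  (exists g k, psl_eq (mat_mul M (word g)) (mat_mul (word g) (mpow (A0 p) k))) \/
  (exists g k, psl_eq (mat_mul M (word g)) (mat_mul (word g) (mpow (B0 q) k))).

Lemma tame_psl M N : psl_eq M N -> tame N -> tame M.
Proof.
intros HMN [H|[[g [k H]]|[g [k H]]]].
- left; rewrite (psl_mtr2 _ _ HMN); trivial.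
- right; left; exists g, k; apply psl_trans with (2 := H); apply psl_mul; [trivial|apply psl_refl].
- right; right; exists g, k; apply psl_trans with (2 := H); apply psl_mul; [trivial|apply psl_refl].
Qed.

Lemma tame_rot u v : tame (word (v ++ u)) -> tame (word (u ++ v)).
Proof.
rewrite !word_app; intros [H|[[g [k H]]|[g [k H]]]].
- left; rewrite mtr_mul_comm; trivial.
- right; left; exists (u ++ g), k; rewrite word_app.
  rewrite <- !mat_mul_assoc in H; rewrite <- !mat_mul_assoc; apply psl_mul; [apply psl_refl|trivial].
- right; right; exists (u ++ g), k; rewrite word_app.
  rewrite <- !mat_mul_assoc in H; rewrite <- !mat_mul_assoc; apply psl_mul; [apply psl_refl|trivial].
Qed.

Lemma block_pos i j : (0 < i < p)%nat -> (0 < j < q)%nat ->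
  posmat (mat_opp (mat_mul (mpow A i) (mpow B j))).
Proof.
intros Hi Hj.
assert (Sp := sin_angle p Hp); assert (Sq := sin_angle q Hq).
change A with (MA (PI / INR p)); change B with (MB (PI / INR q)).
rewrite MA_pow, MB_pow by lra.
assert (I1 : 1 <= INR i <= INR p - 1).
{ assert (H1 := le_INR 1 i (proj1 Hi)); assert (H2 := le_INR (S i) p (proj2 Hi)); rewrite S_INR in H2; simpl in H1; lra. }
assert (J1 : 1 <= INR j <= INR q - 1).
{ assert (H1 := le_INR 1 j (proj1 Hj)); assert (H2 := le_INR (S j) q (proj2 Hj)); rewrite S_INR in H2; simpl in H1; lra. }
assert (X1 := sr_ge_1 p Hp (INR i) I1); assert (Y1 := sr_ge_1 q Hq (INR j) J1).
assert (X2 : 0 <= sr (PI / INR p) (INR i + 1)) by (apply sr_ge_0; trivial; lra).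
assert (X3 : 0 <= sr (PI / INR p) (INR i - 1)) by (apply sr_ge_0; trivial; lra).
assert (Y2 : 0 <= sr (PI / INR q) (INR j + 1)) by (apply sr_ge_0; trivial; lra).
assert (Y3 : 0 <= sr (PI / INR q) (INR j - 1)) by (apply sr_ge_0; trivial; lra).
unfold posmat, mat_opp, mat_mul; simpl; repeat split; nra.
Qed.

Lemma reduced_word_pos l :
  List.Forall (fun ij => (fst ij mod p <> 0)%nat /\ (snd ij mod q <> 0)%nat) l ->
  exists N, psl_eq (word l) N /\ posmat N.
Proof.
induction 1 as [|[i j] l [Hi Hj] _ [N [HN Pos]]].
- exists mat_id; split; [apply psl_refl|unfold posmat, mat_id; simpl; lra].
- simpl in Hi, Hj.
  exists (mat_mul (mat_opp (mat_mul (mpow A (i mod p)) (mpow B (j mod q)))) N); split.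
  + simpl; apply psl_mul; trivial.
    apply psl_trans with (mat_mul (mpow A (i mod p)) (mpow B (j mod q))).
    * apply psl_mul; apply mpow_mod; try lia; [apply A_p|apply B_q].
    * apply psl_sym; right; reflexivity.
  + apply posmat_mul; trivial; apply block_pos; split; try lia; apply Nat.mod_upper_bound; lia.
Qed.

(* Cyclic reduction: a syllable divisible by [p] or [q] is merged with a cyclic neighbour; if there is none,
   the word is a product of blocks which, up to sign, have diagonal entries at least 1 and
   nonpositive off-diagonal entries. *)
Lemma word_tame l : tame (word l).
Proof.
remember (length l) as n eqn:Hn; revert l Hn.
induction n as [n IH] using lt_wf_ind; intros l Hn.
destruct (classic (exists ij, In ij l /\ (fst ij mod p = 0)%nat)) as [[[i j] [Hin Hi]]|HA].
{ simpl in Hi; destruct (in_split _ _ Hin) as [l1 [l2 El]].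
  assert (E : l = (l1 ++ (i, j) :: nil) ++ l2) by (rewrite El, <- app_assoc; reflexivity).
  rewrite E; apply tame_rot; rewrite app_assoc, word_app, word_1.
  assert (E1 : psl_eq (mpow A i) mat_id).
  { apply psl_trans with (1 := mpow_mod A p i (Nat.lt_le_trans _ _ _ Nat.lt_0_2 Hp) A_p).
    rewrite Hi; apply psl_refl. }
  apply tame_psl with (mat_mul (word (l2 ++ l1)) (mpow B j)).
  { apply psl_mul; [apply psl_refl|]; rewrite <- (mat_mul_id_l (mpow B j)) at 2.
    apply psl_mul; [trivial|apply psl_refl]. }
  assert (Hlen : length (l2 ++ l1) = (n - 1)%nat).
  { rewrite Hn, El, !length_app; simpl; lia. }
  assert (Hn0 : (0 < n)%nat) by (rewrite Hn, El, length_app; simpl; lia).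
  destruct (list_rcons_cases (l2 ++ l1)) as [E3|[l3 [[i' j'] E3]]]; rewrite E3 in *.
  (* With no other syllable left, the word is a power of [B0]; otherwise [B0^j] is absorbed by the
     last block. *)
  - right; right; exists nil, j; simpl; rewrite !mat_mul_id_l, mat_mul_id_r; apply psl_refl.
  - rewrite word_app, word_1, <- !mat_mul_assoc, <- mpow_add, <- word_1, <- word_app.
    apply IH with (n - 1)%nat; [lia|].
    rewrite length_app in Hlen |- *; simpl in *; lia. }
destruct (classic (exists ij, In ij l /\ (snd ij mod q = 0)%nat)) as [[[i j] [Hin Hj]]|HB].
{ simpl in Hj; destruct (in_split _ _ Hin) as [l1 [l2 El]].
  rewrite El; apply tame_rot; simpl app; set (l3 := l2 ++ l1).
  assert (E1 : psl_eq (mpow B j) mat_id).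
  { apply psl_trans with (1 := mpow_mod B q j (Nat.lt_le_trans _ _ _ Nat.lt_0_2 Hq) B_q).
    rewrite Hj; apply psl_refl. }
  apply tame_psl with (mat_mul (mpow A i) (word l3)).
  { simpl; apply psl_mul; [|apply psl_refl].
    apply psl_trans with (mat_mul (mpow A i) mat_id); [|rewrite mat_mul_id_r; apply psl_refl].
    apply psl_mul; [apply psl_refl|trivial]. }
  assert (Hlen : length l3 = (n - 1)%nat).
  { unfold l3; rewrite Hn, El, !length_app; simpl; lia. }
  assert (Hn0 : (0 < n)%nat) by (rewrite Hn, El, length_app; simpl; lia).
  destruct l3 as [|[i' j'] l3].
  - right; left; exists nil, i; simpl; rewrite !mat_mul_id_l, !mat_mul_id_r; apply psl_refl.
  - change (word ((i', j') :: l3)) with (mat_mul (mat_mul (mpow A i') (mpow B j')) (word l3)).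
    rewrite !mat_mul_assoc, <- mpow_add.
    apply (IH (n - 1)%nat) with (l := (i + i', j')%nat :: l3); [lia|].
    simpl in *; lia. }
destruct (reduced_word_pos l) as [N [HN [P1 [P2 _]]]].
{ apply List.Forall_forall; intros ij Hin; split; intros H; [apply HA|apply HB]; eauto. }
left; rewrite (psl_mtr2 _ _ HN); unfold mtr; nra.
Qed.

(** Transport by [word g]: the fixed point becomes one of [X^k] and the cocycle rule preserves the
    squared automorphy factor, which at [w] is the [k]-th power of that of [X]. *)
Lemma conj_stab X w g k l z n : mat_det X = 1 -> inH w -> mob X w = w -> ((jfac X w ^ 2) ^ n)%C = 1 ->
  (forall k z, inH z -> mob (mpow X k) z = z -> (jfac (mpow X k) z ^ 2)%C <> 1 -> z = w) ->
  psl_eq (mat_mul (word l) (word g)) (mat_mul (word g) (mpow X k)) ->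
  inH z -> mob (word l) z = z -> (jfac (word l) z ^ 2)%C <> 1 ->
  z = mob (word g) w /\ ((jfac (word l) z ^ 2) ^ n)%C = 1.
Proof.
intros HX Hw Hf Hn Hu H Hz Hzf Hj.
assert (Dg := det_word g); assert (Dl := det_word l); assert (DX := mpow_det X k HX).
assert (Di : mat_det (minv (word g)) = 1) by (rewrite minv_det; trivial).
assert (DgX : mat_det (mat_mul (word g) (mpow X k)) = 1) by (rewrite mat_det_mul, Dg, DX; ring).
set (z1 := mob (minv (word g)) z).
assert (Hz1 : inH z1) by (apply inH_mob; trivial).
assert (Ez : mob (word g) z1 = z) by (apply mob_minv_r; trivial).
assert (E1 : mob (mat_mul (word l) (word g)) z1 = mob (mat_mul (word g) (mpow X k)) z1) by (apply psl_mob; trivial).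
assert (HXz : inH (mob (mpow X k) z1)) by (apply inH_mob; trivial).
rewrite !mob_mul, Ez, Hzf in E1 by trivial.
assert (E2 : mob (mpow X k) z1 = z1).
{ rewrite <- (mob_minv_l (word g) (mob (mpow X k) z1)), <- E1 by trivial; reflexivity. }
assert (E3 := psl_jfac2 _ _ z1 H); rewrite !jfac_mul, Ez, E2 in E3 by trivial.
assert (Jg := jfac_neq_0 (word g) z1 Dg Hz1).
assert (E4 : (jfac (word l) z ^ 2)%C = (jfac (mpow X k) z1 ^ 2)%C).
{ transitivity ((jfac (word l) z * jfac (word g) z1) ^ 2 / (jfac (word g) z1 ^ 2))%C; [simpl; field; trivial|].
  rewrite E3; simpl; field; trivial. }
assert (E5 : z1 = w) by (apply (Hu k z1 Hz1 E2); rewrite <- E4; trivial).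
split; [rewrite <- E5; auto|].
rewrite E4, E5, (proj2 (mob_mpow_fixed X w k HX Hw Hf)).
rewrite <- !Cpow_mult_r in *.
replace (k * (2 * n))%nat with (2 * n * k)%nat by ring.
rewrite Cpow_mult_r, Hn; apply Cpow_1_l.
Qed.

Lemma pt_a_inH : inH (pt_a p).
Proof. exact (sin_angle p Hp). Qed.

Lemma pt_b_inH : inH (pt_b q).
Proof. exact (sin_angle q Hq). Qed.

Lemma jfac_a : jfac A (pt_a p) = cis (- (PI / INR p)).
Proof.
unfold jfac, A, A0, pt_a, cis, Cplus, Cmult, RtoC; simpl; rewrite cos_neg, sin_neg; f_equal; ring.
Qed.

Lemma jfac_b : jfac B (pt_b q) = cis (- (PI / INR q)).
Proof.
unfold jfac, B, B0, pt_b, cis, Cplus, Cmult, RtoC; simpl; rewrite cos_neg, sin_neg; f_equal; ring.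
Qed.

Lemma mob_a : mob A (pt_a p) = pt_a p.
Proof.
assert (Hj := jfac_neq_0 A _ det_A pt_a_inH).
assert (E : (RtoC (ma A) * pt_a p + RtoC (mb A))%C = (pt_a p * jfac A (pt_a p))%C).
{ unfold jfac, A, A0, pt_a, Cplus, Cmult, RtoC; simpl.
  generalize (sin2_cos2 (PI / INR p)); unfold Rsqr; intros; f_equal; nra. }
unfold mob; fold (jfac A (pt_a p)); rewrite E; field; trivial.
Qed.

Lemma mob_b : mob B (pt_b q) = pt_b q.
Proof.
assert (Hj := jfac_neq_0 B _ det_B pt_b_inH).
assert (E : (RtoC (ma B) * pt_b q + RtoC (mb B))%C = (pt_b q * jfac B (pt_b q))%C).
{ unfold jfac, B, B0, pt_b, Cplus, Cmult, RtoC; simpl.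
  generalize (sin2_cos2 (PI / INR q)); unfold Rsqr; intros; f_equal; nra. }
unfold mob; fold (jfac B (pt_b q)); rewrite E; field; trivial.
Qed.

Lemma stabilizer l z : inH z -> mob (word l) z = z -> (jfac (word l) z ^ 2)%C <> 1 ->
  (exists g, z = mob (word g) (pt_a p) /\ ((jfac (word l) z ^ 2) ^ p)%C = 1) \/
  (exists g, z = mob (word g) (pt_b q) /\ ((jfac (word l) z ^ 2) ^ q)%C = 1).
Proof.
intros Hz Hf Hj.
assert (Sp := sin_angle p Hp); assert (Sq := sin_angle q Hq).
destruct (word_tame l) as [Ht|[[g [k H]]|[g [k H]]]].
- elim Hj; apply fixed_nonelliptic; trivial; apply det_word.
- left; exists g; apply (conj_stab A _ g k l z p); trivial; [apply det_A|apply mob_a| |].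
  + rewrite jfac_a; apply angle_pow; trivial.
  + intros k' z' Hz' Hf' Hj'; apply (MA_fixed_unique (PI / INR p) k' z'); trivial.
- right; exists g; apply (conj_stab B _ g k l z q); trivial; [apply det_B|apply mob_b| |].
  + rewrite jfac_b; apply angle_pow; trivial.
  + intros k' z' Hz' Hf' Hj'; apply (MB_fixed_unique (PI / INR q) k' z'); trivial.
Qed.

Lemma Gamma_orb_word z1 z2 : inH z1 -> Gamma_orb p q z1 z2 -> exists l, z2 = mob (word l) z1.
Proof.
intros Hz1 H.
(* The relation also links every point outside the half-plane to itself; the first alternative
   isolates this, so that the induction can assume points of the half-plane elsewhere. *)
assert (G : z1 = z2 \/ (inH z1 /\ inH z2 /\ exists l, z2 = mob (word l) z1)).
{ clear Hz1; induction H as [x y [Hx [->| ->]]|x|x y _ IH|x y z _ IH1 _ IH2].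
  - right; split; [trivial|]; split; [apply inH_mob; trivial; apply det_A|].
    exists ((1, 0)%nat :: nil); simpl; rewrite !mat_mul_id_r; reflexivity.
  - right; split; [trivial|]; split; [apply inH_mob; trivial; apply det_B|].
    exists ((0, 1)%nat :: nil); simpl; rewrite !mat_mul_id_r, mat_mul_id_l; reflexivity.
  - auto.
  - destruct IH as [->|[Hx [Hy [l ->]]]]; [auto|right; split; [trivial|split; [trivial|]]].
    destruct (word_inv l) as [l' Hl']; exists l'.
    rewrite (psl_mob _ _ _ (eq_trans (minv_det _) (det_word l)) Hy Hl'), mob_minv_l; trivial; apply det_word.
  - destruct IH1 as [->|[Hx [Hy [l ->]]]]; [trivial|].
    destruct IH2 as [<-|[_ [Hz [l' ->]]]]; [right; eauto|].
    right; split; [trivial|]; split; [trivial|]; exists (l' ++ l).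
    rewrite word_app, mob_mul; trivial; apply det_word. }
destruct G as [->|[_ [_ G]]]; trivial.
exists nil; simpl; rewrite mob_id; reflexivity.
Qed.

End Words.

(** * Local behaviour of [theta] *)

Lemma inH_disc z w : inH z -> Cmod (w - z)%C < Im z -> inH w.
Proof.
unfold inH; intros Hz Hw; generalize (im_le_Cmod (w - z)%C).
change (Im (w - z)%C) with (Im w + - Im z); intros H; apply Rabs_le_between in H; lra.
Qed.

Lemma inH_seg z w t : 0 <= t <= 1 -> inH z -> inH w -> inH (seg z w t).
Proof.
unfold inH; intros Ht Hz Hw.
replace (Im (seg z w t)) with ((1 - t) * Im z + t * Im w)
  by (unfold seg, Im, Cplus, Cmult, Cminus, Copp, RtoC; simpl; ring).
destruct (Req_dec t 0); [subst; lra|nra].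
Qed.

Lemma holo_isolated (f : C -> C) z0 D0 : 0 < D0 -> holo_disc f z0 D0 ->
  (exists d, 0 < d /\ forall z, Cmod (z - z0)%C < d -> f z = f z0) \/
  (exists d, 0 < d /\ forall z, z <> z0 -> Cmod (z - z0)%C < d -> f z <> f z0).
Proof.
intros HD Hf; destruct (holo_order f z0 D0 HD Hf) as [H|[m [g [d [Hm [Hd [Hg [Hg0 H]]]]]]]]; [auto|right].
assert (Hc : continuous g z0) by (apply Choloat_cont, Hg; rewrite Cmod_self; lra).
rewrite continuous_C in Hc; destruct (Hc (Cmod (g z0))) as [d1 [Hd1 H1]]; [apply Cmod_gt_0; trivial|].
exists (Rmin d d1); split; [apply Rmin_glb_lt; lra|].
intros z Hz Hzd E.
assert (Z1 := Rlt_le_trans _ _ _ Hzd (Rmin_l _ _)); assert (Z2 := Rlt_le_trans _ _ _ Hzd (Rmin_r _ _)).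
specialize (H z Z1); specialize (H1 z Z2).
assert (E1 : ((z - z0) ^ m * g z)%C = 0).
{ replace ((z - z0) ^ m * g z)%C with ((f z0 + (z - z0) ^ m * g z) - f z0)%C by ring; rewrite <- H, E; ring. }
apply Cmult_eq_0 in E1; destruct E1 as [E1|E1].
- revert E1; apply Cpow_nz, Cmod_gt_0, Cmod_sub_pos; trivial.
- rewrite E1 in H1; replace (RtoC 0 - g z0)%C with (- g z0)%C in H1 by ring; rewrite Cmod_opp in H1; lra.
Qed.

(** Let [T] be the supremum of the initial parts of the segment on which [f] is constant. The point
    at [T] is a limit of points with value [f z0], so this value is not isolated there; [f] is then
    constant around it, and [T < 1] is impossible. *)
Lemma identity_theorem (f : C -> C) z0 z1 : (forall z, inH z -> Choloat f z) -> inH z0 -> inH z1 ->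
  (exists d, 0 < d /\ forall z, Cmod (z - z0)%C < d -> f z = f z0) -> f z1 = f z0.
Proof.
intros Hf Hz0 Hz1 [d0 [Hd0 Hloc]].
destruct (Ceq_dec z1 z0) as [->|Hne]; trivial.
assert (HL : 0 < Cmod (z1 - z0)%C) by (apply Cmod_sub_pos; trivial).
set (L := Cmod (z1 - z0)%C) in *.
assert (Hdist : forall s t, Cmod (seg z0 z1 s - seg z0 z1 t)%C = Rabs (s - t) * L).
{ intros s t; replace (seg z0 z1 s - seg z0 z1 t)%C with (RtoC (s - t) * (z1 - z0))%C
    by (unfold seg; rewrite RtoC_minus; ring); rewrite Cmod_mult, Cmod_R; reflexivity. }
set (E := fun t => 0 <= t <= 1 /\ forall s, 0 <= s <= t -> f (seg z0 z1 s) = f z0).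
destruct (completeness E) as [T [HT1 HT2]].
{ exists 1; intros t [Ht _]; lra. }
{ exists 0; split; [lra|]; intros s Hs; replace s with 0 by lra; rewrite seg_0; trivial. }
assert (HT01 : T <= 1) by (apply HT2; intros t [Ht _]; lra).
assert (HT0 : 0 < T).
{ set (t := Rmin 1 (d0 / L / 2)).
  assert (0 < d0 / L) by (apply Rdiv_lt_0_compat; trivial).
  assert (Ht : 0 < t) by (apply Rmin_glb_lt; lra).
  apply Rlt_le_trans with t; trivial; apply HT1; split; [split; [lra|apply Rmin_l]|].
  intros s Hs; apply Hloc; rewrite <- (seg_0 z0 z1) at 2; rewrite Hdist, Rminus_0_r, Rabs_pos_eq by lra.
  assert (s <= d0 / L / 2) by (eapply Rle_trans; [apply Hs|apply Rmin_r]).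
  assert (d0 / L * L = d0) by (field; lra); nra. }
assert (Hbelow : forall s, 0 <= s < T -> f (seg z0 z1 s) = f z0).
{ intros s Hs; apply NNPP; intros Hn.
  assert (T <= s); [|lra].
  apply HT2; intros t [Ht Hts]; apply Rnot_lt_le; intros Hst; apply Hn, Hts; lra. }
set (w := seg z0 z1 T).
assert (Hw : inH w) by (apply inH_seg; trivial; lra).
assert (Hclose : forall e, 0 < e -> exists s, 0 <= s < T /\ Cmod (seg z0 z1 s - w)%C < e /\ seg z0 z1 s <> w).
{ intros e He; set (s := Rmax 0 (T - e / L / 2)).
  assert (0 < e / L) by (apply Rdiv_lt_0_compat; trivial).
  assert (Hs : 0 <= s < T) by (split; [apply Rmax_l|apply Rmax_lub_lt; lra]).
  assert (Hs2 : T - s <= e / L / 2) by (unfold s; generalize (Rmax_r 0 (T - e / L / 2)); lra).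
  assert (Hm : Cmod (seg z0 z1 s - w)%C = (T - s) * L).
  { unfold w; rewrite Hdist, <- Rabs_Ropp, Rabs_pos_eq; [f_equal; ring|lra]. }
  exists s; split; [trivial|]; split.
  - rewrite Hm; assert (e / L * L = e) by (field; lra); nra.
  - intros Eq; rewrite Eq, Cmod_self in Hm; nra. }
assert (Hfw : f w = f z0).
{ apply NNPP; intros Hn; apply Cmod_sub_pos in Hn.
  assert (Hc := Choloat_cont _ _ (Hf w Hw)); rewrite continuous_C in Hc.
  destruct (Hc _ Hn) as [d [Hd H]]; destruct (Hclose d Hd) as [s [Hs [Hs1 _]]].
  specialize (H _ Hs1); rewrite (Hbelow s Hs), Cmod_minus_sym in H; lra. }
destruct (holo_isolated f w (Im w) Hw) as [[d [Hd H]]|[d [Hd H]]].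
- intros z Hz; apply Hf; apply (inH_disc w); trivial.
- destruct (Rlt_le_dec T 1) as [HT|HT].
  + set (t := Rmin 1 (T + d / L / 2)).
    assert (0 < d / L) by (apply Rdiv_lt_0_compat; trivial).
    assert (HtT : T < t) by (apply Rmin_glb_lt; lra).
    assert (Et : E t).
    { split; [split; [lra|apply Rmin_l]|]; intros s Hs.
      destruct (Rlt_le_dec s T) as [HsT|HsT]; [apply Hbelow; lra|].
      rewrite H, Hfw; trivial; unfold w; rewrite Hdist, Rabs_pos_eq by lra.
      assert (s <= T + d / L / 2) by (eapply Rle_trans; [apply Hs|apply Rmin_r]).
      assert (d / L * L = d) by (field; lra); nra. }
    generalize (HT1 t Et); lra.
  + assert (T = 1) by lra; unfold w in Hfw; subst T; rewrite seg_1 in Hfw; trivial.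
- destruct (Hclose d Hd) as [s [Hs [Hs1 Hs2]]].
  elim (H _ Hs2 Hs1); rewrite (Hbelow s Hs); auto.
Qed.

(** * Sequences and compactness in SL_2(R) *)

Definition Clim (u : nat -> C) (l : C) :=
  forall e, 0 < e -> exists N, forall n, (N <= n)%nat -> Cmod (u n - l)%C < e.

Lemma Clim_cont (f : C -> C) u l : continuous f l -> Clim u l -> Clim (fun n => f (u n)) (f l).
Proof.
rewrite continuous_C; intros Hf Hu e He; destruct (Hf e He) as [d [Hd H]].
destruct (Hu d Hd) as [N HN]; exists N; auto.
Qed.

Lemma Clim_mult u v a b : Clim u a -> Clim v b -> Clim (fun n => u n * v n)%C (a * b)%C.
Proof.
intros Hu Hv e He; destruct (Cmult_eps a b e He) as [d [Hd H]].
destruct (Hu d Hd) as [N1 H1]; destruct (Hv d Hd) as [N2 H2].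
exists (max N1 N2); intros n Hn; apply H; [apply H1|apply H2]; lia.
Qed.

Lemma Clim_plus u v a b : Clim u a -> Clim v b -> Clim (fun n => u n + v n)%C (a + b)%C.
Proof.
intros Hu Hv e He.
destruct (Hu (e / 2)) as [N1 H1]; [lra|]; destruct (Hv (e / 2)) as [N2 H2]; [lra|].
exists (max N1 N2); intros n Hn.
replace (u n + v n - (a + b))%C with ((u n - a) + (v n - b))%C by ring.
eapply Rle_lt_trans; [apply Cmod_triangle|].
specialize (H1 n ltac:(lia)); specialize (H2 n ltac:(lia)); lra.
Qed.

Lemma Clim_const a : Clim (fun _ => a) a.
Proof. intros e He; exists O; intros n _; rewrite Cmod_self; trivial. Qed.

Lemma Clim_unique u a b : Clim u a -> Clim u b -> a = b.
Proof.
intros Ha Hb; apply NNPP; intros Hn; apply Cmod_sub_pos in Hn.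
destruct (Ha (Cmod (a - b)%C / 2)) as [N1 H1]; [lra|]; destruct (Hb (Cmod (a - b)%C / 2)) as [N2 H2]; [lra|].
specialize (H1 (max N1 N2) ltac:(lia)); specialize (H2 (max N1 N2) ltac:(lia)).
rewrite Cmod_minus_sym in H1; generalize (Cmod_triangle3 a (u (max N1 N2)) b); lra.
Qed.

Lemma Clim_sub u a phi : Clim u a -> (forall n, (n <= phi n)%nat) -> Clim (fun n => u (phi n)) a.
Proof.
intros Hu Hphi e He; destruct (Hu e He) as [N HN]; exists N; intros n Hn; apply HN.
specialize (Hphi n); lia.
Qed.

(** [n <= phi n] stands in for strict monotonicity; it is enough to preserve limits and is stable
    under composition. *)
Lemma bounded_subseq (u : nat -> R) K : (forall n, Rabs (u n) <= K) ->
  exists phi l, (forall n, (n <= phi n)%nat) /\ Clim (fun n => RtoC (u (phi n))) (RtoC l).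
Proof.
intros HK.
destruct (Bolzano_Weierstrass u (fun x => -K <= x <= K)) as [l Hl].
{ apply compact_P3. }
{ intros n; apply Rabs_le_between; trivial. }
assert (H : forall n, exists m, (n <= m)%nat /\ Rabs (u m - l) < / (INR n + 1)).
{ intros n; assert (Hp : 0 < / (INR n + 1)) by (apply Rinv_0_lt_compat; generalize (pos_INR n); lra).
  destruct (Hl (fun x => Rabs (x - l) < / (INR n + 1)) n) as [m [Hm1 Hm2]]; [|eauto].
  exists (mkposreal _ Hp); intros x Hx; exact Hx. }
exists (fun n => proj1_sig (constructive_indefinite_description _ (H n))), l; split.
- intros n; apply (proj2_sig (constructive_indefinite_description _ (H n))).
- intros e He; destruct (archimed_cor1 e He) as [N [HN1 HN2]]; exists N; intros n Hn.
  destruct (constructive_indefinite_description _ (H n)) as [m [Hm1 Hm2]]; simpl.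
  rewrite <- RtoC_minus, Cmod_R; eapply Rlt_trans; [exact Hm2|].
  eapply Rle_lt_trans; [|exact HN1]; apply Rinv_le_contravar; [apply lt_0_INR; trivial|].
  generalize (le_INR _ _ Hn); lra.
Qed.

(** An element fixing [Ci] and [2 * Ci] is plus or minus the identity. So agreement at these two
    points is agreement in PSL_2(R), which turns pointwise stabilization of a sequence into
    stabilization of the group element. *)
Lemma mob_two_points M N : mat_det M = 1 -> mat_det N = 1 ->
  mob M Ci = mob N Ci -> mob M (2 * Ci)%C = mob N (2 * Ci)%C -> psl_eq M N.
Proof.
intros HM HN E1 E2.
assert (H1 : inH Ci) by (unfold inH, Im, Ci, Cmult, RtoC; simpl; lra).
assert (H2 : inH (2 * Ci)%C) by (unfold inH, Im, Ci, Cmult, RtoC; simpl; lra).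
set (K := mat_mul (minv N) M).
assert (Di : mat_det (minv N) = 1) by (rewrite minv_det; trivial).
assert (DK : mat_det K = 1) by (unfold K; rewrite mat_det_mul, minv_det, HM, HN; ring).
assert (F1 : mob K Ci = Ci) by (unfold K; rewrite mob_mul, E1, mob_minv_l; trivial).
assert (F2 : mob K (2 * Ci)%C = (2 * Ci)%C) by (unfold K; rewrite mob_mul, E2, mob_minv_l; trivial).
assert (E : M = mat_mul N K) by (unfold K; rewrite mat_mul_assoc, minv_r, mat_mul_id_l; trivial).
clearbody K.
assert (G1 : (RtoC (ma K) * Ci + RtoC (mb K))%C = (Ci * jfac K Ci)%C).
{ rewrite <- F1 at 2; unfold mob; fold (jfac K Ci); field; apply jfac_neq_0; trivial. }
assert (G2 : (RtoC (ma K) * (2 * Ci) + RtoC (mb K))%C = ((2 * Ci) * jfac K (2 * Ci))%C).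
{ rewrite <- F2 at 2; unfold mob; fold (jfac K (2 * Ci)); field; apply jfac_neq_0; trivial. }
apply (f_equal Re) in G1 as R1; apply (f_equal Im) in G1 as I1; apply (f_equal Re) in G2 as R2.
unfold jfac, Ci, Re, Im, Cplus, Cmult, RtoC in R1, I1, R2; simpl in R1, I1, R2.
assert (HK : psl_eq K mat_id).
{ assert (mb K = 0 /\ mc K = 0) by (split; lra); assert (ma K = md K) by lra; destruct H as [B0 C0].
  unfold mat_det in DK; rewrite B0, C0, H0 in DK.
  assert (md K = 1 \/ md K = -1) as [D|D] by (assert ((md K - 1) * (md K + 1) = 0) by nra; apply Rmult_integral in H; lra).
  - left; destruct K; simpl in *; unfold mat_id; f_equal; lra.
  - right; destruct K; simpl in *; unfold mat_opp, mat_id; simpl; f_equal; lra. }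
rewrite E; rewrite <- (mat_mul_id_r N) at 2; apply psl_mul; [apply psl_refl|trivial].
Qed.

Lemma Cderiv_zero_seq (F : C -> C) l (u : nat -> C) z : Cderiv F z l -> F z = 0 ->
  Clim u z -> (forall n, u n <> z /\ F (u n) = 0) -> l = 0.
Proof.
intros HF Fz Hu HFu; apply Cmod_eq_0.
destruct (Rle_lt_or_eq_dec 0 (Cmod l) (Cmod_ge_0 _)) as [H0|]; [exfalso|auto].
rewrite Cderiv_eps in HF; destruct (HF (Cmod l / 2)) as [d [Hd H]]; [lra|].
destruct (Hu d Hd) as [N HN]; specialize (HN N (le_n N)); specialize (H _ HN).
destruct (HFu N) as [Hn E]; rewrite E, Fz in H.
replace (0 - 0 - (u N - z) * l)%C with (- ((u N - z) * l))%C in H by ring.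
rewrite Cmod_opp, Cmod_mult in H; assert (Hp := Cmod_sub_pos _ _ Hn); nra.
Qed.

Lemma cis_pow_divide n k : (0 < n)%nat -> (cis (2 * PI / INR n) ^ k)%C = 1 -> Nat.divide n k.
Proof.
intros Hn; rewrite cis_pow; intros H.
assert (Hn' : 0 < INR n) by (apply lt_0_INR; trivial).
assert (HPI := PI_RGT_0).
destruct (Cexp_eq_1 (0, INR k * (2 * PI / INR n))) as [z Hz].
{ rewrite Cexp_cis; simpl; rewrite exp_0, H; ring. }
apply (f_equal snd) in Hz; unfold two_pi_i, Cmult, RtoC in Hz; simpl in Hz.
assert (E : INR k = IZR z * INR n).
{ apply Rmult_eq_reg_r with (2 * PI / INR n); [|apply Rgt_not_eq, Rdiv_lt_0_compat; lra].
  replace (IZR z * INR n * (2 * PI / INR n)) with (IZR z * (2 * PI)) by (field; lra); lra. }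
rewrite !INR_IZR_INZ, <- mult_IZR in E; apply eq_IZR in E.
exists (Z.to_nat z).
assert (0 <= z)%Z by nia.
apply Nat2Z.inj; rewrite Nat2Z.inj_mul, Z2Nat.id; trivial.
Qed.

(** [Im (mob M z) * |jfac M z| ^ 2 = Im z] gives [|jfac M z| ^ 2 <= 3], and the numerator
    [mob M z * jfac M z] is then bounded as well. The imaginary part of [x * z + v] controls [x],
    and then [v] follows. The range [y] to [3 * y] is that of a disc of radius [Im z0 / 2] with
    [y = Im z0 / 2]. *)
Lemma mob_entries_bounded M z (y Z : R) : mat_det M = 1 -> 0 < y -> y <= Im z <= 3 * y -> y <= Im (mob M z) ->
  Cmod z <= Z -> Cmod (mob M z) <= Z ->
  Rabs (mc M) <= 2 / y /\ Rabs (md M) <= 2 + 2 / y * Z /\ Rabs (ma M) <= 2 * Z / y /\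
  Rabs (mb M) <= 2 * Z + 2 * Z / y * Z.
Proof.
intros HM Hy Hz Hz' HZ HZ'.
assert (Hzz : inH z) by (unfold inH; lra).
assert (HIm := Im_mob M z HM Hzz); assert (Hj0 := jfac_neq_0 M z HM Hzz).
set (j := jfac M z) in *.
assert (Hj : Cmod j <= 2).
{ apply Rnot_lt_le; intros Hlt; assert (4 < Cmod j ^ 2) by (simpl; nra).
  assert (y * Cmod j ^ 2 <= Im (mob M z) * Cmod j ^ 2) by (apply Rmult_le_compat_r; lra).
  nra. }
assert (Gen : forall x v t, 0 < t -> Cmod (RtoC x * z + RtoC v)%C <= t -> Rabs x <= t / y /\ Rabs v <= t + t / y * Z).
{ intros x v t Ht H.
  assert (H1 := im_le_Cmod (RtoC x * z + RtoC v)%C).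
  replace (Im (RtoC x * z + RtoC v)%C) with (x * Im z) in H1
    by (destruct z as [a b]; unfold Im, Cplus, Cmult, RtoC; simpl; ring).
  rewrite Rabs_mult, (Rabs_pos_eq (Im z)) in H1 by lra.
  assert (Hx : Rabs x <= t / y) by (apply Rle_div_r; trivial; generalize (Rabs_pos x); nra).
  split; trivial; rewrite <- Cmod_R.
  replace (RtoC v) with ((RtoC x * z + RtoC v) - RtoC x * z)%C by ring.
  eapply Rle_trans; [apply Cmod_sub_le|]; rewrite Cmod_mult, Cmod_R.
  apply Rplus_le_compat; trivial; apply Rmult_le_compat; trivial; [apply Rabs_pos|apply Cmod_ge_0]. }
assert (HZ0 : 0 < Z) by (generalize (im_le_Cmod z) (Rle_abs (Im z)); lra).
destruct (Gen (mc M) (md M) 2) as [G1 G2]; [lra|exact Hj|].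
destruct (Gen (ma M) (mb M) (2 * Z)) as [G3 G4]; [lra| |].
{ replace (RtoC (ma M) * z + RtoC (mb M))%C with (mob M z * j)%C.
  - rewrite Cmod_mult; generalize (Cmod_ge_0 j) (Cmod_ge_0 (mob M z)); nra.
  - unfold mob; fold (jfac M z) j; field; trivial. }
repeat split; trivial.
Qed.

Lemma sl2_subseq (M : nat -> mat2) K : (forall n, mat_det (M n) = 1) ->
  (forall n, Rabs (ma (M n)) <= K /\ Rabs (mb (M n)) <= K /\ Rabs (mc (M n)) <= K /\ Rabs (md (M n)) <= K) ->
  exists phi N, (forall n, (n <= phi n)%nat) /\ mat_det N = 1 /\
    forall w, inH w -> Clim (fun n => mob (M (phi n)) w) (mob N w).
Proof.
intros HD HK.
destruct (bounded_subseq (fun n => ma (M n)) K) as [f1 [a [F1 La]]]; [intros n; apply HK|].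
destruct (bounded_subseq (fun n => mb (M (f1 n))) K) as [f2 [b [F2 Lb]]]; [intros n; apply HK|].
destruct (bounded_subseq (fun n => mc (M (f1 (f2 n)))) K) as [f3 [c [F3 Lc]]]; [intros n; apply HK|].
destruct (bounded_subseq (fun n => md (M (f1 (f2 (f3 n))))) K) as [f4 [d [F4 Ld]]]; [intros n; apply HK|].
set (phi := fun n => f1 (f2 (f3 (f4 n)))).
assert (La' : Clim (fun n => RtoC (ma (M (phi n)))) (RtoC a)).
{ apply (Clim_sub _ _ (fun n => f2 (f3 (f4 n))) La).
  intros n; specialize (F2 (f3 (f4 n))); specialize (F3 (f4 n)); specialize (F4 n); lia. }
assert (Lb' : Clim (fun n => RtoC (mb (M (phi n)))) (RtoC b)).
{ apply (Clim_sub _ _ (fun n => f3 (f4 n)) Lb); intros n; specialize (F3 (f4 n)); specialize (F4 n); lia. }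
assert (Lc' : Clim (fun n => RtoC (mc (M (phi n)))) (RtoC c)) by (apply (Clim_sub _ _ f4 Lc F4)).
exists phi, (Mat2 a b c d); split; [|assert (HN : mat_det (Mat2 a b c d) = 1); [|split; trivial]].
- intros n; unfold phi; specialize (F1 (f2 (f3 (f4 n)))); specialize (F2 (f3 (f4 n))); specialize (F3 (f4 n)); specialize (F4 n); lia.
- unfold mat_det; simpl; apply RtoC_inj.
  assert (L1 := Clim_plus _ _ _ _ (Clim_mult _ _ _ _ La' Ld) (Clim_mult _ _ _ _ (Clim_const (- (1))%C) (Clim_mult _ _ _ _ Lb' Lc'))).
  rewrite RtoC_minus, !RtoC_mult.
  transitivity (RtoC a * RtoC d + - (1) * (RtoC b * RtoC c))%C; [ring|].
  apply (Clim_unique _ _ _ L1).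
  intros e He; exists O; intros n _; cbv beta.
  specialize (HD (phi n)); unfold mat_det in HD; apply (f_equal RtoC) in HD; rewrite RtoC_minus, !RtoC_mult in HD.
  match goal with |- Cmod (?x - _)%C < _ => replace x with (RtoC 1) end; [rewrite Cmod_self; trivial|].
  etransitivity; [symmetry; exact HD|unfold phi; ring].
- intros w Hw.
  assert (Hj := jfac_neq_0 _ w HN Hw); unfold jfac in Hj; simpl in Hj.
  apply (Clim_mult _ _ _ _).
  + apply Clim_plus; [apply Clim_mult; [exact La'|apply Clim_const]|exact Lb'].
  + apply (Clim_cont Cinv).
    * apply (Cderiv_cont _ _ _ (Cderiv_inv (fun z => z) _ _ (Cderiv_id _) Hj)).
    * apply Clim_plus; [apply Clim_mult; [exact Lc'|apply Clim_const]|exact Ld].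
Qed.

(** * Fibres of [theta] and its order at a point *)

Section Theta.

Variables (p q : nat).
Hypothesis Hp : (2 <= p)%nat.
Hypothesis Hq : (2 <= q)%nat.
Variable theta : C -> C.
Hypothesis theta_hol : forall z, inH z -> Choloat theta z.
Hypothesis theta_inv : forall z, inH z ->
  theta (mob (A0 p) z) = theta z /\ theta (mob (B0 q) z) = theta z.
Hypothesis theta_inj : forall z1 z2, inH z1 -> inH z2 -> theta z1 = theta z2 -> Gamma_orb p q z1 z2.
Hypothesis theta_a : theta (pt_a p) = 0.
Hypothesis theta_b : theta (pt_b q) = 1.

Lemma theta_disc z : inH z -> holo_disc theta z (Im z).
Proof. intros Hz w Hw; apply theta_hol, (inH_disc z); trivial. Qed.

Lemma theta_word l z : inH z -> theta (mob (word p q l) z) = theta z.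
Proof.
assert (G : forall M k, mat_det M = 1 -> (forall z, inH z -> theta (mob M z) = theta z) ->
  forall z, inH z -> theta (mob (mpow M k) z) = theta z).
{ intros M k HM H; induction k as [|k IH]; intros w Hw; simpl; [rewrite mob_id; trivial|].
  rewrite mob_mul, H by (trivial; try apply inH_mob; trivial; apply mpow_det; trivial).
  apply IH; trivial. }
revert z; induction l as [|[i j] l IH]; intros z Hz; simpl; [rewrite mob_id; trivial|].
assert (DA := det_A p); assert (DB := det_B q).
assert (Dw := det_word p q l).
assert (D1 : mat_det (mpow (A0 p) i) = 1) by (apply mpow_det; trivial).
assert (D2 : mat_det (mpow (B0 q) j) = 1) by (apply mpow_det; trivial).
assert (D3 : mat_det (mat_mul (mpow (A0 p) i) (mpow (B0 q) j)) = 1) by (rewrite mat_det_mul, D1, D2; ring).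
assert (Hw : inH (mob (word p q l) z)) by (apply inH_mob; trivial).
rewrite mob_mul, mob_mul by trivial.
rewrite (G (A0 p)); trivial; [|intros w Hw'; apply theta_inv; trivial|apply inH_mob; trivial].
rewrite (G (B0 q)); trivial; [|intros w Hw'; apply theta_inv; trivial].
apply IH; trivial.
Qed.

(** Otherwise the identity theorem makes [theta] constant, against its values 0 and 1 at the two
    elliptic points. *)
Lemma theta_isolated z : inH z ->
  exists d, 0 < d /\ forall w, w <> z -> Cmod (w - z)%C < d -> theta w <> theta z.
Proof.
intros Hz; destruct (holo_isolated theta z (Im z) Hz (theta_disc z Hz)) as [H|H]; trivial.
exfalso.
assert (E1 := identity_theorem theta z (pt_a p) theta_hol Hz (pt_a_inH p Hp) H).
assert (E2 := identity_theorem theta z (pt_b q) theta_hol Hz (pt_b_inH q Hq) H).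
rewrite theta_a in E1; rewrite theta_b in E2; rewrite <- E1 in E2; apply RtoC_inj in E2; lra.
Qed.

Lemma theta_order z0 : inH z0 -> exists m g d, (0 < m)%nat /\ 0 < d <= Im z0 /\ holo_disc g z0 d /\ g z0 <> 0 /\
   forall z, Cmod (z - z0)%C < d -> theta z = (theta z0 + (z - z0) ^ m * g z)%C.
Proof.
intros Hz; destruct (holo_order theta z0 (Im z0) Hz (theta_disc z0 Hz)) as [[d [Hd H]]|H]; trivial.
exfalso; destruct (theta_isolated z0 Hz) as [d' [Hd' H']].
set (t := Rmin d d' / 2).
assert (0 < Rmin d d') by (apply Rmin_glb_lt; trivial).
assert (Et : Cmod (z0 + RtoC t - z0)%C = t).
{ replace (z0 + RtoC t - z0)%C with (RtoC t) by ring; rewrite Cmod_R, Rabs_pos_eq; unfold t; lra. }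
apply (H' (z0 + RtoC t)%C).
- intros E; rewrite E, Cmod_self in Et; unfold t in Et; lra.
- rewrite Et; unfold t; generalize (Rmin_r d d'); lra.
- apply H; rewrite Et; unfold t; generalize (Rmin_l d d'); lra.
Qed.

(* The group elements moving [u n] to [v n] stay in a compact part of SL_2(R), and by discreteness of the
   fibres of [theta] a convergent sequence of them is eventually constant in PSL_2(R). *)
Lemma common_word (u v : nat -> C) z0 : inH z0 ->
  (forall n, Cmod (u n - z0)%C <= Im z0 / 2) -> (forall n, Cmod (v n - z0)%C <= Im z0 / 2) ->
  (forall n, theta (u n) = theta (v n)) ->
  exists l phi, (forall n, (n <= phi n)%nat) /\ forall n, mob (word p q l) (u (phi n)) = v (phi n).
Proof.
intros Hz Hu Hv Huv; unfold inH in Hz.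
assert (Him : forall w, Cmod (w - z0)%C <= Im z0 / 2 -> Im z0 / 2 <= Im w <= 3 * (Im z0 / 2) /\ Cmod w <= Cmod z0 + Im z0).
{ intros w Hw; split.
  - assert (H := im_le_Cmod (w - z0)%C); change (Im (w - z0)%C) with (Im w + - Im z0) in H.
    apply Rabs_le_between in H; lra.
  - generalize (Cmod_sub_ge w z0); lra. }
assert (Hin : forall w, Cmod (w - z0)%C <= Im z0 / 2 -> inH w).
{ intros w Hw; generalize (Him w Hw); unfold inH; lra. }
assert (HL : forall n, {l | v n = mob (word p q l) (u n)}).
{ intros n; apply constructive_indefinite_description.
  apply Gamma_orb_word; auto. }
set (L := fun n => proj1_sig (HL n)).
assert (HL' : forall n, v n = mob (word p q (L n)) (u n)) by (intros n; exact (proj2_sig (HL n))).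
clearbody L; clear HL.
set (y := Im z0 / 2); set (Z := Cmod z0 + Im z0).
assert (HZ0 : 0 <= Z) by (unfold Z; generalize (Cmod_ge_0 z0); lra).
assert (Hy : 0 < y) by (unfold y; lra).
assert (H2y : 0 < 2 / y) by (apply Rdiv_lt_0_compat; lra).
assert (H2Z : 0 <= 2 * Z / y) by (apply Rmult_le_pos; [lra|apply Rlt_le, Rinv_0_lt_compat; trivial]).
set (K := 2 / y + (2 + 2 / y * Z) + 2 * Z / y + (2 * Z + 2 * Z / y * Z)).
assert (HM := fun n => det_word p q (L n)).
destruct (sl2_subseq (fun n => word p q (L n)) K) as [phi [N [Hphi [HN Hlim]]]]; trivial.
{ intros n.
  destruct (mob_entries_bounded (word p q (L n)) (u n) y Z) as [B1 [B2 [B3 B4]]]; trivial;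
    try (rewrite <- HL'); try apply Him; auto.
  assert (0 <= 2 / y * Z) by (apply Rmult_le_pos; lra).
  assert (0 <= 2 * Z / y * Z) by (apply Rmult_le_pos; lra).
  unfold K; repeat split; lra. }
assert (Hst : forall w, inH w -> exists n0, forall n, (n0 <= n)%nat -> mob (word p q (L (phi n))) w = mob N w).
{ intros w Hw; specialize (Hlim w Hw).
  assert (HNw : inH (mob N w)) by (apply inH_mob; trivial).
  assert (E : theta (mob N w) = theta w).
  { assert (C1 := Clim_cont theta _ _ (Choloat_cont _ _ (theta_hol _ HNw)) Hlim).
    apply (Clim_unique _ _ _ C1); intros e He; exists O; intros n _; cbv beta.
    rewrite theta_word, Cmod_self; trivial. }
  destruct (theta_isolated _ HNw) as [d [Hd H]].
  destruct (Hlim d Hd) as [n0 Hn0]; exists n0; intros n Hn; specialize (Hn0 n Hn).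
  apply NNPP; intros Hne; apply (H _ Hne Hn0); rewrite theta_word, E; trivial. }
assert (HCi : inH Ci) by (unfold inH, Im, Ci; simpl; lra).
assert (H2Ci : inH (2 * Ci)%C) by (unfold inH, Im, Ci, Cmult, RtoC; simpl; lra).
destruct (Hst _ HCi) as [n1 H1]; destruct (Hst _ H2Ci) as [n2 H2].
set (n0 := max n1 n2).
exists (L (phi n0)), (fun n => phi (n0 + n)%nat); split.
{ intros n; specialize (Hphi (n0 + n)%nat); lia. }
intros n; rewrite HL'; apply psl_mob; auto.
apply mob_two_points; trivial; [rewrite !H1 by lia|rewrite !H2 by lia]; reflexivity.
Qed.

(* With [theta = theta z0 + h ^ m] for a local coordinate [h], the points where [h = eps] and [h = zeta * eps] lie in
   one fibre for every [m]-th root of unity [zeta], hence in one orbit; as [eps -> 0] the group element is constant. *)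
Lemma order_multiplier z0 m g d : inH z0 -> (0 < m)%nat -> 0 < d <= Im z0 -> holo_disc g z0 d -> g z0 <> 0 ->
  (forall z, Cmod (z - z0)%C < d -> theta z = (theta z0 + (z - z0) ^ m * g z)%C) ->
  exists l, mob (word p q l) z0 = z0 /\ (/ (jfac (word p q l) z0 ^ 2))%C = cis (2 * PI / INR m).
Proof.
intros Hz Hm Hd Hg Hg0 Hth.
assert (Hmr : 0 < INR m) by (apply lt_0_INR; trivial).
assert (HmC : RtoC (INR m) <> 0) by (apply RtoC_neq_0; lra).
destruct (nth_root (g z0) m Hm Hg0) as [kap Hkap].
assert (Hk0 : kap <> 0).
{ intros ->; apply Hg0; rewrite <- Hkap; destruct m; [lia|]; rewrite Cpow_S; ring. }
destruct local_log as [dl [lg [Hdl [Hlg0 Hlg]]]].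
assert (Hc : continuous (fun z => g z / g z0)%C z0).
{ apply Choloat_cont, Choloat_div; [apply Hg; rewrite Cmod_self; lra|apply Choloat_const|trivial]. }
rewrite continuous_C in Hc; destruct (Hc dl Hdl) as [d1 [Hd1 H1]].
assert (E1 : (g z0 / g z0)%C = 1) by (field; trivial).
rewrite E1 in H1.
set (D1 := Rmin d (Rmin d1 (Im z0 / 2))).
unfold inH in Hz.
assert (HD1 : 0 < D1) by (repeat apply Rmin_glb_lt; lra).
assert (HDd : D1 <= d) by apply Rmin_l.
assert (HDd1 : D1 <= d1) by (eapply Rle_trans; [apply Rmin_r|apply Rmin_l]).
assert (HDi : D1 <= Im z0 / 2) by (eapply Rle_trans; [apply Rmin_r|apply Rmin_r]).
(* An [m]-th root of [g] near [z0], so that the local coordinate [h = (z - z0) * k] satisfies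
   [theta = theta z0 + h ^ m]. *)
set (k := fun z => (kap * Cexp (lg (g z / g z0)%C / RtoC (INR m)))%C).
assert (Hkm : forall z, Cmod (z - z0)%C < D1 -> (k z ^ m)%C = g z).
{ intros z Hzd; unfold k; rewrite Cpow_mult_l, Hkap, Cexp_pow.
  replace (RtoC (INR m) * (lg (g z / g z0)%C / RtoC (INR m)))%C with (lg (g z / g z0)%C) by (field; trivial).
  rewrite (proj1 (Hlg _ (H1 z (Rlt_le_trans _ _ _ Hzd HDd1)))); field; trivial. }
assert (Hkh : holo_disc k z0 D1).
{ intros z Hzd; apply Choloat_mult; [apply Choloat_const|].
  apply (Choloat_Cexp (fun z => lg (g z / g z0)%C / RtoC (INR m))%C).
  apply Choloat_div; [|apply Choloat_const|trivial].
  apply (Choloat_comp lg (fun z => g z / g z0)%C).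
  - apply Hlg, H1; lra.
  - apply Choloat_div; [apply Hg; lra|apply Choloat_const|trivial]. }
assert (Hkz : k z0 = kap).
{ unfold k; rewrite E1, Hlg0; replace (RtoC 0 / RtoC (INR m))%C with (RtoC 0) by (field; trivial).
  rewrite Cexp_0; ring. }
set (h := fun z => ((z - z0) * k z)%C).
assert (Hh : holo_disc h z0 D1).
{ intros z Hzd; apply Choloat_mult; [|apply Hkh; trivial].
  apply Choloat_minus; [apply Choloat_id|apply Choloat_const]. }
assert (Hh0 : h z0 = 0) by (unfold h; ring).
assert (Hhd : Cderiv h z0 kap).
{ destruct (Hkh z0) as [k' Hk']; [rewrite Cmod_self; trivial|].
  eapply Cderiv_val.
  - apply Cderiv_mult; [apply Cderiv_minus; [apply Cderiv_id|apply Cderiv_const]|exact Hk'].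
  - cbv beta; rewrite Hkz.
    replace (z0 - z0)%C with (RtoC 0) by ring; change (((1 - 0) * kap + 0 * k')%C = kap); ring. }
destruct (inverse_function h z0 D1 kap HD1 Hh Hhd Hk0) as [e1 [e2 [inv [He1 [He2 [Hinv0 [Hinv _]]]]]]].
rewrite Hh0 in Hinv, Hinv0.
assert (Hhm : forall z, Cmod (z - z0)%C < D1 -> theta z = (theta z0 + h z ^ m)%C).
{ intros z Hzd; rewrite Hth by lra; unfold h; rewrite Cpow_mult_l, Hkm; trivial. }
set (zeta := cis (2 * PI / INR m)).
assert (Hzm : (zeta ^ m)%C = 1).
{ unfold zeta; rewrite cis_pow; replace (INR m * (2 * PI / INR m)) with (2 * PI) by (field; lra); apply cis_2PI. }
assert (Hz1 : Cmod zeta = 1) by apply Cmod_cis.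
set (eps := fun n => RtoC (e1 * (/ 2) ^ S n)).
assert (Hp2 : forall n, 0 < (/ 2) ^ n) by (intros n; apply pow_lt; lra).
assert (Hp1 : forall n, (/ 2) ^ n <= 1).
{ intros n; rewrite <- (pow1 n); apply pow_incr; lra. }
assert (Hem : forall n, Cmod (eps n) = e1 * (/ 2) ^ S n).
{ intros n; unfold eps; rewrite Cmod_R, Rabs_pos_eq; trivial; apply Rmult_le_pos; [lra|apply Rlt_le; auto]. }
assert (Hes : forall n, Cmod (eps n) < e1).
{ intros n; rewrite Hem; simpl; specialize (Hp1 n); nra. }
assert (Hen : forall n, eps n <> 0).
{ intros n; apply Cmod_gt_0; rewrite Hem; apply Rmult_lt_0_compat; auto. }
assert (I0 : forall w, Cmod w < e1 -> Cmod (inv w - z0)%C < e2 /\ h (inv w) = w /\ Choloat inv w).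
{ intros w Hw; apply Hinv; replace (w - 0)%C with w by ring; trivial. }
assert (Hze : forall n, Cmod (zeta * eps n)%C < e1) by (intros n; rewrite Cmod_mult, Hz1, Rmult_1_l; auto).
destruct (common_word (fun n => inv (eps n)) (fun n => inv (zeta * eps n)%C) z0) as [l [phi [Hphi Hl]]]; trivial.
{ intros n; destruct (I0 _ (Hes n)) as [J _]; lra. }
{ intros n; destruct (I0 _ (Hze n)) as [J _]; lra. }
{ intros n; destruct (I0 _ (Hes n)) as [J1 [J2 _]]; destruct (I0 _ (Hze n)) as [J3 [J4 _]].
  rewrite (Hhm (inv (eps n))), (Hhm (inv (zeta * eps n)%C)), J2, J4, Cpow_mult_l, Hzm by lra; ring. }
assert (Hlim : Clim (fun n => eps (phi n)) 0).
{ apply (Clim_sub eps 0 phi); trivial; intros e He.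
  destruct (pow_half_small e1 e He) as [N HN]; exists N; intros n Hn.
  replace (eps n - 0)%C with (eps n) by ring; rewrite Hem; simpl.
  specialize (HN n Hn); specialize (Hp2 n); nra. }
assert (C0 : Cmod 0 < e1) by (rewrite Cmod_0; trivial).
destruct (I0 _ C0) as [_ [_ [i' Hi']]].
assert (Dw := det_word p q l).
assert (Hi1 : (i' * kap)%C = 1).
{ assert (X := Cderiv_comp h inv 0 kap i'); rewrite Hinv0 in X; specialize (X Hhd Hi').
  apply (Cderiv_ext_loc _ (fun w => w) _ _ e1 He1) in X.
  - exact (Cderiv_unique _ _ _ _ X (Cderiv_id _)).
  - intros w Hw; apply I0; replace w with (w - 0)%C by ring; trivial. }
assert (Hi0 : (i' : C) <> 0).
{ intros E; assert (Hi2 : (RtoC 0 * kap)%C = 1) by (rewrite <- Hi1, E; reflexivity).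
  replace (RtoC 0 * kap)%C with (RtoC 0) in Hi2 by ring; apply RtoC_inj in Hi2; lra. }
assert (Hfix : mob (word p q l) z0 = z0).
{ assert (C1 : continuous inv (RtoC 0)) by (apply (Cderiv_cont _ _ _ Hi')).
  assert (L1 := Clim_cont inv _ _ C1 Hlim); rewrite Hinv0 in L1.
  assert (L2 := Clim_cont _ _ _ (Cderiv_cont _ _ _ (mob_deriv _ z0 Dw Hz)) L1).
  assert (L3 : Clim (fun n => zeta * eps (phi n))%C 0).
  { replace (RtoC 0) with (zeta * 0)%C by ring; apply Clim_mult; [apply Clim_const|trivial]. }
  assert (L4 := Clim_cont inv _ _ C1 L3); rewrite Hinv0 in L4.
  apply (Clim_unique _ _ _ L2); intros e He; destruct (L4 e He) as [N HN]; exists N; intros n Hn.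
  rewrite Hl; auto. }
exists l; split; trivial.
(* In the coordinate [h] the group element agrees with multiplication by [zeta] along a sequence
   tending to 0. So [F] vanishes along that sequence, hence so does its derivative at 0, and the
   multiplier is [zeta]. *)
set (F := fun w => (mob (word p q l) (inv w) - inv (zeta * w))%C).
assert (HF : Cderiv F 0 (i' * / (jfac (word p q l) z0 ^ 2) - zeta * i')%C).
{ apply Cderiv_minus.
  - apply (Cderiv_comp (mob (word p q l)) inv); trivial.
    rewrite Hinv0; apply mob_deriv; trivial.
  - apply (Cderiv_comp inv (fun w => zeta * w)%C 0 i' zeta).
    + replace (zeta * 0)%C with (RtoC 0) by ring; trivial.
    + eapply Cderiv_val; [apply Cderiv_mult; [apply Cderiv_const|apply Cderiv_id]|cbv beta; ring]. }
assert (X : (i' * / (jfac (word p q l) z0 ^ 2) - zeta * i')%C = 0).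
{ apply (Cderiv_zero_seq F _ (fun n => eps (phi n)) 0); trivial.
  - unfold F; replace (zeta * 0)%C with (RtoC 0) by ring; rewrite Hinv0, Hfix; ring.
  - intros n; split; trivial; unfold F; rewrite Hl; ring. }
set (jj := (/ (jfac (word p q l) z0 ^ 2))%C) in *.
assert (X2 : (i' * (jj - zeta))%C = 0) by (rewrite <- X; ring).
apply Cmult_eq_0 in X2; destruct X2 as [X2|X2]; [contradiction|].
replace jj with ((jj - zeta) + zeta)%C by ring; rewrite X2; ring.
Qed.

(** The conjugate [N] of [X] fixes [z0] and preserves [theta]. With [N z - z0 = (z - z0) * D z],
    comparing leading terms of [theta (N z) = theta z] gives [D z0 ^ m = 1], where [D z0] is a
    primitive [n]-th root of unity. *)
Lemma multiplier_order X w n g z0 m g0 d :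
  mat_det X = 1 -> (forall z, inH z -> theta (mob X z) = theta z) -> inH w -> mob X w = w ->
  (/ (jfac X w ^ 2))%C = cis (2 * PI / INR n) -> (0 < n)%nat -> z0 = mob (word p q g) w ->
  inH z0 -> 0 < d <= Im z0 -> holo_disc g0 z0 d -> g0 z0 <> 0 ->
  (forall z, Cmod (z - z0)%C < d -> theta z = (theta z0 + (z - z0) ^ m * g0 z)%C) -> Nat.divide n m.
Proof.
intros HX HthX Hw HXw HXj Hn Hz0 Hz Hd Hg0 Hg00 Hth.
set (W := word p q g) in *.
assert (DW : mat_det W = 1) by apply det_word.
assert (DWi : mat_det (minv W) = 1) by (rewrite minv_det; trivial).
set (N := mat_mul W (mat_mul X (minv W))).
assert (DXW : mat_det (mat_mul X (minv W)) = 1) by (rewrite mat_det_mul, HX, DWi; ring).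
assert (DN : mat_det N = 1) by (unfold N; rewrite mat_det_mul, DXW, DW; ring).
assert (Ew : mob (minv W) z0 = w) by (rewrite Hz0; apply mob_minv_l; trivial).
assert (HN : mob N z0 = z0).
{ unfold N; rewrite !mob_mul, Ew, HXw by trivial; auto. }
assert (HthN : forall z, inH z -> theta (mob N z) = theta z).
{ intros z Hz'; assert (inH (mob (minv W) z)) by (apply inH_mob; trivial).
  unfold N; rewrite !mob_mul by trivial.
  unfold W at 1; rewrite theta_word by (apply inH_mob; trivial).
  rewrite HthX by trivial; rewrite <- (theta_word g (mob (minv W) z)) by trivial.
  fold W; rewrite mob_minv_r; trivial. }
assert (HNj : (/ (jfac N z0 ^ 2))%C = cis (2 * PI / INR n)).
{ rewrite <- HXj; f_equal.
  assert (J1 := jfac_mul N W w DW Hw); rewrite <- Hz0 in J1.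
  assert (J2 : jfac (mat_mul N W) w = (jfac W w * jfac X w)%C).
  { replace (mat_mul N W) with (mat_mul W X).
    - rewrite jfac_mul, HXw; trivial.
    - unfold N; rewrite <- !mat_mul_assoc, minv_l, mat_mul_id_r; trivial. }
  assert (JW := jfac_neq_0 W w DW Hw).
  replace (jfac N z0) with (jfac X w); [reflexivity|].
  transitivity ((jfac W w * jfac X w) / jfac W w)%C; [field; trivial|].
  rewrite <- J2, J1; field; trivial. }
assert (HND : holo_disc (mob N) z0 (Im z0)).
{ intros z Hz'; eexists; apply mob_deriv; trivial; apply (inH_disc z0); trivial. }
destruct (divided_difference (mob N) z0 (Im z0) z0 HND) as [D [HD1 [_ [HD3 HD4]]]].
{ rewrite Cmod_self; trivial. }
assert (ED : D z0 = cis (2 * PI / INR n)).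
{ rewrite <- HNj; apply (Cderiv_unique (mob N) z0); trivial; apply mob_deriv; trivial. }
assert (HNc := Cderiv_cont _ _ _ (mob_deriv N z0 DN Hz)).
assert (HNc' := HNc); rewrite continuous_C in HNc'; destruct (HNc' d (proj1 Hd)) as [d1 [Hd1 HN1]].
assert (Hgc : continuous g0 z0) by (apply Choloat_cont, Hg0; rewrite Cmod_self; lra).
assert (E : (D z0 ^ m * g0 (mob N z0))%C = g0 z0).
{ apply (cont_eq_punctured (fun z => D z ^ m * g0 (mob N z))%C g0 z0 (Rmin d d1)); trivial.
  - apply continuous_Cmult; [apply continuous_Cpow; trivial|].
    apply (continuous_comp (mob N) g0); trivial; rewrite HN; trivial.
  - apply Rmin_glb_lt; lra.
  - intros z Hne Hzd.
    assert (Z1 := Rlt_le_trans _ _ _ Hzd (Rmin_l _ _)); assert (Z2 := Rlt_le_trans _ _ _ Hzd (Rmin_r _ _)).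
    assert (Hzz : inH z) by (apply (inH_disc z0); trivial; lra).
    specialize (HN1 z Z2); rewrite HN in HN1.
    assert (T1 := Hth _ Z1); assert (T2 := Hth _ HN1); rewrite HthN, T1 in T2 by trivial.
    assert (Hnz : (z - z0)%C <> 0) by (apply Cmod_gt_0, Cmod_sub_pos; trivial).
    assert (Hnp : ((z - z0) ^ m)%C <> 0) by (apply Cpow_nz; trivial).
    assert (EN : (mob N z - z0)%C = ((z - z0) * D z)%C).
    { rewrite HD1, HN by trivial; field; trivial. }
    rewrite EN, Cpow_mult_l in T2.
    assert (T3 : ((z - z0) ^ m * (D z ^ m * g0 (mob N z)))%C = ((z - z0) ^ m * g0 z)%C).
    { transitivity ((theta z0 + (z - z0) ^ m * D z ^ m * g0 (mob N z)) - theta z0)%C; [ring|rewrite <- T2; ring]. }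
    transitivity (((z - z0) ^ m * (D z ^ m * g0 (mob N z))) / (z - z0) ^ m)%C; [field; trivial|].
    rewrite T3; field; trivial. }
rewrite HN, ED in E.
apply cis_pow_divide; trivial.
transitivity (cis (2 * PI / INR n) ^ m * g0 z0 / g0 z0)%C; [field; trivial|].
rewrite E; field; trivial.
Qed.

(** [order_multiplier] realizes a primitive [m]-th root of unity as a multiplier, and by
    [stabilizer] a multiplier other than 1 is a [p]-th or [q]-th root of unity and occurs only on
    the orbits of the elliptic points. *)
Lemma order_generic z0 m g d : inH z0 -> (0 < m)%nat -> 0 < d <= Im z0 -> holo_disc g z0 d -> g z0 <> 0 ->
  (forall z, Cmod (z - z0)%C < d -> theta z = (theta z0 + (z - z0) ^ m * g z)%C) ->
  Nat.divide m 1 \/ (theta z0 = 0 /\ Nat.divide m p) \/ (theta z0 = 1 /\ Nat.divide m q).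
Proof.
intros Hz Hm Hd Hg Hg0 Hth.
destruct (order_multiplier z0 m g d Hz Hm Hd Hg Hg0 Hth) as [l [Hl Hj]].
assert (Dw := det_word p q l); assert (J0 := jfac_neq_0 _ z0 Dw Hz).
assert (J2 : (jfac (word p q l) z0 ^ 2)%C <> 0) by (apply Cpow_nz; trivial).
assert (Inv : forall n, ((jfac (word p q l) z0 ^ 2) ^ n)%C = 1 -> (cis (2 * PI / INR m) ^ n)%C = 1).
{ intros n E; rewrite <- Hj, Cpow_inv, E by trivial; field; apply RtoC_neq_0; lra. }
destruct (Ceq_dec (jfac (word p q l) z0 ^ 2)%C 1) as [E|E].
- left; apply cis_pow_divide; trivial; apply Inv; rewrite E; simpl; ring.
- right; destruct (stabilizer p q Hp Hq l z0 Hz Hl E) as [[w [Hw Hw']]|[w [Hw Hw']]]; [left|right]; split.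
  + rewrite Hw, theta_word; trivial; apply pt_a_inH; trivial.
  + apply cis_pow_divide; trivial; apply Inv; trivial.
  + rewrite Hw, theta_word; trivial; apply pt_b_inH; trivial.
  + apply cis_pow_divide; trivial; apply Inv; trivial.
Qed.

Lemma theta_simple z0 : inH z0 -> theta z0 <> 0 -> theta z0 <> 1 ->
  forall l, Cderiv theta z0 l -> l <> 0.
Proof.
intros Hz H0 H1 l Hl; destruct (theta_order z0 Hz) as [m [g [d [Hm [Hd [Hg [Hg0 Hth]]]]]]].
destruct (order_generic z0 m g d Hz Hm Hd Hg Hg0 Hth) as [Hdiv|[[E _]|[E _]]]; try contradiction.
apply Nat.divide_1_r in Hdiv; subst m.
destruct (Hg z0) as [g' Hg']; [rewrite Cmod_self; lra|].
replace l with (g z0); trivial.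
apply (Cderiv_unique theta z0); trivial.
apply (Cderiv_ext_loc (fun z => theta z0 + (z - z0) ^ 1 * g z)%C) with d; [lra|intros w Hw; symmetry; auto|].
eapply Cderiv_val.
- apply Cderiv_plus; [apply Cderiv_const|]; apply Cderiv_mult; [|exact Hg'].
  apply (Cderiv_pow (fun z => z - z0)%C), Cderiv_minus; [apply Cderiv_id|apply Cderiv_const].
- simpl; change ((0 + (1 * (1 - 0) * 1 * g z0 + (z0 - z0) * 1 * g'))%C = g z0); ring.
Qed.

Lemma theta_order_elliptic X w n z0 : (2 <= n)%nat -> mat_det X = 1 ->
  (forall z, inH z -> theta (mob X z) = theta z) -> inH w -> mob X w = w -> jfac X w = cis (- (PI / INR n)) ->
  (forall m, theta w = 0 /\ Nat.divide m p \/ theta w = 1 /\ Nat.divide m q -> Nat.divide m n) ->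
  inH z0 -> theta z0 = theta w -> exists g d, 0 < d <= Im z0 /\ holo_disc g z0 d /\ g z0 <> 0 /\
   forall z, Cmod (z - z0)%C < d -> theta z = (theta z0 + (z - z0) ^ n * g z)%C.
Proof.
intros Hn HX HthX Hw HXw HXj Hdiv Hz H0.
destruct (theta_order z0 Hz) as [m [g [d [Hm [Hd [Hg [Hg0 Hth]]]]]]].
destruct (Gamma_orb_word p q Hp Hq w z0 Hw) as [l Hl]; [apply theta_inj; auto|].
assert (Hnm : Nat.divide n m).
{ apply (multiplier_order X w n l z0 m g d); trivial; [|lia].
  rewrite HXj, cis_opp; simpl.
  replace (2 * PI / INR n) with (PI / INR n + PI / INR n) by (field; apply not_0_INR; lia).
  rewrite cis_plus; field; apply cis_neq_0. }
assert (Hmn : m = n).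
{ apply Nat.divide_antisym; trivial.
  destruct (order_generic z0 m g d Hz Hm Hd Hg Hg0 Hth) as [H1|H1].
  - apply Nat.divide_trans with 1%nat; trivial; apply Nat.divide_1_l.
  - apply Hdiv; rewrite <- H0; trivial. }
subst m; exists g, d; split; [trivial|]; split; [trivial|]; split; trivial.
Qed.

Lemma theta_order_a z0 : inH z0 -> theta z0 = 0 -> exists g d, 0 < d <= Im z0 /\ holo_disc g z0 d /\ g z0 <> 0 /\
   forall z, Cmod (z - z0)%C < d -> theta z = (theta z0 + (z - z0) ^ p * g z)%C.
Proof.
intros Hz H0; apply (theta_order_elliptic (A0 p) (pt_a p)); trivial.
- apply det_A.
- intros z Hz'; apply theta_inv; trivial.
- apply pt_a_inH; trivial.
- apply mob_a; trivial.
- apply jfac_a.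
- intros m [[_ H]|[H _]]; trivial; elim zero_one_neq; congruence.
- congruence.
Qed.

Lemma theta_order_b z0 : inH z0 -> theta z0 = 1 -> exists g d, 0 < d <= Im z0 /\ holo_disc g z0 d /\ g z0 <> 0 /\
   forall z, Cmod (z - z0)%C < d -> theta z = (theta z0 + (z - z0) ^ q * g z)%C.
Proof.
intros Hz H0; apply (theta_order_elliptic (B0 q) (pt_b q)); trivial.
- apply det_B.
- intros z Hz'; apply theta_inv; trivial.
- apply pt_b_inH; trivial.
- apply mob_b; trivial.
- apply jfac_b.
- intros m [[H _]|[_ H]]; trivial; elim zero_one_neq; congruence.
- congruence.
Qed.

End Theta.

(** * The forms *)

Lemma Cderiv_lip (f : C -> C) z l B d : 0 < d ->
  (forall w, Cmod (w - z)%C < d -> Cmod (f w - f z)%C <= B * Cmod (w - z)%C) ->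
  Cderiv f z l -> Cmod l <= B.
Proof.
intros Hd HB Hl; apply Rnot_lt_le; intros Hlt; rewrite Cderiv_eps in Hl.
destruct (Hl ((Cmod l - B) / 2)) as [d1 [Hd1 H1]]; [lra|].
set (t := Rmin d d1 / 2).
assert (Hm : 0 < Rmin d d1) by (apply Rmin_glb_lt; trivial).
assert (Et : Cmod (z + RtoC t - z)%C = t).
{ replace (z + RtoC t - z)%C with (RtoC t) by ring; rewrite Cmod_R, Rabs_pos_eq; unfold t; lra. }
specialize (HB (z + RtoC t)%C); specialize (H1 (z + RtoC t)%C); rewrite Et in *.
specialize (HB ltac:(unfold t; generalize (Rmin_l d d1); lra)).
specialize (H1 ltac:(unfold t; generalize (Rmin_r d d1); lra)).
assert (A := Cmod_sub_ge ((z + RtoC t - z) * l)%C (f (z + RtoC t) - f z)%C).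
rewrite (Cmod_minus_sym ((z + RtoC t - z) * l)%C) in A; rewrite Cmod_mult, Et in A.
assert (0 < t) by (unfold t; lra); nra.
Qed.

(** [P = n * g + (z - z0) * g']. For continuity at [z0] it is enough that [g'] is bounded nearby,
    which strict differentiability gives. *)
Lemma deriv_order (f df g : C -> C) z0 c n d : (0 < n)%nat -> 0 < d -> holo_disc g z0 d ->
  (forall z, Cmod (z - z0)%C < d -> f z = (c + (z - z0) ^ n * g z)%C) ->
  (forall z, Cmod (z - z0)%C < d -> Cderiv f z (df z)) ->
  exists P : C -> C, continuous P z0 /\ P z0 = (RtoC (INR n) * g z0)%C /\
    forall z, Cmod (z - z0)%C < d -> df z = ((z - z0) ^ (n - 1) * P z)%C.
Proof.
intros Hn Hd Hg Hf Hdf.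
set (g1 := fun z => epsilon (inhabits (RtoC 0)) (fun l => Cderiv g z l)).
assert (Hg1 : forall z, Cmod (z - z0)%C < d -> Cderiv g z (g1 z)).
{ intros z Hz; apply (epsilon_spec (inhabits (RtoC 0)) (fun l => Cderiv g z l)).
  destruct (Hg z Hz) as [l Hl]; exists l; exact Hl. }
exists (fun z => RtoC (INR n) * g z + (z - z0) * g1 z)%C; split; [|split].
- destruct (holo_strict g z0 d Hd Hg) as [l [_ HS]].
  destruct (HS 1 Rlt_0_1) as [d1 [Hd1 H1]].
  set (B := Cmod l + 1).
  assert (HB0 : 0 < B) by (unfold B; generalize (Cmod_ge_0 l); lra).
  assert (HB : forall z, Cmod (z - z0)%C < d1 -> Cmod (g1 z) <= B).
  { intros z Hz; apply (Cderiv_lip g z (g1 z) B (d1 - Cmod (z - z0)%C)); [lra| |apply Hg1; lra].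
    intros w Hw.
    assert (Hw' : Cmod (w - z0)%C < d1) by (generalize (Cmod_triangle3 w z z0); lra).
    specialize (H1 w z Hw' Hz).
    replace (g w - g z)%C with ((g w - g z - (w - z) * l) + (w - z) * l)%C by ring.
    eapply Rle_trans; [apply Cmod_triangle|]; rewrite Cmod_mult; unfold B; lra. }
  apply (continuous_plus (V := C_NormedModule) (fun z => RtoC (INR n) * g z)%C (fun z => (z - z0) * g1 z)%C).
  + apply Choloat_cont, Choloat_mult; [apply Choloat_const|apply Hg; rewrite Cmod_self; trivial].
  + apply continuous_C; intros e He; exists (Rmin d1 (e / B)); split.
    * apply Rmin_glb_lt; [lra|apply Rdiv_lt_0_compat; trivial].
    * intros w Hw.
      assert (W1 := Rlt_le_trans _ _ _ Hw (Rmin_l _ _)); assert (W2 := Rlt_le_trans _ _ _ Hw (Rmin_r _ _)).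
      replace ((w - z0) * g1 w - (z0 - z0) * g1 z0)%C with ((w - z0) * g1 w)%C by ring.
      rewrite Cmod_mult; apply Rlt_div_r in W2; trivial.
      specialize (HB w W1); generalize (Cmod_ge_0 (w - z0)%C); nra.
- cbv beta; ring.
- intros z Hz; apply (Cderiv_unique f z); [auto|].
  apply (Cderiv_ext_loc (fun z => c + (z - z0) ^ n * g z)%C) with (d - Cmod (z - z0)%C); [lra| |].
  { intros w Hw; symmetry; apply Hf; generalize (Cmod_triangle3 w z z0); lra. }
  eapply Cderiv_val.
  + apply Cderiv_plus; [apply Cderiv_const|]; apply Cderiv_mult; [|apply Hg1; trivial].
    apply (Cderiv_pow (fun z => z - z0)%C), Cderiv_minus; [apply Cderiv_id|apply Cderiv_const].
  + cbv beta; destruct n as [|n]; [lia|]; replace (S n - 1)%nat with n by lia; rewrite Cpow_S; ring.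
Qed.

Section RootOrder.

Variables (f U V : C -> C) (z0 : C) (r k : nat) (d : R).
Hypothesis Hr : (0 < r)%nat.
Hypothesis Hd : 0 < d.
Hypothesis Hf : Choloat f z0.
Hypothesis HU : continuous U z0.
Hypothesis HV : continuous V z0.
Hypothesis HV0 : V z0 <> 0.

(** The powers of [z - z0] on both sides cancel, leaving [f ^ r * U = V] at [z0] by continuity. *)
Lemma root_order_0 :
  (forall z, Cmod (z - z0)%C < d -> (f z ^ r * ((z - z0) ^ k * U z))%C = ((z - z0) ^ k * V z)%C) -> f z0 <> 0.
Proof.
intros H E; apply HV0.
transitivity (f z0 ^ r * U z0)%C; [|rewrite E, Cpow_0_l by trivial; ring].
symmetry; apply (cont_eq_punctured (fun z => f z ^ r * U z)%C V z0 d); trivial.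
- apply continuous_Cmult; trivial; apply continuous_Cpow, Choloat_cont; trivial.
- intros z Hz Hzd; apply (Cmult_cancel ((z - z0) ^ k)%C).
  + apply Cpow_nz, Cmod_gt_0, Cmod_sub_pos; trivial.
  + rewrite <- H by trivial; ring.
Qed.

(** After cancellation [f ^ r] has order exactly [r], so [f] has a simple zero: dividing by
    [(z - z0) ^ r] gives [f'(z0) ^ r * U z0 = V z0]. *)
Lemma root_order_r :
  (forall z, Cmod (z - z0)%C < d -> (f z ^ r * ((z - z0) ^ k * U z))%C = ((z - z0) ^ (k + r) * V z)%C) ->
  U z0 <> 0 -> f z0 = 0 /\ forall l, Cderiv f z0 l -> l <> 0.
Proof.
intros H HU0.
assert (HfU : forall z, z <> z0 -> Cmod (z - z0)%C < d -> (f z ^ r * U z)%C = ((z - z0) ^ r * V z)%C).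
{ intros z Hz Hzd; apply (Cmult_cancel ((z - z0) ^ k)%C).
  + apply Cpow_nz, Cmod_gt_0, Cmod_sub_pos; trivial.
  + transitivity (f z ^ r * ((z - z0) ^ k * U z))%C; [ring|rewrite H, Cpow_add_r by trivial; ring]. }
assert (Hf0 : f z0 = 0).
{ apply (Cpow_eq_0 _ r); apply (Cmult_cancel (U z0)); trivial.
  transitivity (f z0 ^ r * U z0)%C; [ring|].
  transitivity ((z0 - z0) ^ r * V z0)%C.
  - apply (cont_eq_punctured (fun z => f z ^ r * U z)%C (fun z => (z - z0) ^ r * V z)%C z0 d); trivial.
    + apply continuous_Cmult; trivial; apply continuous_Cpow, Choloat_cont; trivial.
    + apply continuous_Cmult; trivial; apply continuous_Cpow, Choloat_cont, Choloat_minus; [apply Choloat_id|apply Choloat_const].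
  - replace (z0 - z0)%C with (RtoC 0) by ring; rewrite Cpow_0_l by trivial; ring. }
split; trivial; intros l Hl El; subst l.
apply HV0.
(* The quotient [f z / (z - z0)], extended by the derivative, which is assumed to be 0 in order to
   reach a contradiction. *)
set (D := fun z => if Ceq_dec z z0 then RtoC 0 else (f z / (z - z0))%C).
assert (HD0 : D z0 = 0) by (unfold D; destruct (Ceq_dec z0 z0); tauto).
assert (HDz : forall z, z <> z0 -> D z = (f z / (z - z0))%C) by (intros z Hz; unfold D; destruct (Ceq_dec z z0); tauto).
assert (HDc : continuous D z0).
{ apply continuous_C; intros e He; rewrite HD0.
  rewrite Cderiv_eps in Hl; destruct (Hl (e / 2)) as [d1 [Hd1 H1]]; [lra|].
  exists d1; split; trivial; intros w Hw.
  destruct (Ceq_dec w z0) as [->|Hne]; [rewrite HD0, Cmod_self; trivial|].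
  assert (Hp := Cmod_sub_pos _ _ Hne).
  assert (Hnz : (w - z0)%C <> 0) by (apply Cmod_gt_0; trivial).
  rewrite HDz by trivial; specialize (H1 w Hw); rewrite Hf0 in H1.
  replace (f w / (w - z0) - 0)%C with ((f w - 0 - (w - z0) * 0) / (w - z0))%C by (field; trivial).
  rewrite Cmod_div by trivial; apply Rle_lt_trans with (e / 2); [|lra]; apply Rle_div_l; trivial. }
transitivity (D z0 ^ r * U z0)%C; [|rewrite HD0, Cpow_0_l by trivial; ring].
symmetry; apply (cont_eq_punctured (fun z => D z ^ r * U z)%C V z0 d); trivial.
- apply continuous_Cmult; trivial; apply continuous_Cpow; trivial.
- intros z Hz Hzd.
  assert (Hnz : (z - z0)%C <> 0) by (apply Cmod_gt_0, Cmod_sub_pos; trivial).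
  apply (Cmult_cancel ((z - z0) ^ r)%C); [apply Cpow_nz; trivial|].
  rewrite <- HfU, HDz by trivial; unfold Cdiv; rewrite Cpow_mult_l, Cpow_inv by trivial.
  field; apply Cpow_nz; trivial.
Qed.

End RootOrder.

(** * Zeros of the three forms and the relations with [theta] *)

Section Forms.

Variables (p q : nat).
Hypothesis Hp : (2 <= p)%nat.
Hypothesis Hpq : (p < q)%nat.
Variables (theta dtheta fa fb finf : C -> C) (ca cb : C).
Hypothesis theta_der : forall z, inH z -> Cderiv theta z (dtheta z).
Hypothesis theta_inv : forall z, inH z ->
  theta (mob (A0 p) z) = theta z /\ theta (mob (B0 q) z) = theta z.
Hypothesis theta_inj : forall z1 z2, inH z1 -> inH z2 -> theta z1 = theta z2 -> Gamma_orb p q z1 z2.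
Hypothesis theta_a : theta (pt_a p) = 0.
Hypothesis theta_b : theta (pt_b q) = 1.
Hypothesis fa_hol : forall z, inH z -> Choloat fa z.
Hypothesis fb_hol : forall z, inH z -> Choloat fb z.
Hypothesis finf_hol : forall z, inH z -> Choloat finf z.
Hypothesis Hfa : forall z, inH z ->
  (fa z ^ rpq p q * (theta z * (theta z - RtoC 1) ^ (q - 1)))%C = (dtheta z ^ q)%C.
Hypothesis Hfb : forall z, inH z ->
  (fb z ^ rpq p q * (theta z ^ (p - 1) * (theta z - RtoC 1)))%C = (dtheta z ^ p)%C.
Hypothesis Hfinf : forall z, inH z ->
  (finf z ^ rpq p q * (theta z ^ ((p - 1) * q) * (theta z - RtoC 1) ^ (p * (q - 1))))%C = (dtheta z ^ (p * q))%C.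
Hypothesis Hca : ca <> 0.
Hypothesis Hcb : cb <> 0.
Hypothesis Hcacb : forall z, inH z -> finf z = (ca * fa z ^ p + cb * fb z ^ q)%C.

(** Positivity uses [p q >= 2 q], so that the truncated subtractions are genuine. The two identities
    compare the exponents of [finf] with those of [fa] and [fb], and also yield the orders at the
    elliptic points. *)
Lemma r_spec : (0 < rpq p q)%nat /\ ((p - 1) * q = p + rpq p q)%nat /\ (p * (q - 1) = q + rpq p q)%nat.
Proof.
unfold rpq; assert ((2 * q <= p * q)%nat) by (apply Nat.mul_le_mono_r; trivial).
rewrite Nat.mul_sub_distr_r, Nat.mul_sub_distr_l; lia.
Qed.

Lemma theta_hol z : inH z -> Choloat theta z.
Proof. intros Hz; exists (dtheta z); exact (theta_der z Hz). Qed.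

Lemma two_le_q : (2 <= q)%nat.
Proof. lia. Qed.

Lemma theta_m1 z : theta z <> 1 -> (theta z - RtoC 1)%C <> 0.
Proof. intros H; apply Cmod_gt_0, Cmod_sub_pos; trivial. Qed.

Lemma generic_nz z : inH z -> theta z <> 0 -> theta z <> 1 ->
  dtheta z <> 0 /\ fa z <> 0 /\ fb z <> 0 /\ finf z <> 0.
Proof.
intros Hz H0 H1.
destruct r_spec as [Hr0 _].
assert (Hd : dtheta z <> 0).
{ apply (theta_simple p q Hp two_le_q theta theta_hol theta_inv theta_inj theta_a theta_b z Hz H0 H1); auto. }
split; trivial; split; [|split]; intros E.
- apply (Cpow_nz (dtheta z) q Hd); rewrite <- Hfa, E, Cpow_0_l by trivial; ring.
- apply (Cpow_nz (dtheta z) p Hd); rewrite <- Hfb, E, Cpow_0_l by trivial; ring.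
- apply (Cpow_nz (dtheta z) (p * q) Hd); rewrite <- Hfinf, E, Cpow_0_l by trivial; ring.
Qed.

(** Counting orders where [theta - c] has order [n] and [dtheta] has order [n - 1]:
    [r * ord f0 + n = (n - 1) * e = n + r] gives a simple zero of [f0], and
    [r * ord f1 + (n - 1) * n = (n - 1) * n] gives none for [f1]. *)
Lemma forms_at_elliptic (f0 f1 U0 U1 : C -> C) (c : C) (n e : nat) z g d :
  (2 <= n)%nat -> ((n - 1) * e = n + rpq p q)%nat -> inH z -> theta z = c ->
  0 < d <= Im z -> holo_disc g z d -> g z <> 0 ->
  (forall w, Cmod (w - z)%C < d -> theta w = (theta z + (w - z) ^ n * g w)%C) ->
  Choloat f0 z -> Choloat f1 z -> continuous U0 z -> continuous U1 z -> U0 z <> 0 ->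
  (forall w, inH w -> (f0 w ^ rpq p q * ((theta w - c) * U0 w))%C = (dtheta w ^ e)%C) ->
  (forall w, inH w -> (f1 w ^ rpq p q * ((theta w - c) ^ (n - 1) * U1 w))%C = (dtheta w ^ n)%C) ->
  f0 z = 0 /\ (forall l, Cderiv f0 z l -> l <> 0) /\ f1 z <> 0.
Proof.
intros Hn Hne Hz Hc Hd Hg Hg0 Hth Hf0 Hf1 HU0 HU1 HU0z H0 H1.
destruct r_spec as [Hr0 _].
assert (HinH : forall w, Cmod (w - z)%C < d -> inH w) by (intros w Hw; apply (inH_disc z); trivial; lra).
assert (Hgc : continuous g z) by (apply Choloat_cont, Hg; rewrite Cmod_self; lra).
destruct (deriv_order theta dtheta g z (theta z) n d) as [P [HPc [HP0 HP]]]; trivial; try lia; try lra.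
{ intros w Hw; apply theta_der; auto. }
assert (HPz : P z <> 0).
{ rewrite HP0; apply Cmult_neq_0; trivial; apply RtoC_neq_0, not_0_INR; lia. }
assert (Hth' : forall w, Cmod (w - z)%C < d -> (theta w - c)%C = ((w - z) ^ n * g w)%C).
{ intros w Hw; rewrite Hth, Hc by trivial; ring. }
assert (R : f0 z = 0 /\ forall l, Cderiv f0 z l -> l <> 0).
{ apply (root_order_r f0 (fun w => g w * U0 w)%C (fun w => P w ^ e)%C z (rpq p q) n d); trivial.
  - lra.
  - apply continuous_Cmult; trivial.
  - apply continuous_Cpow; trivial.
  - apply Cpow_nz; trivial.
  - intros w Hw; transitivity (dtheta w ^ e)%C.
    + rewrite <- H0, (Hth' w Hw) by auto; ring.
    + rewrite HP, Cpow_mult_l, <- Cpow_mult_r, Hne by trivial; reflexivity.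
  - apply Cmult_neq_0; trivial. }
split; [apply R|]; split; [apply R|].
apply (root_order_0 f1 (fun w => g w ^ (n - 1) * U1 w)%C (fun w => P w ^ n)%C z (rpq p q) (n * (n - 1)) d); trivial.
- lra.
- apply continuous_Cmult; [apply continuous_Cpow|]; trivial.
- apply continuous_Cpow; trivial.
- apply Cpow_nz; trivial.
- intros w Hw; transitivity (dtheta w ^ n)%C.
  + rewrite <- H1, (Hth' w Hw), Cpow_mult_l, <- Cpow_mult_r by auto; ring.
  + rewrite HP, Cpow_mult_l, <- Cpow_mult_r by trivial; f_equal; f_equal; ring.
Qed.

Lemma forms_at_zero z : inH z -> theta z = 0 ->
  fa z = 0 /\ (forall l, Cderiv fa z l -> l <> 0) /\ fb z <> 0.
Proof.
intros Hz H0.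
destruct (theta_order_a p q Hp two_le_q theta theta_hol theta_inv theta_inj theta_a theta_b z Hz H0)
  as [g [d [Hd [Hg [Hg0 Hth]]]]].
assert (Hm : Choloat (fun w => theta w - RtoC 1)%C z) by (apply Choloat_minus; auto using theta_hol, Choloat_const).
apply (forms_at_elliptic fa fb (fun w => (theta w - RtoC 1) ^ (q - 1))%C (fun w => theta w - RtoC 1)%C 0 p q z g d); auto.
- apply r_spec.
- apply Choloat_cont, Choloat_pow; trivial.
- apply Choloat_cont; trivial.
- apply Cpow_nz, theta_m1; rewrite H0; apply zero_one_neq.
- intros w Hw; rewrite <- Hfa by trivial; ring.
- intros w Hw; replace (theta w - RtoC 0)%C with (theta w) by ring; auto.
Qed.

Lemma forms_at_one z : inH z -> theta z = 1 ->
  fb z = 0 /\ (forall l, Cderiv fb z l -> l <> 0) /\ fa z <> 0.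
Proof.
intros Hz H0.
destruct (theta_order_b p q Hp two_le_q theta theta_hol theta_inv theta_inj theta_a theta_b z Hz H0)
  as [g [d [Hd [Hg [Hg0 Hth]]]]].
destruct r_spec as [_ [_ Hr]].
apply (forms_at_elliptic fb fa (fun w => theta w ^ (p - 1))%C theta 1 q p z g d); auto.
- lia.
- rewrite Nat.mul_comm; trivial.
- apply Choloat_cont, Choloat_pow, theta_hol; trivial.
- apply Choloat_cont, theta_hol; trivial.
- apply Cpow_nz; rewrite H0; apply not_eq_sym, zero_one_neq.
- intros w Hw; rewrite <- Hfb by trivial; ring.
- intros w Hw; rewrite <- Hfa by trivial; ring.
Qed.

Lemma generic_nbhd z : inH z -> theta z <> 0 -> theta z <> 1 ->
  exists d, 0 < d /\ forall w, Cmod (w - z)%C < d -> inH w /\ theta w <> 0 /\ theta w <> 1.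
Proof.
intros Hz H0 H1.
assert (Hc := Choloat_cont _ _ (theta_hol z Hz)); rewrite continuous_C in Hc.
apply Cmod_sub_pos in H0; apply Cmod_sub_pos in H1.
destruct (Hc _ H0) as [d0 [Hd0 D0]]; destruct (Hc _ H1) as [d1 [Hd1 D1]].
exists (Rmin (Im z) (Rmin d0 d1)); split; [repeat apply Rmin_glb_lt; trivial|].
intros w Hw.
assert (W1 := Rlt_le_trans _ _ _ Hw (Rmin_l _ _)).
assert (W2 := Rlt_le_trans _ _ _ Hw (Rle_trans _ _ _ (Rmin_r _ _) (Rmin_l _ _))).
assert (W3 := Rlt_le_trans _ _ _ Hw (Rle_trans _ _ _ (Rmin_r _ _) (Rmin_r _ _))).
split; [apply (inH_disc z); trivial|]; split; intros E.
- specialize (D0 w W2); rewrite E, Cmod_minus_sym in D0; lra.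
- specialize (D1 w W3); rewrite E, Cmod_minus_sym in D1; lra.
Qed.

Lemma Cderiv_root_const (f : C -> C) z l n d : (0 < n)%nat -> 0 < d -> Cderiv f z l ->
  (forall w, Cmod (w - z)%C < d -> (f w ^ n)%C = 1) -> l = 0.
Proof.
intros Hn Hd Hl H.
assert (E : (RtoC (INR n) * l * f z ^ (n - 1))%C = 0).
{ apply (Cderiv_unique (fun w => f w ^ n)%C z); [apply Cderiv_pow; trivial|].
  apply (Cderiv_ext_loc (fun _ => RtoC 1) _ _ _ d Hd); [intros w Hw; symmetry; auto|apply Cderiv_const]. }
assert (Hfz : f z <> 0).
{ intros E0; specialize (H z); rewrite Cmod_self, E0, Cpow_0_l in H by trivial.
  apply zero_one_neq; auto. }
apply Cmult_eq_0 in E; destruct E as [E|E]; [|elim (Cpow_nz (f z) (n - 1) Hfz E)].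
apply Cmult_eq_0 in E; destruct E as [E|E]; trivial.
elim (RtoC_neq_0 (INR n)); trivial; apply not_0_INR; lia.
Qed.

(* [phi = fa^p / (theta finf)] and [psi = fb^q / ((theta - 1) finf)] are [r]-th roots of unity, so they have derivative 0;
   differentiating [ca phi theta + cb psi (theta - 1) = 1] determines them. *)
Lemma generic_relation z : inH z -> theta z <> 0 -> theta z <> 1 ->
  (ca * fa z ^ p)%C = (theta z * finf z)%C /\ (cb * fb z ^ q)%C = ((1 - theta z) * finf z)%C.
Proof.
intros Hz H0 H1.
destruct r_spec as [Hr0 [Hr1 Hr2]].
destruct (generic_nbhd z Hz H0 H1) as [d [Hd HN]].
destruct (generic_nz z Hz H0 H1) as [Dz [Az [Bz Fz]]].
assert (Mz := theta_m1 z H1).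
set (phi := fun w => (fa w ^ p / (finf w * theta w))%C).
set (psi := fun w => (fb w ^ q / (finf w * (theta w - RtoC 1)))%C).
assert (Hphi : forall w, Cmod (w - z)%C < d -> (phi w ^ rpq p q)%C = 1).
{ intros w Hw; destruct (HN w Hw) as [Hw1 [Hw2 Hw3]].
  destruct (generic_nz w Hw1 Hw2 Hw3) as [_ [A1 [B1 F1]]]; assert (M1 := theta_m1 w Hw3).
  unfold phi, Cdiv; rewrite Cpow_mult_l, Cpow_inv, Cpow_mult_l by (apply Cmult_neq_0; trivial).
  assert (E : ((fa w ^ p) ^ rpq p q)%C = (finf w ^ rpq p q * theta w ^ rpq p q)%C).
  { apply (Cmult_cancel (theta w ^ p * (theta w - RtoC 1) ^ (p * (q - 1)))%C).
    { apply Cmult_neq_0; apply Cpow_nz; trivial. }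
    transitivity (dtheta w ^ (p * q))%C.
    - rewrite (Nat.mul_comm p q), (Cpow_mult_r (dtheta w)), <- Hfa, !Cpow_mult_l, <- !Cpow_mult_r by trivial.
      rewrite (Nat.mul_comm (q - 1) p), (Nat.mul_comm (rpq p q) p); ring.
    - rewrite <- Hfinf, Hr1, Cpow_add_r by trivial; ring. }
  rewrite E; field; split; apply Cpow_nz; trivial. }
assert (Hpsi : forall w, Cmod (w - z)%C < d -> (psi w ^ rpq p q)%C = 1).
{ intros w Hw; destruct (HN w Hw) as [Hw1 [Hw2 Hw3]].
  destruct (generic_nz w Hw1 Hw2 Hw3) as [_ [A1 [B1 F1]]]; assert (M1 := theta_m1 w Hw3).
  unfold psi, Cdiv; rewrite Cpow_mult_l, Cpow_inv, Cpow_mult_l by (apply Cmult_neq_0; trivial).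
  assert (E : ((fb w ^ q) ^ rpq p q)%C = (finf w ^ rpq p q * (theta w - RtoC 1) ^ rpq p q)%C).
  { apply (Cmult_cancel (theta w ^ ((p - 1) * q) * (theta w - RtoC 1) ^ q)%C).
    { apply Cmult_neq_0; apply Cpow_nz; trivial. }
    transitivity (dtheta w ^ (p * q))%C.
    - rewrite (Cpow_mult_r (dtheta w)), <- Hfb, !Cpow_mult_l, <- !Cpow_mult_r by trivial.
      rewrite (Nat.mul_comm (rpq p q) q); ring.
    - rewrite <- Hfinf, Hr2, Cpow_add_r by trivial; ring. }
  rewrite E; field; split; apply Cpow_nz; trivial. }
assert (Hsum : forall w, Cmod (w - z)%C < d -> (ca * (phi w * theta w) + cb * (psi w * (theta w - RtoC 1)))%C = 1).
{ intros w Hw; destruct (HN w Hw) as [Hw1 [Hw2 Hw3]].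
  destruct (generic_nz w Hw1 Hw2 Hw3) as [_ [A1 [B1 F1]]]; assert (M1 := theta_m1 w Hw3).
  transitivity ((ca * fa w ^ p + cb * fb w ^ q) / finf w)%C.
  - unfold phi, psi; field; auto.
  - rewrite <- Hcacb by trivial; field; trivial. }
assert (Tz := theta_der z Hz).
destruct (Choloat_div (fun w => fa w ^ p)%C (fun w => finf w * theta w)%C z) as [phi' Hphi'].
{ apply Choloat_pow; auto. }
{ apply Choloat_mult; auto using theta_hol. }
{ apply Cmult_neq_0; trivial. }
destruct (Choloat_div (fun w => fb w ^ q)%C (fun w => finf w * (theta w - RtoC 1))%C z) as [psi' Hpsi'].
{ apply Choloat_pow; auto. }
{ apply Choloat_mult; auto; apply Choloat_minus; auto using theta_hol, Choloat_const. }
{ apply Cmult_neq_0; trivial. }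
assert (Ephi := Cderiv_root_const phi z phi' (rpq p q) d Hr0 Hd Hphi' Hphi).
assert (Epsi := Cderiv_root_const psi z psi' (rpq p q) d Hr0 Hd Hpsi' Hpsi).
(* Since [phi] and [psi] have derivative 0, only [theta] contributes to the derivative of the sum,
   and [dtheta z] is nonzero at a generic point. *)
assert (E : ((ca * phi z + cb * psi z) * dtheta z)%C = 0).
{ apply (Cderiv_unique (fun w => ca * (phi w * theta w) + cb * (psi w * (theta w - RtoC 1)))%C z).
  - rewrite Ephi in Hphi'; rewrite Epsi in Hpsi'; eapply Cderiv_val.
    + apply Cderiv_plus; (apply Cderiv_mult; [apply Cderiv_const|]); apply Cderiv_mult.
      * exact Hphi'.
      * exact Tz.
      * exact Hpsi'.
      * apply Cderiv_minus; [exact Tz|apply Cderiv_const].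
    + cbv beta; ring.
  - apply (Cderiv_ext_loc (fun _ => RtoC 1) _ _ _ d Hd); [intros w Hw; symmetry; auto|apply Cderiv_const]. }
apply Cmult_eq_0 in E; destruct E as [E|E]; [|contradiction].
assert (Sz := Hsum z ltac:(rewrite Cmod_self; trivial)).
assert (E1 : (ca * phi z)%C = 1).
{ transitivity ((ca * (phi z * theta z) + cb * (psi z * (theta z - RtoC 1))) - (ca * phi z + cb * psi z) * (theta z - RtoC 1))%C; [ring|].
  rewrite Sz, E; ring. }
assert (E2 : (cb * psi z)%C = (- (1))%C).
{ transitivity ((ca * phi z + cb * psi z) - ca * phi z)%C; [ring|rewrite E, E1; ring]. }
split.
- transitivity ((ca * phi z) * (finf z * theta z))%C; [unfold phi; field; auto|rewrite E1; ring].
- transitivity ((cb * psi z) * (finf z * (theta z - RtoC 1)))%C; [unfold psi; field; auto|rewrite E2; ring].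
Qed.

Lemma form_relation z : inH z ->
  (ca * fa z ^ p)%C = (theta z * finf z)%C /\ (cb * fb z ^ q)%C = ((1 - theta z) * finf z)%C.
Proof.
intros Hz.
destruct (Ceq_dec (theta z) 0) as [E|H0].
{ destruct (forms_at_zero z Hz E) as [A _].
  rewrite Hcacb, A, Cpow_0_l, E by (trivial; lia); split; ring. }
destruct (Ceq_dec (theta z) 1) as [E|H1].
{ destruct (forms_at_one z Hz E) as [A _].
  rewrite Hcacb, A, Cpow_0_l, E by (trivial; lia); split; ring. }
apply generic_relation; trivial.
Qed.

Lemma finf_nz z : inH z -> finf z <> 0.
Proof.
intros Hz.
destruct (Ceq_dec (theta z) 0) as [E|H0].
{ destruct (forms_at_zero z Hz E) as [A [_ B]]; intros F; apply (Cpow_nz (fb z) q B), (Cmult_cancel cb); trivial.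
  rewrite (proj2 (form_relation z Hz)), F; ring. }
destruct (Ceq_dec (theta z) 1) as [E|H1].
{ destruct (forms_at_one z Hz E) as [A [_ B]]; intros F; apply (Cpow_nz (fa z) p B), (Cmult_cancel ca); trivial.
  rewrite (proj1 (form_relation z Hz)), F; ring. }
apply generic_nz; trivial.
Qed.

(** Logarithmic differentiation of [cb fb^q theta = ca fa^p (1 - theta)] gives the Wronskian as
    [fa fb dtheta / (theta (1 - theta))] at generic points. Over 0 and 1 one form has a simple zero
    and the other none, so exactly one of the two terms survives. *)
Lemma wronskian_nz z a b : inH z -> Cderiv fa z a -> Cderiv fb z b ->
  (RtoC (INR p) * a * fb z - RtoC (INR q) * fa z * b)%C <> 0.
Proof.
intros Hz Ha Hb.
assert (HpC : RtoC (INR p) <> 0) by (apply RtoC_neq_0, not_0_INR; lia).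
assert (HqC : RtoC (INR q) <> 0) by (apply RtoC_neq_0, not_0_INR; lia).
destruct (Ceq_dec (theta z) 0) as [E|H0].
{ destruct (forms_at_zero z Hz E) as [A [B D]]; specialize (B a Ha); rewrite A.
  replace (RtoC (INR p) * a * fb z - RtoC (INR q) * 0 * b)%C with (RtoC (INR p) * a * fb z)%C by ring.
  repeat apply Cmult_neq_0; trivial. }
destruct (Ceq_dec (theta z) 1) as [E|H1].
{ destruct (forms_at_one z Hz E) as [A [B D]]; specialize (B b Hb); rewrite A.
  replace (RtoC (INR p) * a * 0 - RtoC (INR q) * fa z * b)%C with (- RtoC (INR q) * fa z * b)%C by ring.
  repeat apply Cmult_neq_0; trivial.
  intros En; apply HqC; transitivity (- - RtoC (INR q))%C; [ring|rewrite En; ring]. }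
destruct (generic_nz z Hz H0 H1) as [Dz [Az [Bz Fz]]].
destruct (form_relation z Hz) as [R1 R2].
assert (Hrel : forall w, Cmod (w - z)%C < Im z -> (cb * fb w ^ q * theta w)%C = (ca * fa w ^ p * (1 - theta w))%C).
{ intros w Hw; destruct (form_relation w (inH_disc z w Hz Hw)) as [-> ->]; ring. }
assert (D1 : Cderiv (fun w => cb * fb w ^ q * theta w)%C z
   (cb * (RtoC (INR q) * b * fb z ^ (q - 1)) * theta z + cb * fb z ^ q * dtheta z)%C).
{ eapply Cderiv_val.
  - apply Cderiv_mult; [apply Cderiv_mult; [apply Cderiv_const|apply Cderiv_pow; exact Hb]|auto].
  - cbv beta; ring. }
assert (D2 : Cderiv (fun w => ca * fa w ^ p * (1 - theta w))%C z
   (ca * (RtoC (INR p) * a * fa z ^ (p - 1)) * (1 - theta z) - ca * fa z ^ p * dtheta z)%C).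
{ eapply Cderiv_val.
  - apply Cderiv_mult; [apply Cderiv_mult; [apply Cderiv_const|apply Cderiv_pow; exact Ha]|].
    apply Cderiv_minus; [apply Cderiv_const|auto].
  - cbv beta; ring. }
apply (Cderiv_ext_loc _ _ _ _ (Im z) Hz Hrel) in D1.
assert (E := Cderiv_unique _ _ _ _ D1 D2).
assert (Xq : (fb z ^ q)%C = (fb z * fb z ^ (q - 1))%C).
{ rewrite <- Cpow_S; f_equal; lia. }
assert (Xp : (fa z ^ p)%C = (fa z * fa z ^ (p - 1))%C).
{ rewrite <- Cpow_S; f_equal; lia. }
intros W.
assert (K : (finf z * dtheta z * fa z * fb z)%C = 0).
{ transitivity ((finf z * (1 - theta z) * theta z) * (RtoC (INR p) * a * fb z - RtoC (INR q) * fa z * b))%C; [|rewrite W; ring].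
  transitivity (RtoC (INR p) * a * (ca * fa z ^ p) * fb z * (1 - theta z) - RtoC (INR q) * b * (cb * fb z ^ q) * fa z * theta z)%C; [|rewrite R1, R2; ring].
  transitivity ((theta z * finf z + (1 - theta z) * finf z) * dtheta z * fa z * fb z)%C; [ring|].
  rewrite <- R1, <- R2.
  transitivity (fa z * fb z * (ca * (RtoC (INR p) * a * fa z ^ (p - 1)) * (1 - theta z)) - fa z * fb z * (cb * (RtoC (INR q) * b * fb z ^ (q - 1)) * theta z))%C;
    [|rewrite Xp, Xq; ring].
  transitivity (fa z * fb z * ((cb * (RtoC (INR q) * b * fb z ^ (q - 1)) * theta z + cb * fb z ^ q * dtheta z) + ca * fa z ^ p * dtheta z
     - cb * (RtoC (INR q) * b * fb z ^ (q - 1)) * theta z))%C; [ring|rewrite E; ring]. }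
revert K; repeat apply Cmult_neq_0; trivial.
Qed.

End Forms.

(** * Roots of unity depending continuously on a point, and coprime powers *)

(** The power map is injective near 1 by the lower bound of [inverse_function]; division by [y],
    which has modulus 1, moves any pair of roots there without changing their distance. *)
Lemma roots_separated n : (0 < n)%nat -> exists e, 0 < e /\
  forall x y, (x ^ n)%C = 1 -> (y ^ n)%C = 1 -> Cmod (x - y)%C < e -> x = y.
Proof.
intros Hn.
destruct (inverse_function (fun z => z ^ n)%C 1 1 (RtoC (INR n))) as [d [e [k [_ [He [_ [_ Hlow]]]]]]].
- lra.
- intros z _; apply Choloat_pow, Choloat_id.
- eapply Cderiv_val; [apply (Cderiv_pow (fun z => z)), Cderiv_id|cbv beta; rewrite Cpow_1_l; ring].
- apply RtoC_neq_0, not_0_INR; lia.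
- assert (Hnn : 0 < INR n) by (apply lt_0_INR; trivial).
  rewrite Cmod_R, Rabs_pos_eq in Hlow by lra.
  exists e; split; [lra|]; intros x y Hx Hy Hxy.
  assert (Hy0 : y <> 0).
  { intros ->; rewrite Cpow_0_l in Hy by trivial; apply zero_one_neq; trivial. }
  assert (Hym : Cmod y = 1).
  { assert (E : Cmod y ^ n = 1) by (rewrite <- Cmod_pow, Hy; apply Cmod_1).
    destruct (Rtotal_order (Cmod y) 1) as [H|[H|H]]; trivial.
    - generalize (pow_lt_1_compat (Cmod y) n (conj (Cmod_ge_0 y) H) Hn); lra.
    - generalize (Rlt_pow_R1 (Cmod y) n H Hn); lra. }
  set (w := (x / y)%C).
  assert (Hw : (w ^ n)%C = 1).
  { unfold w, Cdiv; rewrite Cpow_mult_l, Cpow_inv, Hx, Hy by trivial; field; apply RtoC_neq_0; lra. }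
  assert (Hw1 : Cmod (w - 1)%C < e).
  { replace (w - 1)%C with ((x - y) / y)%C by (unfold w; field; trivial).
    rewrite Cmod_div, Hym by trivial; lra. }
  specialize (Hlow w 1 Hw1 ltac:(rewrite Cmod_self; lra)).
  rewrite Hw, Cpow_1_l, Cmod_self in Hlow.
  assert (Ew : w = 1).
  { apply Cmod_sub_0; generalize (Cmod_ge_0 (w - 1)%C); nra. }
  transitivity (w * y)%C; [unfold w; field; trivial|rewrite Ew; ring].
Qed.

(** By separation of the roots [F] is locally constant along the segment joining the points, so its
    derivative there is 0 and integrates to 0. *)
Lemma roots_const (F : C -> C) n z w : (0 < n)%nat -> (forall z, inH z -> continuous F z) ->
  (forall z, inH z -> (F z ^ n)%C = 1) -> inH z -> inH w -> F z = F w.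
Proof.
intros Hn Hc H1 Hz Hw; destruct (roots_separated n Hn) as [e [He Hsep]].
assert (Hd : forall t, 0 <= t <= 1 -> RCderiv (fun s => F (seg z w s)) t 0).
{ intros t Ht; assert (Ht' : inH (seg z w t)) by (apply inH_seg; trivial).
  assert (C1 := seg_cont F z w t (Hc _ Ht')).
  assert (C2 := proj1 (continuous_RC _ _) (RCderiv_cont _ _ _ (RCderiv_seg z w t))).
  destruct (C2 _ Ht') as [d2 [Hd2 D2]].
  rewrite continuous_RC in C1; destruct (C1 e He) as [d1 [Hd1 D1]].
  apply RCderiv_eps; intros e' He'; exists (Rmin d1 d2); split; [apply Rmin_glb_lt; trivial|].
  intros s Hs.
  assert (S1 := Rlt_le_trans _ _ _ Hs (Rmin_l _ _)); assert (S2 := Rlt_le_trans _ _ _ Hs (Rmin_r _ _)).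
  assert (Hs' : inH (seg z w s)) by (apply (inH_disc _ _ Ht'), D2; trivial).
  rewrite (Hsep (F (seg z w s)) (F (seg z w t))) by auto.
  replace (F (seg z w t) - F (seg z w t) - RtoC (s - t) * 0)%C with (RtoC 0) by ring.
  rewrite Cmod_0; apply Rmult_le_pos; [lra|apply Rabs_pos]. }
assert (I1 : isI (fun _ => RtoC 0) 0 1 (F (seg z w 1) - F (seg z w 0))%C).
{ apply (isI_FTC (fun s => F (seg z w s))); [lra|trivial|intros; apply continuous_const]. }
assert (I2 := isI_const 0 0 1); assert (E := isI_unique _ _ _ _ _ I1 I2).
rewrite seg_0, seg_1 in E.
transitivity (F w - (F w - F z))%C; [ring|rewrite E; ring].
Qed.

(** With [a * m = b * n + 1] both numbers are recovered as [x ^ (a * m) / x ^ (b * n)]. *)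
Lemma coprime_powers (x y : C) m n : Nat.gcd m n = 1%nat -> (0 < m)%nat -> (0 < n)%nat ->
  (x ^ m)%C = (y ^ m)%C -> (x ^ n)%C = (y ^ n)%C -> x = y.
Proof.
intros Hg Hm Hn E1 E2.
destruct (Ceq_dec x 0) as [->|Hx].
{ symmetry; apply (Cpow_eq_0 _ m); rewrite <- E1; apply Cpow_0_l; trivial. }
destruct (Nat.gcd_bezout_pos m n Hm) as [a [b Hab]]; rewrite Hg in Hab.
apply (Cmult_cancel (x ^ (b * n))%C); [apply Cpow_nz; trivial|].
transitivity (x ^ (a * m))%C.
- rewrite Hab, Cpow_add_r; simpl; ring.
- rewrite Nat.mul_comm, Cpow_mult_r, E1, <- Cpow_mult_r, Nat.mul_comm, Hab, Cpow_add_r.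
  rewrite (Nat.mul_comm b n), !Cpow_mult_r, E2; simpl; ring.
Qed.

(** * Iterates of a lift acting on pairs *)

Lemma lift_act_comp g2 g1 x : mat_det (lmat g2) = 1 -> mat_det (lmat g1) = 1 -> inH (fst x) ->
  lift_act (lift_comp g2 g1) x = lift_act g2 (lift_act g1 x).
Proof.
intros H2 H1 Hx; unfold lift_act, lift_comp; simpl; rewrite mob_mul by trivial; f_equal; ring.
Qed.

Lemma lmat_pow g n : lmat (lift_pow g n) = mpow (lmat g) n.
Proof. induction n as [|n IH]; simpl; [reflexivity|rewrite IH; reflexivity]. Qed.

Lemma inH_iter g n x : mat_det (lmat g) = 1 -> inH (fst x) -> inH (fst (Nat.iter n (lift_act g) x)).
Proof. intros H Hx; induction n as [|n IH]; simpl; trivial; apply inH_mob; trivial. Qed.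

Lemma lift_act_pow g n x : mat_det (lmat g) = 1 -> inH (fst x) ->
  lift_act (lift_pow g n) x = Nat.iter n (lift_act g) x.
Proof.
intros H Hx; induction n as [|n IH]; simpl.
- unfold lift_act; simpl; rewrite mob_id, Cplus_0_l; destruct x; reflexivity.
- rewrite lift_act_comp, IH; trivial; rewrite lmat_pow; apply mpow_det; trivial.
Qed.

Lemma iter_mul {T} (f : T -> T) m n x : Nat.iter (m * n) f x = Nat.iter m (Nat.iter n f) x.
Proof. induction m as [|m IH]; simpl; [reflexivity|rewrite Nat.iter_add, IH; reflexivity]. Qed.

Lemma form_act k f g x :
  form k f (lift_act g x) = (f (mob (lmat g) (fst x)) * Cexp (RtoC k * llog g (fst x)) * Cexp (RtoC k * snd x))%C.
Proof.
unfold form, lift_act; simpl.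
replace (RtoC k * (llog g (fst x) + snd x))%C with (RtoC k * llog g (fst x) + RtoC k * snd x)%C by ring.
rewrite Cexp_plus; ring.
Qed.

(** * Invariance of the forms under the [r]-th power of a lift preserving [theta] *)

Section Invariance.

Variables (r : nat) (theta dtheta : C -> C) (g : lift).
Hypothesis Hr : (0 < r)%nat.
Hypothesis theta_der : forall z, inH z -> Cderiv theta z (dtheta z).
Hypothesis theta_iso : forall z, inH z ->
  exists d, 0 < d /\ forall w, w <> z -> Cmod (w - z)%C < d -> theta w <> theta z.
Hypothesis Hg : is_lift g.
Hypothesis theta_g : forall z, inH z -> theta (mob (lmat g) z) = theta z.

Lemma generic_punctured z : inH z -> exists d, 0 < d /\
  forall w, w <> z -> Cmod (w - z)%C < d -> inH w /\ theta w <> 0 /\ theta w <> 1.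
Proof.
intros Hz.
assert (Av : forall c, exists d, 0 < d /\ forall w, w <> z -> Cmod (w - z)%C < d -> theta w <> c).
{ intros c; destruct (Ceq_dec (theta z) c) as [<-|Hne]; [apply theta_iso; trivial|].
  assert (Hc := Cderiv_cont _ _ _ (theta_der z Hz)); rewrite continuous_C in Hc.
  apply Cmod_sub_pos in Hne; destruct (Hc _ Hne) as [d [Hd H]]; exists d; split; trivial.
  intros w _ Hw E; specialize (H w Hw); rewrite E, Cmod_minus_sym in H; lra. }
destruct (Av 0) as [d0 [Hd0 D0]]; destruct (Av 1) as [d1 [Hd1 D1]].
exists (Rmin (Im z) (Rmin d0 d1)); split; [repeat apply Rmin_glb_lt; trivial|].
intros w Hne Hw.
assert (W1 := Rlt_le_trans _ _ _ Hw (Rmin_l _ _)).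
assert (W2 := Rlt_le_trans _ _ _ Hw (Rle_trans _ _ _ (Rmin_r _ _) (Rmin_l _ _))).
assert (W3 := Rlt_le_trans _ _ _ Hw (Rle_trans _ _ _ (Rmin_r _ _) (Rmin_r _ _))).
split; [apply (inH_disc z); trivial|auto].
Qed.

Lemma lift_det : mat_det (lmat g) = 1.
Proof. apply Hg. Qed.

Lemma dtheta_chain z : inH z -> (dtheta (mob (lmat g) z) * Cexp (llog g z))%C = dtheta z.
Proof.
intros Hz; rewrite (proj2 (proj2 Hg z Hz)).
assert (D1 := Cderiv_comp theta (mob (lmat g)) z _ _ (theta_der _ (inH_mob _ z lift_det Hz)) (mob_deriv _ z lift_det Hz)).
rewrite Cmult_comm; apply (Cderiv_unique theta z); [|auto].
apply (Cderiv_ext_loc (fun w => theta (mob (lmat g) w)) _ _ _ (Im z)); trivial.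
intros w Hw; apply theta_g, (inH_disc z); trivial.
Qed.

Lemma transform_cont (f : C -> C) (c : C) z : (forall z, inH z -> Choloat f z) -> inH z ->
  continuous (fun w => f (mob (lmat g) w) * Cexp (c * llog g w))%C z.
Proof.
intros Hf Hz; apply continuous_Cmult.
- apply (continuous_comp (mob (lmat g)) f).
  + apply (Cderiv_cont _ _ _ (mob_deriv _ z lift_det Hz)).
  + apply Choloat_cont, Hf, inH_mob; trivial; apply lift_det.
- apply (continuous_comp (llog g) (fun u => Cexp (c * u))%C).
  + apply Hg; trivial.
  + apply Choloat_cont, Choloat_Cexp, Choloat_mult; [apply Choloat_const|apply Choloat_id].
Qed.

(** The chain rule for [dtheta] gives the identity multiplied by [Q (theta z)], a factor that may
    vanish over 0 and 1; these isolated points are reached by continuity. *)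
Lemma transform_pow (f Q : C -> C) k z : (forall z, inH z -> Choloat f z) ->
  (forall t, t <> RtoC 0 -> t <> RtoC 1 -> Q t <> 0) ->
  (forall z, inH z -> (f z ^ r * Q (theta z))%C = (dtheta z ^ k)%C) -> inH z ->
  ((f (mob (lmat g) z) * Cexp (RtoC (INR k / INR r) * llog g z)) ^ r)%C = (f z ^ r)%C.
Proof.
intros Hf HQ H Hz.
destruct (generic_punctured z Hz) as [d [Hd HN]].
apply (cont_eq_punctured (fun z => (f (mob (lmat g) z) * Cexp (RtoC (INR k / INR r) * llog g z)) ^ r)%C (fun z => f z ^ r)%C z d); trivial.
- apply continuous_Cpow, transform_cont; trivial.
- apply continuous_Cpow, Choloat_cont; auto.
- intros w Hne Hw; destruct (HN w Hne Hw) as [W1 [W2 W3]].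
  assert (HQw := HQ _ W2 W3).
  apply (Cmult_cancel (Q (theta w))); trivial.
  assert (Hmw : inH (mob (lmat g) w)) by (apply inH_mob; trivial; apply lift_det).
  assert (H1 := H _ Hmw); rewrite theta_g in H1 by trivial.
  assert (Hr0 : INR r <> 0) by (apply not_0_INR; lia).
  rewrite Cpow_mult_l, Cexp_pow.
  replace (RtoC (INR r) * (RtoC (INR k / INR r) * llog g w))%C with (RtoC (INR k) * llog g w)%C.
  2:{ rewrite RtoC_div by trivial; field; apply RtoC_neq_0; trivial. }
  rewrite <- Cexp_pow.
  transitivity (f (mob (lmat g) w) ^ r * Q (theta w) * Cexp (llog g w) ^ k)%C; [ring|].
  rewrite H1, <- Cpow_mult_l, dtheta_chain, <- H by trivial; ring.
Qed.

(** * A form of degree [k / r] whose [e]-th power is tied to [finf] by a function of [theta],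
    covering both [fa] and [fb] *)

Section OneForm.

Variables (f Q cc finf Qinf : C -> C) (k e kinf : nat) (cst : C).
Hypothesis Hf : forall z, inH z -> Choloat f z.
Hypothesis HQ : forall t, t <> RtoC 0 -> t <> RtoC 1 -> Q t <> 0.
Hypothesis Hfr : forall z, inH z -> (f z ^ r * Q (theta z))%C = (dtheta z ^ k)%C.
Hypothesis Hfi : forall z, inH z -> Choloat finf z.
Hypothesis HQi : forall t, t <> RtoC 0 -> t <> RtoC 1 -> Qinf t <> 0.
Hypothesis Hfir : forall z, inH z -> (finf z ^ r * Qinf (theta z))%C = (dtheta z ^ kinf)%C.
Hypothesis Hfi0 : forall z, inH z -> finf z <> 0.
Hypothesis Hrel : forall z, inH z -> (cst * f z ^ e)%C = (cc (theta z) * finf z)%C.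
Hypothesis Hcst : cst <> 0.
Hypothesis He : (0 < e)%nat.
Hypothesis Hke : (e * k = kinf)%nat.
Hypothesis Hcop : Nat.gcd e r = 1%nat.

(* [finf] has no zeros, so its multiplier is a continuous [r]-th root of unity on the connected upper half-plane. *)
Lemma form_inf_invariant x : inH (fst x) ->
  form (INR kinf / INR r) finf (Nat.iter r (lift_act g) x) = form (INR kinf / INR r) finf x.
Proof.
intros Hx.
set (F := fun z => (finf (mob (lmat g) z) * Cexp (RtoC (INR kinf / INR r) * llog g z) / finf z)%C).
assert (HFc : forall z, inH z -> continuous F z).
{ intros z Hz; apply continuous_Cmult; [apply transform_cont; trivial|].
  destruct (Hfi z Hz) as [l Hl]; apply (Cderiv_cont _ _ _ (Cderiv_inv _ _ _ Hl (Hfi0 z Hz))). }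
assert (HFr : forall z, inH z -> (F z ^ r)%C = 1).
{ intros z Hz; unfold F, Cdiv; rewrite Cpow_mult_l, Cpow_inv by auto.
  rewrite (transform_pow finf Qinf kinf z Hfi HQi Hfir Hz); field; apply Cpow_nz; auto. }
set (F0 := F (fst x)).
assert (HF : forall n, form (INR kinf / INR r) finf (Nat.iter n (lift_act g) x) = (F0 ^ n * form (INR kinf / INR r) finf x)%C).
{ induction n as [|n IH]; [simpl; ring|].
  assert (Hn := inH_iter g n x lift_det Hx).
  change (Nat.iter (S n) (lift_act g) x) with (lift_act g (Nat.iter n (lift_act g) x)).
  transitivity (F0 * form (INR kinf / INR r) finf (Nat.iter n (lift_act g) x))%C; [|rewrite IH, Cpow_S; ring].
  rewrite form_act; unfold F0; rewrite (roots_const F r _ _ Hr HFc HFr Hx Hn).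
  unfold F, form; field; auto. }
rewrite HF; unfold F0; rewrite HFr by trivial; ring.
Qed.

Lemma form_pow_e x : inH (fst x) ->
  (cst * form (INR k / INR r) f x ^ e)%C = (cc (theta (fst x)) * form (INR kinf / INR r) finf x)%C.
Proof.
intros Hx; unfold form; rewrite Cpow_mult_l, Cexp_pow.
assert (Hr0 : INR r <> 0) by (apply not_0_INR, Nat.neq_sym, Nat.lt_neq, Hr).
replace (RtoC (INR e) * (RtoC (INR k / INR r) * snd x))%C with (RtoC (INR kinf / INR r) * snd x)%C.
- rewrite !Cmult_assoc, Hrel by trivial; reflexivity.
- rewrite <- Hke, mult_INR, !RtoC_div, RtoC_mult by trivial; field; apply RtoC_neq_0; trivial.
Qed.

(* Both the [e]-th powers (via [finf]) and the [r]-th powers of the two sides agree, and [e] is prime to [r]. *)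
Lemma form_invariant x : inH (fst x) ->
  form (INR k / INR r) f (lift_act (lift_pow g r) x) = form (INR k / INR r) f x.
Proof.
intros Hx; rewrite lift_act_pow by (trivial; apply lift_det).
assert (Hth : forall n, theta (fst (Nat.iter n (lift_act g) x)) = theta (fst x)).
{ induction n as [|n IH]; simpl; trivial; rewrite theta_g; trivial; apply inH_iter; trivial; apply lift_det. }
apply (coprime_powers _ _ e r); trivial.
- apply (Cmult_cancel cst); trivial.
  rewrite !form_pow_e, Hth, form_inf_invariant by (trivial; apply inH_iter; trivial; apply lift_det); trivial.
- assert (G : forall n, (form (INR k / INR r) f (Nat.iter n (lift_act g) x) ^ r)%C = (form (INR k / INR r) f x ^ r)%C); [|auto].
  induction n as [|n IH]; [reflexivity|].
  change (Nat.iter (S n) (lift_act g) x) with (lift_act g (Nat.iter n (lift_act g) x)).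
  rewrite form_act, Cpow_mult_l, (transform_pow f Q k), <- Cpow_mult_l by (trivial; apply inH_iter; trivial; apply lift_det).
  exact IH.
Qed.

End OneForm.
End Invariance.

(** * Orbits *)

Lemma psl_mpow M N k : psl_eq M N -> psl_eq (mpow M k) (mpow N k).
Proof. intros H; induction k as [|k IH]; simpl; [apply psl_refl|apply psl_mul; trivial]. Qed.

(** * Moves obtained from the [r]-th power of one generator, for either generator and an abstract
    orbit relation *)

Section Generator.

Variables (O : relation (C * C)) (al : lift) (X : mat2) (n r : nat).
Hypothesis O_refl : forall x, O x x.
Hypothesis O_sym : forall x y, O x y -> O y x.
Hypothesis O_trans : forall x y z, O x y -> O y z -> O x z.
Hypothesis O_step : forall x, inH (fst x) -> O x (lift_act (lift_pow al r) x).
Hypothesis Hal : is_lift al.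
Hypothesis HalX : psl_eq (lmat al) X.
Hypothesis Haln : lift_eq (lift_pow al n) lift_c.
Hypothesis HX : mat_det X = 1.
Hypothesis HXn : mpow X n = mat_opp mat_id.
Hypothesis Hn : (2 <= n)%nat.
Hypothesis Hr : (0 < r)%nat.
Hypothesis Hcop : Nat.gcd n r = 1%nat.

Let Hdet : mat_det (lmat al) = 1 := proj1 Hal.

Lemma O_iter k x : inH (fst x) -> O x (Nat.iter (k * r) (lift_act al) x).
Proof.
intros Hx; induction k as [|k IH]; [apply O_refl|].
apply O_trans with (1 := IH).
change (S k * r)%nat with (r + k * r)%nat; rewrite Nat.iter_add.
assert (Hk := inH_iter al (k * r) x Hdet Hx).
rewrite <- (lift_act_pow al r (Nat.iter (k * r) (lift_act al) x)) by trivial; apply O_step; trivial.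
Qed.

(** With [k * r = 1 + b * n], the power [al^(k r)] covers [X] in PSL_2(R). The shift [s] of the
    logarithmic coordinate is not computed; what matters is that it is the same for all [u]. *)
Lemma O_mob z : inH z -> exists s, forall u, O (z, u) (mob X z, (u + s)%C).
Proof.
intros Hz; destruct (Nat.gcd_bezout_pos r n Hr) as [k [b Hkb]].
rewrite Nat.gcd_comm, Hcop in Hkb.
exists (llog (lift_pow al (k * r)) z); intros u.
assert (H := O_iter k (z, u) Hz); rewrite <- lift_act_pow in H by trivial.
unfold lift_act in H; simpl in H; rewrite lmat_pow in H.
replace (mob X z) with (mob (mpow (lmat al) (k * r)) z); [rewrite Cplus_comm; exact H|].
apply psl_mob; trivial; apply psl_trans with (1 := psl_mpow _ _ _ HalX).
apply psl_trans with (1 := mpow_mod X n _ ltac:(lia) HXn).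
rewrite Hkb, Nat.Div0.mod_add, Nat.mod_1_l by lia; simpl; rewrite mat_mul_id_r; apply psl_refl.
Qed.

Lemma O_shift_Z z s : (forall u, O (z, u) (z, (u + s)%C)) ->
  forall (k : Z) u, O (z, u) (z, (u + RtoC (IZR k) * s)%C).
Proof.
intros H.
assert (G : forall m u, O (z, u) (z, (u + RtoC (INR m) * s)%C)).
{ intros m u; induction m as [|m IH].
  - simpl; replace (u + RtoC 0 * s)%C with u by ring; apply O_refl.
  - apply O_trans with (1 := IH).
    replace (u + RtoC (INR (S m)) * s)%C with (u + RtoC (INR m) * s + s)%C by (rewrite S_INR, RtoC_plus; ring).
    apply H. }
intros k u; destruct (Z_le_dec 0 k) as [Hk|Hk].
- rewrite <- (Z2Nat.id k) by trivial; rewrite <- INR_IZR_INZ; apply G.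
- apply O_sym; replace u with (u + RtoC (IZR k) * s + RtoC (INR (Z.to_nat (- k))) * s)%C at 2; [apply G|].
  rewrite INR_IZR_INZ, Z2Nat.id by lia; rewrite opp_IZR, RtoC_opp; ring.
Qed.

(** [(al^r)^n = (al^n)^r = c^r], which shifts the logarithmic coordinate by [r * 2 pi i] over every
    point. *)
Lemma O_center z : inH z -> forall (k : Z) u, O (z, u) (z, (u + RtoC (IZR k) * (RtoC (INR r) * two_pi_i))%C).
Proof.
intros Hz; apply O_shift_Z; intros u.
assert (H := O_iter n (z, u) Hz); rewrite Nat.mul_comm, iter_mul in H.
assert (G : forall m, Nat.iter m (Nat.iter n (lift_act al)) (z, u) = (z, (u + RtoC (INR m) * two_pi_i)%C)).
{ induction m as [|m IH]; [simpl; f_equal; ring|].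
  change (Nat.iter (S m) (Nat.iter n (lift_act al)) (z, u)) with
    (Nat.iter n (lift_act al) (Nat.iter m (Nat.iter n (lift_act al)) (z, u))).
  rewrite IH, <- lift_act_pow by trivial; destruct Haln as [E1 E2]; unfold lift_act; simpl fst; simpl snd.
  assert (Dc : mat_det (lmat lift_c) = 1) by (unfold mat_det; simpl; ring).
  rewrite E2, (psl_mob _ _ z Dc Hz E1) by trivial.
  unfold lift_c; simpl lmat; simpl llog; rewrite mob_id, S_INR, RtoC_plus; f_equal; ring. }
rewrite G in H; exact H.
Qed.

(** At a fixed point the iterates of [al] add [llog al w] each time, so [al^n = c] forces
    [llog al w = 2 pi i / n]; the stabilizing element [al^r] thus shifts by [r / n] times
    [2 pi i]. *)
Lemma O_fixed w : inH w -> mob X w = w ->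
  forall (k : Z) u, O (w, u) (w, (u + RtoC (IZR k) * (RtoC (INR r / INR n) * two_pi_i))%C).
Proof.
intros Hw HXw.
assert (Hfix : mob (lmat al) w = w) by (rewrite <- HXw at 2; apply psl_mob; trivial).
assert (G : forall m u, Nat.iter m (lift_act al) (w, u) = (w, (u + RtoC (INR m) * llog al w)%C)).
{ intros m u; induction m as [|m IH]; [simpl; f_equal; ring|].
  change (Nat.iter (S m) (lift_act al) (w, u)) with (lift_act al (Nat.iter m (lift_act al) (w, u))).
  rewrite IH; unfold lift_act; simpl fst; simpl snd; rewrite Hfix, S_INR, RtoC_plus; f_equal; ring. }
assert (Hn0 : INR n <> 0) by (apply not_0_INR; lia).
assert (HnC : RtoC (INR n) <> 0) by (apply RtoC_neq_0; trivial).
assert (HL : llog al w = (two_pi_i / RtoC (INR n))%C).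
{ assert (E := G n (RtoC 0)); rewrite <- lift_act_pow in E by trivial.
  destruct Haln as [_ E2]; unfold lift_act in E; simpl fst in E; simpl snd in E; rewrite E2 in E by trivial.
  apply (f_equal snd) in E; simpl in E; unfold lift_c in E; simpl llog in E.
  assert (E' : (RtoC (INR n) * llog al w)%C = two_pi_i).
  { transitivity (RtoC 0 + RtoC (INR n) * llog al w)%C; [ring|rewrite <- E; ring]. }
  rewrite <- E'; field; trivial. }
apply O_shift_Z; intros u.
assert (H := O_iter 1 (w, u) Hw); rewrite Nat.mul_1_l, G, HL in H.
replace (RtoC (INR r / INR n) * two_pi_i)%C with (RtoC (INR r) * (two_pi_i / RtoC (INR n)))%C; [exact H|].
rewrite RtoC_div by trivial; field; trivial.
Qed.

End Generator.

Lemma Cexp_scaled_eq_1 (k : R) (d : C) : k <> 0 -> Cexp (RtoC k * d)%C = 1 ->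
  exists m : Z, d = (RtoC (IZR m) * (RtoC (/ k) * two_pi_i))%C.
Proof.
intros Hk H; destruct (Cexp_eq_1 _ H) as [m Hm]; exists m.
assert (HkC : RtoC k <> 0) by (apply RtoC_neq_0; trivial).
apply (Cmult_cancel (RtoC k)); trivial; rewrite Hm, RtoC_inv by trivial; field; trivial.
Qed.

Lemma form_eq_exp k (f : C -> C) z u v : f z <> 0 -> form k f (z, u) = form k f (z, v) -> Cexp (RtoC k * (v - u))%C = 1.
Proof.
unfold form; simpl; intros Hf H; apply (Cmult_cancel _ _ _ Hf) in H.
replace (RtoC k * (v - u))%C with (RtoC k * v - RtoC k * u)%C by ring; apply Cexp_eq; symmetry; exact H.
Qed.

Lemma bezout_Z (p q : nat) : Nat.gcd p q = 1%nat -> (0 < p)%nat -> exists a b : Z, (a * Z.of_nat p + b * Z.of_nat q = 1)%Z.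
Proof.
intros Hg Hp; destruct (Nat.gcd_bezout_pos p q Hp) as [a [b H]]; rewrite Hg in H.
exists (Z.of_nat a), (- Z.of_nat b)%Z; lia.
Qed.

(** * Invariance, injectivity, surjectivity and local inverses of [Psi] *)

Theorem mainTheorem1
  (p q : nat) (Hp : (2 <= p)%nat) (Hpq : (p < q)%nat) (Hcop : Nat.gcd p q = 1%nat)
  (* alpha, beta : the lifts of alpha0, beta0 with alpha^p = beta^q = c *)
  (alpha beta : lift)
  (Halpha : is_lift alpha /\ psl_eq (lmat alpha) (A0 p)
            /\ lift_eq (lift_pow alpha p) lift_c)
  (Hbeta : is_lift beta /\ psl_eq (lmat beta) (B0 q)
            /\ lift_eq (lift_pow beta q) lift_c)
  (* theta and its derivative *)
  (theta dtheta : C -> C)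
  (Htheta_hol : forall z, inH z -> Cderiv theta z (dtheta z))
  (Htheta_inv : forall z, inH z ->
       theta (mob (A0 p) z) = theta z /\ theta (mob (B0 q) z) = theta z)
  (Htheta_surj : forall w : C, exists z, inH z /\ theta z = w)
  (Htheta_inj : forall z1 z2, inH z1 -> inH z2 -> theta z1 = theta z2 ->
       Gamma_orb p q z1 z2)
  (Htheta_a : theta (pt_a p) = RtoC 0)
  (Htheta_b : theta (pt_b q) = RtoC 1)
  (* holomorphic branches f_a, f_b, f_infty *)
  (fa fb finf : C -> C)
  (Hfa_hol : forall z, inH z -> Choloat fa z)
  (Hfb_hol : forall z, inH z -> Choloat fb z)
  (Hfinf_hol : forall z, inH z -> Choloat finf z)
  (Hfa : forall z, inH z ->
     (fa z ^ rpq p q * (theta z * (theta z - RtoC 1) ^ (q - 1)))%C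
       = (dtheta z ^ q)%C)
  (Hfb : forall z, inH z ->
     (fb z ^ rpq p q * (theta z ^ (p - 1) * (theta z - RtoC 1)))%C
       = (dtheta z ^ p)%C)
  (Hfinf : forall z, inH z ->
     (finf z ^ rpq p q * (theta z ^ ((p - 1) * q) * (theta z - RtoC 1) ^ (p * (q - 1))))%C
       = (dtheta z ^ (p * q))%C)
  (* the nonzero constants with omega_infty = c_a omega_a^p + c_b omega_b^q *)
  (ca cb : C) (Hca : ca <> RtoC 0) (Hcb : cb <> RtoC 0)
  (Hcacb : forall z, inH z -> finf z = (ca * fa z ^ p + cb * fb z ^ q)%C) :
  let G_orb := orb2 (lift_pow alpha (rpq p q)) (lift_pow beta (rpq p q)) in
  let notV := fun y : C * C => (cb * fst y ^ q + ca * snd y ^ p)%C <> RtoC 0 in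
  (* Psi is constant on G-orbits *)
  (forall x y, inH (fst x) -> G_orb x y -> Psi p q fa fb x = Psi p q fa fb y) /\
  (* the image avoids V *)
  (forall x, inH (fst x) -> notV (Psi p q fa fb x)) /\
  (* the induced map M -> C^2 \ V is injective *)
  (forall x y, inH (fst x) -> inH (fst y) ->
     Psi p q fa fb x = Psi p q fa fb y -> G_orb x y) /\
  (* ... surjective *)
  (forall y, notV y -> exists x, inH (fst x) /\ Psi p q fa fb x = y) /\
  (* ... holomorphic *)
  (forall x, inH (fst x) -> holo2_at (Psi p q fa fb) x) /\
  (* ... with holomorphic inverse: local holomorphic sections of Psi *)
  (forall y, notV y -> exists eps : posreal, exists s : C * C -> C * C,
     forall y', C2dist y y' < eps ->
       inH (fst (s y')) /\ Psi p q fa fb (s y') = y' /\ holo2_at s y').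
Proof.
intros G_orb notV.
assert (Hq : (2 <= q)%nat) by lia.
destruct Halpha as [Al1 [Al2 Al3]]; destruct Hbeta as [Be1 [Be2 Be3]].
destruct (r_spec p q Hp Hpq) as [Hr0 [Hr1 Hr2]].
assert (Hth : forall z, inH z -> Choloat theta z) by (intros z Hz; exists (dtheta z); exact (Htheta_hol z Hz)).
assert (Hrel := form_relation p q Hp Hpq theta dtheta fa fb finf ca cb Htheta_hol Htheta_inv Htheta_inj Htheta_a Htheta_b
  Hfa_hol Hfb_hol Hfinf_hol Hfa Hfb Hfinf Hcacb).
assert (Hnz := finf_nz p q Hp Hpq theta dtheta fa fb finf ca cb Htheta_hol Htheta_inv Htheta_inj Htheta_a Htheta_b
  Hfa_hol Hfb_hol Hfinf_hol Hfa Hfb Hfinf Hca Hcb Hcacb).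
assert (Hwr := wronskian_nz p q Hp Hpq theta dtheta fa fb finf ca cb Htheta_hol Htheta_inv Htheta_inj Htheta_a Htheta_b
  Hfa_hol Hfb_hol Hfinf_hol Hfa Hfb Hfinf Hcacb).
assert (Hiso := theta_isolated p q Hp Hq theta Hth Htheta_a Htheta_b).
set (r := rpq p q) in *.
(* A common divisor of [p] and [r] divides [p * (q - 1) - r = q]. *)
assert (Hcp : Nat.gcd p r = 1%nat).
{ apply Nat.divide_1_r; rewrite <- Hcop; apply Nat.gcd_greatest; [apply Nat.gcd_divide_l|].
  apply (Nat.divide_add_cancel_r _ r); [apply Nat.gcd_divide_r|].
  rewrite Nat.add_comm, <- Hr2; apply Nat.divide_mul_l, Nat.gcd_divide_l. }
assert (Hcq : Nat.gcd q r = 1%nat).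
{ apply Nat.divide_1_r; rewrite <- Hcop; apply Nat.gcd_greatest; [|apply Nat.gcd_divide_l].
  apply (Nat.divide_add_cancel_r _ r); [apply Nat.gcd_divide_r|].
  rewrite Nat.add_comm, <- Hr1; apply Nat.divide_mul_r, Nat.gcd_divide_l. }
assert (Hpr : INR p <> 0) by (apply not_0_INR; lia).
assert (Hqr : INR q <> 0) by (apply not_0_INR; lia).
assert (Hrr : INR r <> 0) by (apply not_0_INR; lia).
assert (HQa : forall t : C, t <> RtoC 0 -> t <> RtoC 1 -> (t * (t - RtoC 1) ^ (q - 1))%C <> 0).
{ intros t H0 H1; apply Cmult_neq_0; trivial; apply Cpow_nz, Cmod_gt_0, Cmod_sub_pos; trivial. }
assert (HQb : forall t : C, t <> RtoC 0 -> t <> RtoC 1 -> (t ^ (p - 1) * (t - RtoC 1))%C <> 0).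
{ intros t H0 H1; apply Cmult_neq_0; [apply Cpow_nz; trivial|apply Cmod_gt_0, Cmod_sub_pos; trivial]. }
assert (HQi : forall t : C, t <> RtoC 0 -> t <> RtoC 1 -> (t ^ ((p - 1) * q) * (t - RtoC 1) ^ (p * (q - 1)))%C <> 0).
{ intros t H0 H1; apply Cmult_neq_0; apply Cpow_nz; trivial; apply Cmod_gt_0, Cmod_sub_pos; trivial. }
assert (Hra : forall z, inH z -> (ca * fa z ^ p)%C = (theta z * finf z)%C) by (intros; apply Hrel; trivial).
assert (Hrb : forall z, inH z -> (cb * fb z ^ q)%C = ((1 - theta z) * finf z)%C) by (intros; apply Hrel; trivial).
(* The power tied to [finf] is the [q]-th for [fb] and the [p]-th for [fa], both prime to [r]. *)
assert (Hinv : forall g x, is_lift g -> (forall z, inH z -> theta (mob (lmat g) z) = theta z) -> inH (fst x) ->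
  Psi p q fa fb (lift_act (lift_pow g r) x) = Psi p q fa fb x).
{ intros g x Hg Hthg Hx; unfold Psi; fold r; f_equal.
  - exact (form_invariant r theta dtheta g Hr0 Htheta_hol Hiso Hg Hthg fb _ (fun t => (1 - t)%C) finf _ p q (p * q)%nat cb
      Hfb_hol HQb Hfb Hfinf_hol HQi Hfinf Hnz Hrb Hcb ltac:(lia) ltac:(lia) Hcq x Hx).
  - exact (form_invariant r theta dtheta g Hr0 Htheta_hol Hiso Hg Hthg fa _ (fun t => t) finf _ q p (p * q)%nat ca
      Hfa_hol HQa Hfa Hfinf_hol HQi Hfinf Hnz Hra Hca ltac:(lia) ltac:(lia) Hcp x Hx). }
assert (HthA : forall z, inH z -> theta (mob (lmat alpha) z) = theta z).
{ intros z Hz; rewrite (psl_mob _ _ z (det_A p) Hz Al2); apply Htheta_inv; trivial. }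
assert (HthB : forall z, inH z -> theta (mob (lmat beta) z) = theta z).
{ intros z Hz; rewrite (psl_mob _ _ z (det_B q) Hz Be2); apply Htheta_inv; trivial. }
assert (P1 : forall x y, G_orb x y -> Psi p q fa fb x = Psi p q fa fb y).
{ intros x y H; induction H as [x y [Hx [->| ->]]|x|x y _ IH|x y z _ IH1 _ IH2]; auto.
  - symmetry; apply Hinv; trivial.
  - symmetry; apply Hinv; trivial.
  - congruence. }
assert (Hfpa : forall x, inH (fst x) -> (ca * snd (Psi p q fa fb x) ^ p)%C = (theta (fst x) * form (INR (p * q) / INR r) finf x)%C).
{ intros x Hx; exact (form_pow_e r theta Hr0 fa (fun t => t) finf q p (p * q)%nat ca Hra ltac:(lia) x Hx). }
assert (Hfpb : forall x, inH (fst x) -> (cb * fst (Psi p q fa fb x) ^ q)%C = ((1 - theta (fst x)) * form (INR (p * q) / INR r) finf x)%C).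
{ intros x Hx; exact (form_pow_e r theta Hr0 fb (fun t => 1 - t)%C finf p q (p * q)%nat cb Hrb ltac:(lia) x Hx). }
assert (Hfi : forall x, inH (fst x) -> (cb * fst (Psi p q fa fb x) ^ q + ca * snd (Psi p q fa fb x) ^ p)%C = form (INR (p * q) / INR r) finf x).
{ intros x Hx; rewrite Hfpa, Hfpb by trivial; ring. }
assert (Hfinz : forall x, inH (fst x) -> form (INR (p * q) / INR r) finf x <> 0).
{ intros x Hx; apply Cmult_neq_0; [auto|apply Cexp_neq_0]. }
assert (P2 : forall x, inH (fst x) -> notV (Psi p q fa fb x)).
{ intros x Hx; unfold notV; rewrite Hfi; auto. }
assert (Orefl : forall x, G_orb x x) by (intros x; apply rst_refl).
assert (Osym : forall x y, G_orb x y -> G_orb y x) by (intros x y; apply rst_sym).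
assert (Otrans : forall x y z, G_orb x y -> G_orb y z -> G_orb x z) by (intros x y z; apply rst_trans).
assert (OstA : forall x, inH (fst x) -> G_orb x (lift_act (lift_pow alpha r) x)) by (intros x Hx; apply rst_step; auto).
assert (OstB : forall x, inH (fst x) -> G_orb x (lift_act (lift_pow beta r) x)) by (intros x Hx; apply rst_step; auto).
(* [G] moves a point of the half-plane along its whole triangle group orbit, at the price of a shift
   of the logarithmic coordinate independent of [u]. *)
assert (Horb : forall z w, Gamma_orb p q z w -> exists s, forall u, G_orb (z, u) (w, (u + s)%C)).
{ intros z w H; induction H as [z w [Hz [->| ->]]|z|z w _ [s IH]|z w v _ [s1 IH1] _ [s2 IH2]].
  - apply (O_mob G_orb alpha (A0 p) p r); trivial; [apply det_A|apply A_p; trivial].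
  - apply (O_mob G_orb beta (B0 q) q r); trivial; [apply det_B|apply B_q; trivial].
  - exists (RtoC 0); intros u; replace (u + RtoC 0)%C with u by ring; auto.
  - exists (- s)%C; intros u; apply Osym; replace u with (u + - s + s)%C at 2 by ring; auto.
  - exists (s1 + s2)%C; intros u; apply Otrans with (1 := IH1 u).
    replace (u + (s1 + s2))%C with (u + s1 + s2)%C by ring; auto. }
assert (Hfab : forall z, inH z -> fa z = 0 -> fb z <> 0).
{ intros z Hz Ea Eb; apply (Hnz z Hz); rewrite Hcacb, Ea, Eb, !Cpow_0_l by (trivial; lia); ring. }
assert (Hkp : INR p / INR r <> 0) by (apply Rmult_integral_contrapositive_currified; trivial; apply Rinv_neq_0_compat; trivial).
assert (Hkq : INR q / INR r <> 0) by (apply Rmult_integral_contrapositive_currified; trivial; apply Rinv_neq_0_compat; trivial).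
destruct (bezout_Z p q Hcop ltac:(lia)) as [ba [bb Hbez]].
assert (Hbez' : IZR ba * INR p + IZR bb * INR q = 1).
{ rewrite !INR_IZR_INZ, <- !mult_IZR, <- plus_IZR, Hbez; reflexivity. }
assert (P3 : forall x y, inH (fst x) -> inH (fst y) -> Psi p q fa fb x = Psi p q fa fb y -> G_orb x y).
{ intros [z1 u1] [z2 u2] Hz1 Hz2 E; simpl fst in Hz1, Hz2.
  assert (Ei : form (INR (p * q) / INR r) finf (z1, u1) = form (INR (p * q) / INR r) finf (z2, u2)).
  { rewrite <- !Hfi, E; trivial. }
  (* [theta] is the quotient of [ca] times the [p]-th power of the second coordinate by the value of
     the form of [finf], and both are functions of the value of [Psi]. *)
  assert (Et : theta z1 = theta z2).
  { apply (Cmult_cancel (form (INR (p * q) / INR r) finf (z1, u1))); [apply Hfinz; trivial|].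
    assert (T1 := Hfpa (z1, u1) Hz1); assert (T2 := Hfpa (z2, u2) Hz2); simpl fst in T1, T2.
    rewrite E, T2 in T1; rewrite Cmult_comm, <- T1, Ei; ring. }
  destruct (Horb z1 z2 (Htheta_inj z1 z2 Hz1 Hz2 Et)) as [s Hs].
  apply Otrans with (1 := Hs u1); set (v := (u1 + s)%C).
  assert (E' : Psi p q fa fb (z2, v) = Psi p q fa fb (z2, u2)) by (rewrite <- E; symmetry; apply P1, Hs).
  unfold Psi in E'; fold r in E'; assert (Eb := f_equal fst E'); assert (Ea := f_equal snd E'); simpl in Ea, Eb.
  (* Going from [z2] to the elliptic point [w], shifting by [c] there and coming back amounts to the
     shift by [c] over [z2], because the shift of the connecting move does not depend on the
     logarithmic coordinate. *)
  assert (Hfix : forall w c, inH w -> theta z2 = theta w ->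
     (forall u, G_orb (w, u) (w, (u + c)%C)) -> u2 = (v + c)%C -> G_orb (z2, v) (z2, u2)).
  { intros w c Hw Hthw Hc Hv; destruct (Horb z2 w (Htheta_inj z2 w Hz2 Hw Hthw)) as [s' Hs'].
    apply Otrans with (1 := Hs' v); apply Otrans with (1 := Hc (v + s')%C).
    apply Osym; replace (v + s' + c)%C with (u2 + s')%C by (rewrite Hv; ring); apply Hs'. }
  (* A vanishing form says nothing about [u2 - v]. The finer lattice of admissible shifts is then
     matched by the stabilizer of the elliptic point; if neither form vanishes, the center
     suffices. *)
  destruct (Ceq_dec (fa z2) 0) as [Za|Za]; [|destruct (Ceq_dec (fb z2) 0) as [Zb|Zb]].
  - assert (Zt : theta z2 = 0).
    { apply (Cmult_cancel (finf z2)); [auto|]; rewrite Cmult_comm, <- Hra, Za, Cpow_0_l by (trivial; lia); ring. }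
    destruct (Cexp_scaled_eq_1 _ _ Hkp (form_eq_exp _ _ _ _ _ (Hfab z2 Hz2 Za) Eb)) as [m Hm].
    apply (Hfix (pt_a p) (RtoC (IZR m) * (RtoC (INR r / INR p) * two_pi_i))%C).
    + apply pt_a_inH; trivial.
    + congruence.
    + intros u; apply (O_fixed G_orb alpha (A0 p) p r); trivial; [apply det_A|apply pt_a_inH; trivial|apply mob_a; trivial].
    + replace (INR r / INR p) with (/ (INR p / INR r)) by (field; auto); rewrite <- Hm; ring.
  - assert (Zt : theta z2 = 1).
    { assert (Z0 : (1 - theta z2)%C = 0).
      { apply (Cmult_cancel (finf z2)); [auto|]; rewrite Cmult_comm, <- Hrb, Zb, Cpow_0_l by (trivial; lia); ring. }
      transitivity (1 - (1 - theta z2))%C; [ring|rewrite Z0; ring]. }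
    destruct (Cexp_scaled_eq_1 _ _ Hkq (form_eq_exp _ _ _ _ _ Za Ea)) as [m Hm].
    apply (Hfix (pt_b q) (RtoC (IZR m) * (RtoC (INR r / INR q) * two_pi_i))%C).
    + apply pt_b_inH; trivial.
    + congruence.
    + intros u; apply (O_fixed G_orb beta (B0 q) q r); trivial; [apply det_B|apply pt_b_inH; trivial|apply mob_b; trivial].
    + replace (INR r / INR q) with (/ (INR q / INR r)) by (field; auto); rewrite <- Hm; ring.
  (* Here [q / r] and [p / r] times [u2 - v] are the integral multiples [ma] and [mb] of [2 pi i];
     the Bezout combination of the two equations makes [u2 - v] a multiple of [r * 2 pi i]. *)
  - destruct (Cexp_eq_1 _ (form_eq_exp _ _ _ _ _ Za Ea)) as [ma Hma].
    destruct (Cexp_eq_1 _ (form_eq_exp _ _ _ _ _ Zb Eb)) as [mb Hmb].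
    replace u2 with (v + RtoC (IZR (ba * mb + bb * ma)) * (RtoC (INR r) * two_pi_i))%C.
    + apply (O_center G_orb alpha p r); trivial.
    + rewrite plus_IZR, !mult_IZR, RtoC_plus, !RtoC_mult.
      transitivity (v + RtoC (INR r) * (RtoC (IZR ba) * (RtoC (IZR mb) * two_pi_i) + RtoC (IZR bb) * (RtoC (IZR ma) * two_pi_i)))%C; [ring|].
      rewrite <- Hma, <- Hmb, !RtoC_div by trivial.
      transitivity (v + RtoC (IZR ba * INR p + IZR bb * INR q) * (u2 - v))%C.
      * rewrite RtoC_plus, !RtoC_mult; field; apply RtoC_neq_0; trivial.
      * rewrite Hbez'; ring. }
assert (Hroot : forall (x y : C) n, (0 < n)%nat -> (x ^ n)%C = (y ^ n)%C ->
   exists k : Z, (x * Cexp (RtoC (IZR k / INR n) * two_pi_i))%C = y).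
{ intros x y n Hn E; destruct (Ceq_dec x 0) as [->|Hx].
  - exists 0%Z; transitivity (RtoC 0); [ring|symmetry].
    apply (Cpow_eq_0 _ n); rewrite <- E; apply Cpow_0_l; trivial.
  - destruct (root_of_unity (y / x)%C n Hn) as [k Hk].
    + unfold Cdiv; rewrite Cpow_mult_l, Cpow_inv, E by trivial; field; rewrite <- E; apply Cpow_nz; trivial.
    + exists k; rewrite <- Hk; field; trivial. }
assert (P4 : forall y, notV y -> exists x, inH (fst x) /\ Psi p q fa fb x = y).
{ intros [y1 y2] Hy; unfold notV in Hy; simpl in Hy.
  set (D := (cb * y1 ^ q + ca * y2 ^ p)%C) in *.
  (* The relation [ca A^p = theta F] leaves no other value for [theta z], as [F] must take the value
     [D]. *)
  destruct (Htheta_surj (ca * y2 ^ p / D)%C) as [z [Hz Ez]].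
  destruct (Cexp_surj (D / finf z)%C) as [w Hw].
  { apply Cmult_neq_0; [trivial|apply Cinv_neq_0; auto]. }
  assert (HpqR : INR (p * q) <> 0) by (apply not_0_INR; nia).
  (* Solves the equation for the form of [finf]. The other two forms then have the right [p]-th and
     [q]-th powers, hence the right values up to roots of unity. *)
  set (u0 := (RtoC (INR r / INR (p * q)) * w)%C).
  assert (Ei : form (INR (p * q) / INR r) finf (z, u0) = D).
  { unfold form; simpl fst; simpl snd.
    replace (RtoC (INR (p * q) / INR r) * u0)%C with w; [rewrite Hw; field; auto|].
    unfold u0; rewrite !RtoC_div by trivial; field; split; apply RtoC_neq_0; trivial. }
  assert (Ea := Hfpa (z, u0) Hz); assert (Eb := Hfpb (z, u0) Hz).
  simpl fst in Ea, Eb; simpl snd in Ea; rewrite Ei, Ez in Ea, Eb; fold r in Ea, Eb.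
  assert (Ea' : (form (INR q / INR r) fa (z, u0) ^ p)%C = (y2 ^ p)%C).
  { apply (Cmult_cancel ca); trivial; rewrite Ea; field; trivial. }
  assert (Eb' : (form (INR p / INR r) fb (z, u0) ^ q)%C = (y1 ^ q)%C).
  { apply (Cmult_cancel cb); trivial; rewrite Eb.
    transitivity (D - ca * y2 ^ p)%C; [field; trivial|unfold D; ring]. }
  destruct (Hroot _ _ p ltac:(lia) Ea') as [ka Hka]; destruct (Hroot _ _ q ltac:(lia) Eb') as [kb Hkb].
  (* [K = ka] modulo [p] and [K = kb] modulo [q]. *)
  set (K := (ka * bb * Z.of_nat q + kb * ba * Z.of_nat p)%Z).
  exists (z, (u0 + RtoC (INR r / INR (p * q)) * (RtoC (IZR K) * two_pi_i))%C); split; [trivial|].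
  (* Shifting by [(r / (p q)) * K * 2 pi i] leaves the form of [finf] unchanged and multiplies a
     form of degree [k / r], where [n * k = p * q], by [e^(2 pi i K / n)], which depends on [K]
     modulo [n] only. *)
  assert (Hsh : forall k (f : C -> C) c c' n, (n * k = p * q)%nat -> (0 < n)%nat -> K = (c + c' * Z.of_nat n)%Z ->
     form (INR k / INR r) f (z, (u0 + RtoC (INR r / INR (p * q)) * (RtoC (IZR K) * two_pi_i))%C) =
     (form (INR k / INR r) f (z, u0) * Cexp (RtoC (IZR c / INR n) * two_pi_i))%C).
  { intros k f c c' n Hnk Hn HK; unfold form; simpl fst; simpl snd.
    assert (Hn0 : INR n <> 0) by (apply not_0_INR; lia).
    replace (RtoC (INR k / INR r) * (u0 + RtoC (INR r / INR (p * q)) * (RtoC (IZR K) * two_pi_i)))%C with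
      (RtoC (INR k / INR r) * u0 + (RtoC (IZR c / INR n) * two_pi_i + RtoC (IZR c') * two_pi_i))%C.
    - rewrite !Cexp_plus, Cexp_2PI_Z; ring.
    - rewrite Cmult_plus_distr_l; f_equal; rewrite HK, plus_IZR, mult_IZR, <- INR_IZR_INZ.
      assert (Hk0 : INR k <> 0) by (apply not_0_INR; nia).
      rewrite <- Hnk, mult_INR.
      rewrite !Cmult_assoc, <- !RtoC_mult, <- Cmult_plus_distr_r, <- RtoC_plus; f_equal; f_equal; field; auto. }
  unfold Psi; fold r; f_equal.
  - rewrite (Hsh p fb kb (bb * (ka - kb))%Z q), Hkb; trivial; try lia.
    unfold K; replace ba with (ba * 1)%Z by ring.
    transitivity (kb * (ba * Z.of_nat p) + ka * bb * Z.of_nat q)%Z; [ring|].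
    replace (ba * Z.of_nat p)%Z with (1 - bb * Z.of_nat q)%Z by lia; ring.
  - rewrite (Hsh q fa ka (ba * (kb - ka))%Z p), Hka; trivial; try lia.
    unfold K; transitivity (ka * (bb * Z.of_nat q) + kb * ba * Z.of_nat p)%Z; [ring|].
    replace (bb * Z.of_nat q)%Z with (1 - ba * Z.of_nat p)%Z by lia; ring. }
split; [intros x y _; apply P1|]; split; [trivial|]; split; [trivial|]; split; [trivial|]; split.
{ intros x Hx; apply holo2_pair; apply form_D2; auto. }
intros y Hy; destruct (P4 y Hy) as [[z u] [Hz Ey]]; simpl fst in Hz.
destruct (Hfa_hol z Hz) as [a Ha]; destruct (Hfb_hol z Hz) as [b Hb].
assert (HW := Hwr z a b Hz Ha Hb).
assert (HrC : RtoC (INR r) <> 0) by (apply RtoC_neq_0; trivial).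
assert (Da : holo_disc fa z (Im z)) by (intros w Hw; apply Hfa_hol, (inH_disc z); trivial).
assert (Db : holo_disc fb z (Im z)) by (intros w Hw; apply Hfb_hol, (inH_disc z); trivial).
assert (Ey1 : form (INR p / INR r) fb (z, u) = fst y) by (rewrite <- Ey; reflexivity).
assert (Ey2 : form (INR q / INR r) fa (z, u) = snd y) by (rewrite <- Ey; reflexivity).
(* [local_section] takes a logarithm of its first function, which must not vanish at [z]. The two
   forms have no common zero, so at worst the coordinates are exchanged. *)
destruct (Ceq_dec (fb z) 0) as [Zb|Zb].
- assert (Za : fa z <> 0) by (intros Za; apply (Hfab z Hz Za Zb)).
  destruct (local_section fa fb z u (Im z) (INR q / INR r) (INR p / INR r) a b) as [eps [s Hs]]; trivial.
  { replace (RtoC (INR q / INR r) * b * fa z - RtoC (INR p / INR r) * fb z * a)%C with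
      (- (/ RtoC (INR r)) * (RtoC (INR p) * a * fb z - RtoC (INR q) * fa z * b))%C
      by (rewrite !RtoC_div by trivial; field; trivial).
    apply Cmult_neq_0; trivial; intros E; apply (Cinv_neq_0 _ HrC).
    transitivity (- - / RtoC (INR r))%C; [ring|rewrite E; ring]. }
  exists eps, (fun y => s (snd y, fst y)); intros y' Hy'.
  rewrite Ey1, Ey2 in Hs; destruct (Hs (snd y', fst y')) as [S1 [S2 [S3 S4]]].
  { eapply Rle_lt_trans; [apply Rmax_r|exact Hy']. }
  { eapply Rle_lt_trans; [apply Rmax_l|exact Hy']. }
  split; [apply (inH_disc z); trivial|]; split; [unfold Psi; fold r; rewrite S2, S3; destruct y'; reflexivity|].
  apply (ex_filterdiff_comp' (U := Defs.C2) (V := Defs.C2) (W := Defs.C2) (fun y => (snd y, fst y)) s); trivial.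
  apply holo2_pair; [apply D2_snd|apply D2_fst].
- destruct (local_section fb fa z u (Im z) (INR p / INR r) (INR q / INR r) b a) as [eps [s Hs]]; trivial.
  { replace (RtoC (INR p / INR r) * a * fb z - RtoC (INR q / INR r) * fa z * b)%C with
      (/ RtoC (INR r) * (RtoC (INR p) * a * fb z - RtoC (INR q) * fa z * b))%C
      by (rewrite !RtoC_div by trivial; field; trivial).
    apply Cmult_neq_0; trivial; apply Cinv_neq_0; trivial. }
  exists eps, s; intros y' Hy'.
  rewrite Ey1, Ey2 in Hs; destruct (Hs y') as [S1 [S2 [S3 S4]]].
  { eapply Rle_lt_trans; [apply Rmax_l|exact Hy']. }
  { eapply Rle_lt_trans; [apply Rmax_r|exact Hy']. }
  split; [apply (inH_disc z); trivial|]; split; [|trivial].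
  unfold Psi; fold r; rewrite S2, S3; destruct y'; reflexivity.
Qed.
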